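(* Let $\mathbb{R}^N_\epsilon$ be a Weyl chamber. Let $1<p<N+2\gamma$ and $q=\frac{p(N+2\gamma)}{N+2\gamma-p}$, and let $p'$ be given by $\frac1p+\frac1{p'}=1$. Then the best constant $C$ in the Sobolev inequality $$\left(\int_{\mathbb{R}^N_\epsilon}|f|^q\,d\mu_k\right)^{1/q}\le C\left(\int_{\mathbb{R}^N_\epsilon}|\nabla f|^p\,d\mu_k\right)^{1/p}\qquad\text{for all } f\in C_c^1(\overline{\mathbb{R}^N_\epsilon})$$ is $$C_W=(N+2\gamma)^{-1/p}\left(\frac{p-1}{N+2\gamma-p}\right)^{1/p'}\left[\frac{2^{\frac{N+2\gamma}2-1}\,p'\,|G|}{M_k}\,\frac{\Gamma(N+2\gamma)\,\Gamma((N+2\gamma)/2)}{\Gamma((N+2\gamma)/p)\,\Gamma((N+2\gamma)/p')}\right]^{\frac1{N+2\gamma}}.$$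
   Context: Fix $N\ge 1$ and a root system $R\subset\mathbb{R}^N\setminus\{0\}$, i.e. a finite set with $R\cap\mathbb{R}\alpha=\{-\alpha,\alpha\}$ and $\sigma_\alpha(R)=R$ for all $\alpha\in R$, where $\sigma_\alpha x=x-2\frac{\langle\alpha,x\rangle}{\langle\alpha,\alpha\rangle}\alpha$. Normalise $|\alpha|^2=2$ for all $\alpha\in R$. Let $G$ be the finite group generated by the reflections $\sigma_\alpha$, of order $|G|$, let $R=R_+\sqcup(-R_+)$ with $R_+$ a positive subsystem, and let $k:R\to[0,\infty)$ be $G$-invariant, $k_\alpha:=k(\alpha)$. Put $\gamma=\sum_{\alpha\in R_+}k_\alpha$, $w_k(x)=\prod_{\alpha\in R_+}|\langle\alpha,x\rangle|^{2k_\alpha}$, $d\mu_k=w_k(x)\,dx$, $M_k=\int_{\mathbb{R}^N}e^{-|x|^2/2}\,d\mu_k(x)$. For $\epsilon:R_+\to\{-1,1\}$ let $\mathbb{R}^N_\epsilon=\{x:\operatorname{sgn}\langle\alpha,x\rangle=\epsilon(\alpha)\ \forall\alpha\in R_+\}$; the Weyl chambers (connected components of $\mathbb{R}^N\setminus\{x:\langle\alpha,x\rangle=0\text{ for some }\alpha\in R\}$) are exactly the non-empty sets $\mathbb{R}^N_\epsilon$. $C_c^1(\overline{\mathbb{R}^N_\epsilon})$ is the space of $C^1$ functions on the closed chamber with compact support (not required to vanish on the boundary of the chamber). $\nabla$ is the usual gradient; in the claim $\Gamma(\cdot)$ is the Euler gamma function. ''Best constant'' means the supremum of the quotient of the left integral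 norm by the right integral norm over non-zero $f$. *)

(* Defs.v *)
From HB Require Import structures.
From mathcomp Require Import all_boot all_order all_algebra finmap.
From mathcomp Require Import all_classical all_reals all_analysis.

Set Implicit Arguments.
Unset Strict Implicit.
Unset Printing Implicit Defensive.
Import Order.TTheory GRing.Theory Num.Theory.
Import numFieldNormedType.Exports.
Local Open Scope classical_set_scope.
Local Open Scope ring_scope.

Definition measure_rV_display : measure_display.
Proof. exact: default_measure_display. Qed.

Section measurable_rV.
Context {R : realType} (n : nat).

Let coors : 'I_n -> 'rV[R]_n -> measurableTypeR R := fun i x => x ord0 i.

Let rV_set0 : g_sigma_preimage coors set0.
Proof. exact: sigma_algebra0. Qed.

Let rV_setC A : g_sigma_preimage coors A -> g_sigma_preimage coors (~` A).
Proof. exact: sigma_algebraC. Qed.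

Let rV_bigcup (F : (set 'rV[R]_n)^nat) :
  (forall i, g_sigma_preimage coors (F i)) ->
  g_sigma_preimage coors (\bigcup_i (F i)).
Proof. exact: sigma_algebra_bigcup. Qed.

(* product sigma-algebra, i.e. the Borel sets of R^n *)
HB.instance Definition _ := @isMeasurable.Build measure_rV_display
  'rV[R]_n (g_sigma_preimage coors) rV_set0 rV_setC rV_bigcup.

Lemma measurable_coor (i : 'I_n) :
  measurable_fun [set: 'rV[R]_n] (fun x => x ord0 i : measurableTypeR R).
Proof.
move=> _ Y mY; rewrite setTI; apply: sub_sigma_algebra => /=.
rewrite -bigcup_seq/=; exists i => /=; first by rewrite mem_index_enum.
by exists Y => //; rewrite setTI.
Qed.

Lemma measurable_fun_rVP d (T : measurableType d) (f : T -> 'rV[R]_n) :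
  (forall i, measurable_fun [set: T] (fun x => f x ord0 i : measurableTypeR R))
  -> measurable_fun [set: T] f.
Proof.
move=> mf _ A mA; rewrite setTI.
have : preimage_set_system [set: T] f (g_sigma_preimage coors) (f @^-1` A).
  by exists A => //; rewrite setTI.
rewrite -g_sigma_preimage_comp; move: (f @^-1` A).
apply: smallest_sub; first exact: sigma_algebra_measurable.
by rewrite -bigcup_seq => B [i _ [C mC <-]]; exact: mf.
Qed.

End measurable_rV.

Section lebesgue_rV.
Context {R : realType}.

Definition cons_rV n (z : measurableTypeR R * 'rV[R]_n) : 'rV[R]_n.+1 :=
  \row_i (if unlift ord0 i is Some j then z.2 ord0 j else z.1).

Definition uncons_rV n (x : 'rV[R]_n.+1) : measurableTypeR R * 'rV[R]_n :=
  (x ord0 ord0, \row_j x ord0 (lift ord0 j)).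

Lemma cons_rVK n : cancel (@cons_rV n) (@uncons_rV n).
Proof.
move=> [a x]; rewrite /uncons_rV /cons_rV mxE unlift_none /=; congr pair.
by apply/rowP => j; rewrite !mxE liftK.
Qed.

Lemma measurable_cons_rV n : measurable_fun setT (@cons_rV n).
Proof.
apply: measurable_fun_rVP => i; rewrite /cons_rV.
case: (unliftP ord0 i) => [j ->|->].
  under eq_fun do rewrite mxE liftK.
  exact: measurableT_comp (measurable_coor j) measurable_snd.
by under eq_fun do rewrite mxE unlift_none; exact: measurable_fst.
Qed.

Lemma measurable_uncons_rV n : measurable_fun setT (@uncons_rV n).
Proof.
apply/measurable_fun_pairP; split; first exact: measurable_coor.
apply: measurable_fun_rVP => j; rewrite /uncons_rV/=.
by under eq_fun do rewrite mxE; exact: measurable_coor.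
Qed.

Section step.
Variables (n : nat) (mu : {sigma_finite_measure set 'rV[R]_n -> \bar R}).

Definition lebesgue_rV_step : set 'rV[R]_n.+1 -> \bar R :=
  pushforward ((@lebesgue_measure R) \x mu)%E (@cons_rV n).

Let prod : {measure set (measurableTypeR R * 'rV[R]_n)%type -> \bar R} :=
  ((@lebesgue_measure R) \x mu)%E.

Let step0 : lebesgue_rV_step set0 = 0%E.
Proof. by rewrite /lebesgue_rV_step /pushforward preimage_set0 measure0. Qed.

Let step_ge0 A : (0 <= lebesgue_rV_step A)%E.
Proof. exact: (measure_ge0 prod). Qed.

Let step_sigma_additive : semi_sigma_additive lebesgue_rV_step.
Proof.
move=> F mF tF mUF; rewrite /lebesgue_rV_step /pushforward preimage_bigcup.
apply: (@measure_semi_sigma_additive _ _ _ prod).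
- by move=> i; rewrite -[X in measurable X]setTI; exact: measurable_cons_rV.
- apply/trivIsetP => /= i j _ _ ij; rewrite -preimage_setI.
  by move/trivIsetP : tF => /(_ _ _ _ _ ij) ->//; rewrite preimage_set0.
- by rewrite -preimage_bigcup -[X in measurable X]setTI;
    exact: measurable_cons_rV.
Qed.

HB.instance Definition _ := isMeasure.Build _ _ _ lebesgue_rV_step
  step0 step_ge0 step_sigma_additive.

Let step_sigma_finite : sigma_finite [set: 'rV[R]_n.+1] lebesgue_rV_step.
Proof.
have /sigma_finiteP[F [TF ndF Foo]] := sigma_finiteT (@lebesgue_measure R).
have /sigma_finiteP[G [TG ndG Goo]] := sigma_finiteT mu.
exists (fun i => @uncons_rV n @^-1` (F i `*` G i)).
  rewrite -preimage_bigcup (_ : \bigcup_i _ = setT) ?preimage_setT//.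
  rewrite -setXTT TF TG; apply/seteqP; split=> -[x y].
    by move=> [i _ []/= ? ?]; split; exists i.
  move=> [/= [i _ Fix] [j _ Gjy]]; exists (maxn i j) => //; split.
    by move: x Fix; exact/subsetPset/ndF/leq_maxl.
  by move: y Gjy; exact/subsetPset/ndG/leq_maxr.
move=> i; have [? ?] := Foo i; have [? ?] := Goo i; split.
  rewrite -[X in measurable X]setTI; apply: measurable_uncons_rV => //.
  exact: measurableX.
rewrite /lebesgue_rV_step /pushforward -comp_preimage.
rewrite (_ : @uncons_rV n \o @cons_rV n = id); last first.
  by apply/funext => z; exact: cons_rVK.
rewrite preimage_id.
by rewrite product_measure1E// lte_mul_pinfty// ge0_fin_numE.
Qed.

HB.instance Definition _ := Measure_isSigmaFinite.Build _ _ _ lebesgue_rV_step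
  step_sigma_finite.
End step.

(* R^0 carries the unit mass; R^(n+1) = R * R^n carries the product measure *)
Fixpoint lebesgue_rV n : {sigma_finite_measure set 'rV[R]_n -> \bar R} :=
  match n with
  | 0 => dirac (0 : 'rV[R]_0)
  | m.+1 => lebesgue_rV_step (lebesgue_rV m)
  end.

Lemma lebesgue_rV_box n (A : 'I_n -> set (measurableTypeR R)) :
  (forall i, measurable (A i)) ->
  lebesgue_rV n [set x : 'rV[R]_n | forall i, A i (x ord0 i)] =
  (\prod_(i < n) lebesgue_measure (A i))%E.
Proof.
elim: n A => [|n IH] A mA.
  by rewrite big_ord0 /= diracE mem_set// => -[].
rewrite big_ord_recl -IH//= /lebesgue_rV_step /pushforward.
rewrite -product_measure1E//; last first.
  rewrite (_ : [set _ | _] =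
    \bigcap_(i in [set: 'I_n]) ((fun x : 'rV[R]_n => x ord0 i : measurableTypeR R)
      @^-1` A (lift ord0 i))); last first.
    by apply/seteqP; split=> [x h i _|x h i]; [exact: h|exact: (h i I)].
  apply: fin_bigcap_measurable => // i _.
  by rewrite -[X in measurable X]setTI; exact: measurable_coor.
congr (_ _); apply/seteqP; split => -[a x] /=.
  move=> h; split => [|i].
    by have := h ord0; rewrite /cons_rV mxE unlift_none.
  by have := h (lift ord0 i); rewrite /cons_rV mxE liftK.
move=> [ha hx] i; rewrite /cons_rV mxE.
by case: (unliftP ord0 i) => [j ->|->] //=; exact: hx.
Qed.

End lebesgue_rV.

Section root_systems.
Context {R : realType} {N : nat}.
Implicit Types (x y a b : 'rV[R]_N) (Phi Phip : {fset 'rV[R]_N}).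

Definition dotp x y : R := \sum_(i < N) x ord0 i * y ord0 i.

(* the Euclidean norm; `|x| on matrices is the sup norm *)
Definition enorm x : R := Num.sqrt (dotp x x).

Definition reflection a x : 'rV[R]_N := x - (2 * (dotp a x / dotp a a)) *: a.

Definition root_system Phi : Prop :=
  [/\ 0 \notin Phi,
      forall a, a \in Phi ->
        [set` Phi] `&` [set c *: a | c in [set: R]] = [set - a; a]
    & forall a, a \in Phi -> reflection a @` [set` Phi] = [set` Phi]].

Definition positive_subsystem Phi Phip : Prop :=
  [/\ [set` Phi] = [set` Phip] `|` -%R @` [set` Phip],
      [set` Phip] `&` -%R @` [set` Phip] = set0
    & exists b, forall a, a \in Phip -> 0 < dotp b a].

Definition is_matrix_group (H : set 'M[R]_N) : Prop :=
  [/\ H `<=` [set M | M \in unitmx], H 1%:M,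
      (forall M M', H M -> H M' -> H (M *m M'))
    & (forall M, H M -> H (invmx M))].

(* The elements are matrices acting on row vectors on the right: for f linear,
   x *m lin1_mx f = f x. *)
Definition reflection_group Phi : set 'M[R]_N :=
  smallest is_matrix_group
    [set lin1_mx (reflection a) | a in [set` Phi]].

Definition group_order Phi : nat := #|` fset_set (reflection_group Phi)|.

Definition invariant_multiplicity Phi (k : 'rV[R]_N -> R) : Prop :=
  (forall a, a \in Phi -> 0 <= k a) /\
  (forall a M, a \in Phi -> reflection_group Phi M -> k (a *m M) = k a).

Definition hyperplane_complement Phi : set 'rV[R]_N :=
  [set x | forall a, a \in Phi -> dotp a x != 0].

Definition weyl_chamber Phi (W : set 'rV[R]_N) : Prop :=
  exists2 x, hyperplane_complement Phi x &
    W = connected_component (hyperplane_complement Phi) x.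

Definition signed_chamber Phip (eps : 'rV[R]_N -> R) : set 'rV[R]_N :=
  [set x | forall a, a \in Phip -> Num.sg (dotp a x) = eps a].

Definition gamma_k Phip (k : 'rV[R]_N -> R) : R := \sum_(a <- Phip) k a.

Definition w_k Phip (k : 'rV[R]_N -> R) x : R :=
  \prod_(a <- Phip) `|dotp a x| `^ (2 * k a).

(* \int_D g d(mu_k), where d(mu_k) = w_k dx *)
Definition int_mu_k Phip k (D : set 'rV[R]_N) (g : 'rV[R]_N -> R) : \bar R :=
  (\int[lebesgue_rV N]_(x in D) (g x * w_k Phip k x)%:E)%E.

Definition M_k Phip k : R :=
  fine (int_mu_k Phip k setT (fun x => expR (- (enorm x ^+ 2 / 2)))).

Definition grad (f : 'rV[R]_N -> R) x : 'rV[R]_N :=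
  \row_i 'D_(delta_mx ord0 i) f x.

(* C^1 functions on the closure of the open set W, with compact support: f is
   continuous on the closure and C^1 in W, and grad f extends continuously to
   the closure.  Values of f outside the closure are irrelevant. *)
Definition C1c_closure (W : set 'rV[R]_N) (f : 'rV[R]_N -> R) : Prop :=
  [/\ {within closure W, continuous f},
      (forall x, W x -> differentiable f x),
      (exists2 g : 'rV[R]_N -> 'rV[R]_N, {within closure W, continuous g} &
         forall x, W x -> g x = grad f x)
    & compact (closure (closure W `&` [set x | f x != 0]))].

(* the L^r(mu_k) norm over D *)
Definition Lnorm_mu_k Phip k (D : set 'rV[R]_N) (r : R) (g : 'rV[R]_N -> R) :
    \bar R :=
  (int_mu_k Phip k D (fun x => `|g x| `^ r)%R `^ r^-1)%E.

(* In \bar R, x / 0 = +oo for 0 < x, so no quotient is hidden by the division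
   convention. *)
Definition sobolev_best_constant Phip k (W : set 'rV[R]_N) (p q : R) : \bar R :=
  ereal_sup [set
    (Lnorm_mu_k Phip k W q f /
       Lnorm_mu_k Phip k W p (fun x => enorm (grad f x)))%E
  | f in [set f | C1c_closure W f /\ exists2 x, closure W x & f x != 0]].

End root_systems.

Definition Gamma {R : realType} (s : R) : R :=
  \int[lebesgue_measure]_(t in `]0, +oo[%classic) (t `^ (s - 1) * expR (- t)).

(* Main.v *)
Require Import Defs.
From mathcomp Require Import all_boot all_order all_algebra finmap.
From mathcomp Require Import all_classical all_reals all_analysis.
From mathcomp Require Import measurable_realfun ring lra.

(** Put $D = N + 2\gamma$, $W$ for the chamber and $d\mu = w_k\,dx$ on $W$.  Each
$|\langle\alpha,x\rangle|$ is a positive linear form on the convex cone $W$, so $w_k$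
is there a product of powers of linear forms, homogeneous of degree $2\gamma$, and
$W$ with $\mu$ behaves like a convex cone in a space of dimension $D$.  The chamber
enters the upper and the lower bound only through these properties, collected in
[cone_weight].

Upper bound.  The one-dimensional Brunn-Minkowski inequality gives the
Borell-Brascamp-Lieb inequality by induction on the dimension
([borell_brascamp_lieb]).  The form [bbl] of its hypothesis is stable under
multiplication by linear weights, at the price of their degree ([bbl_weight]).  With
exponent $e = D - 1$, the slices of the weighted functions satisfy the inequality
whose conclusion is a minimum, and if the largest slices agree, integrating once
more turns it into
$\int h\,d\mu \ge \int u\,d\mu + \int v\,d\mu$ ([slice_brunn_minkowski]).  This is applied to
$u = |f|^{ke}$, with $k = p/(D-p)$, to the dilates by $s$ of the model
$v = (1+|y|^{p'})^{-e}$, rescaled so that their slices do not change and their total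
mass is $s\int v\,d\mu$, and to their sup-convolution $h$.  As $s \to 0$,
$h - u$ is at most $s(K|\nabla f|^p - e|f|^q)$ to first order ([supconv_slope]), so that
$\int v\,d\mu + e\int |f|^q\,d\mu \le K\int |\nabla f|^p\,d\mu$ ([sobolev_normalized]).
Multiplying $f$ by a constant makes the slices agree, and the inequality between
weighted means removes that constant ([sobolev_truncated]).  What remains is the
Sobolev inequality with a constant expressed by $\int v\,d\mu$ ([cone_sobolev]).

Sharpness.  The function $(1+|x|^{p'})^{-(D-p)/p}$ gives equality
([sharp_constant_attained]).  Its support is not compact, so it is approximated by the
$C^1$ functions with compact support of [extremal_cutoff], with dominated convergence of
both integrals ([sobolev_best_constantE]).

Value of the constant.  The radial integrals over $W$ are multiples of the mass of
$W$ in the unit ball by values of the Gamma function ([wint_exp_power],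
[wint_inverse_power]).  The reflection group acts simply transitively on the chambers
([chamber_transitive], [chamber_free]), and it preserves $w_k$ and Lebesgue measure;
hence $M_k$ is $|G|$ times the Gaussian integral over $W$ ([M_k_chamber]), which
determines that mass. *)

Set Implicit Arguments.
Unset Strict Implicit.
Unset Printing Implicit Defensive.
Import Order.TTheory GRing.Theory Num.Theory.
Import numFieldNormedType.Exports.
Local Open Scope classical_set_scope.
Local Open Scope ring_scope.

(** * Affine maps, sums of sets and superlevel sets on the line *)

(** The image measure as an object of the type of measures, so that it can be
rescaled and fed to uniqueness theorems. *)
Definition image_measure d1 d2 (T1 : measurableType d1) (T2 : measurableType d2)
  (R : realType) (m : {measure set T1 -> \bar R}) (f : T1 -> T2)
  (mf : measurable_fun setT f) : {measure set T2 -> \bar R}.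
Proof. by refine (pushforward m f : {measure set T2 -> \bar R}). Defined.

Lemma ge0_integral_image_measure d1 d2 (T1 : measurableType d1)
  (T2 : measurableType d2) (R : realType) (m : {measure set T1 -> \bar R})
  (f : T1 -> T2) (mf : measurable_fun setT f) (g : T2 -> \bar R) :
  measurable_fun setT g -> (forall x, 0 <= g x)%E ->
  (\int[image_measure m mf]_x g x = \int[m]_x g (f x))%E.
Proof.
move=> mg g0; have := @ge0_integral_pushforward _ _ _ _ R f mf m setT g.
by rewrite preimage_setT; apply.
Qed.

Section line.
Context {R : realType}.
Notation mu := (@lebesgue_measure R).

Lemma measurable_affine (c b : R) :
  measurable_fun setT (fun x : measurableTypeR R => c * x + b : measurableTypeR R).
Proof. by apply: measurable_funD => //; exact: measurable_funM. Qed.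

Lemma lebesgue_measure_affine (c b : R) (A : set (measurableTypeR R)) :
  c != 0 -> measurable A ->
  mu A = (`|c|%:E * mu [set x | A (c * x + b)%R])%E.
Proof.
move=> c0 mA.
pose nu := mscale (NngNum (normr_ge0 c)) (image_measure mu (measurable_affine c b)).
transitivity (nu A) => //.
apply: lebesgue_measure_unique => // _ [[u v]] _ <-.
change (mu `]u, v]%classic =
  (`|c|%:E * mu [set x | `]u, v]%classic (c * x + b)%R])%E).
have [c_gt0|c_lt0|] := ltgtP 0 c; last by move/eqP; rewrite eq_sym (negbTE c0).
- rewrite [X in (_ * mu X)%E](_ : _ = `](u - b) / c, (v - b) / c]%classic); last first.
    by apply/seteqP; split => x /=;
      rewrite !in_itv/= ltr_pdivrMr// ler_pdivlMr// ltrBlDr lerBrDr [x * c]mulrC.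
  rewrite !lebesgue_measure_itv/= !lte_fin ltr_pM2r ?invr_gt0// ltrD2r gtr0_norm//.
  case: ifPn => _; last by rewrite mule0.
  by rewrite -EFinD -EFinM; congr (_%:E); field.
- rewrite [X in (_ * mu X)%E](_ : _ = `[(v - b) / c, (u - b) / c[%classic); last first.
    by apply/seteqP; split => x /=;
      rewrite !in_itv/= ltr_ndivlMr// ler_ndivrMr// ltrBlDr lerBrDr [x * c]mulrC andbC.
  rewrite !lebesgue_measure_itv/= !lte_fin ltr_nM2r ?invr_lt0// ltrD2r ltr0_norm//.
  case: ifPn => _; last by rewrite mule0.
  by rewrite -EFinD -EFinM; congr (_%:E); field.
Qed.

Lemma integral_affine (c b : R) (f : measurableTypeR R -> \bar R) :
  c != 0 -> measurable_fun [set: measurableTypeR R] f -> (forall x, (0 <= f x)%E) ->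
  (\int[mu]_x f x = `|c|%:E * \int[mu]_x f (c * x + b)%R)%E.
Proof.
move=> c0 mf f0.
pose nu := mscale (NngNum (normr_ge0 c)) (image_measure mu (measurable_affine c b)).
transitivity (\int[nu]_x f x)%E.
  by apply: eq_measure_integral => //= A mA _; exact: lebesgue_measure_affine.
rewrite ge0_integral_mscale//; congr (_ * _)%E.
exact: ge0_integral_image_measure.
Qed.

Lemma measurable_translate (A : set (measurableTypeR R)) (b : R) :
  measurable A -> measurable [set x : measurableTypeR R | A (x - b)].
Proof.
move=> mA; rewrite -[X in measurable X]setTI.
have := measurable_affine 1 (- b).
move=> /(_ measurableT A mA); congr measurable.
by apply/seteqP; split => x /=; rewrite mul1r.
Qed.

Lemma measure_translate (A : set (measurableTypeR R)) (b : R) :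
  measurable A -> mu [set x | A (x - b)%R] = mu A.
Proof.
move=> mA; rewrite (lebesgue_measure_affine (- b) (oner_neq0 R) mA).
rewrite normr1 mul1e; congr (mu _).
by apply/seteqP; split => x /=; rewrite mul1r.
Qed.

(** Countably many of the initial parts exhaust the set. *)
Lemma le_measure_initial (A : set (measurableTypeR R)) (r : \bar R) :
  measurable A -> A !=set0 ->
  (forall a, A a -> (mu (A `&` `]-oo, a]) <= r)%E) -> (mu A <= r)%E.
Proof.
move=> mA A0 H.
have [[m [Am ub]]|nomax] := pselect (exists m, A m /\ ubound A m).
  have := H _ Am; rewrite (_ : A `&` _ = A)//.
  by apply/seteqP; split => [x []//|x Ax]; split => //=; rewrite in_itv/= ub.
have [s sA sup_s] : exists2 s : nat -> R, (forall n, A (s n)) &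
    forall x, A x -> exists n, x <= s n.
  have [hub|nub] := pselect (has_ubound A); last first.
    have H1 n : exists y, A y /\ n%:R <= y.
      apply: contrapT => h; apply: nub; exists n%:R => y Ay.
      by have [//|yn] := leP y n%:R; exfalso; apply: h; exists y; split => //; exact: ltW.
    exists (fun n => sval (cid (H1 n))) => [n|x Ax].
      by case: (cid _) => y [].
    exists (Num.truncn x).+1; case: (cid _) => y [] Ay /= /(le_trans _); apply.
    by have := truncnS_gt x; exact: ltW.
  have hs : has_sup A by split.
  have H1 (n : nat) : exists y, A y /\ sup A - n.+1%:R^-1 < y.
    have [|y Ay ys] := @sup_adherent _ A n.+1%:R^-1 _ hs; first by rewrite invr_gt0.
    by exists y.
  exists (fun n => sval (cid (H1 n))) => [n|x Ax].
    by case: (cid _) => y [].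
  have xs : x < sup A.
    rewrite lt_neqAle sup_ubound// andbT; apply/eqP => xs; apply: nomax.
    by exists x; split => //; rewrite xs; exact: sup_ubound.
  exists (Num.truncn (sup A - x)^-1); case: (cid _) => y [] Ay /= /ltW /(le_trans _); apply.
  rewrite lerBrDl -lerBrDr -[leRHS]invrK lef_pV2 ?posrE ?invr_gt0 ?subr_gt0//.
  by have := truncnS_gt (sup A - x)^-1; exact: ltW.
pose t n := \big[Order.max/s 0]_(i < n.+1) s i.
have tA n : A (t n).
  by rewrite /t; elim/big_ind : _ => // x y Ax Ay; rewrite /Order.max; case: ifP.
have -> : A = \bigcup_n (A `&` `]-oo, t n]).
  apply/seteqP; split => [x Ax|x [n _ []//]].
  have [n xn] := sup_s _ Ax; exists n => //; split => //=.
  rewrite in_itv/= (le_trans xn)//.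
  by apply: (le_bigmax _ (fun i : 'I_n.+1 => s i) ord_max).
have cv : mu (A `&` `]-oo, t n]) @[n --> \oo] --> mu (\bigcup_n (A `&` `]-oo, t n])).
  apply: nondecreasing_cvg_mu.
  - by move=> n; apply: measurableI.
  - by apply: bigcup_measurable => n _; apply: measurableI.
  - move=> n m nm; apply/subsetPset => x [Ax]/=; rewrite !in_itv/= => xt; split => //.
    rewrite /= (le_trans xt)//; apply: bigmax_le => /=.
      exact: (le_trans _ (le_bigmax _ (fun i : 'I_m.+1 => s i) ord0)).
    move=> i _.
    have im : (i < m.+1)%N by rewrite (leq_trans (ltn_ord i))// ltnS.
    exact: (le_bigmax _ (fun i : 'I_m.+1 => s i) (Ordinal im)).
rewrite -(cvg_lim _ cv)//; apply: lime_le; first by apply/cvg_ex; eexists; exact: cv.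
by apply: nearW => n; exact: H.
Qed.

Lemma le_measure_final (A : set (measurableTypeR R)) (r : \bar R) :
  measurable A -> A !=set0 ->
  (forall a, A a -> (mu (A `&` `]a, +oo[) <= r)%E) -> (mu A <= r)%E.
Proof.
move=> mA [a0 Aa0] H.
have N1 : -1 != 0 :> R by rewrite oppr_eq0 oner_neq0.
have mN (B : set (measurableTypeR R)) : measurable B ->
    mu [set x | B (- x)%R] = mu B.
  move=> mB; rewrite (lebesgue_measure_affine 0 N1 mB) normrN1 mul1e.
  by congr (mu _); apply/seteqP; split => x /=; rewrite mulN1r addr0.
have mNA : measurable [set x | A (- x)].
  rewrite -[X in measurable X]setTI.
  have := measurable_affine (-1) 0.
  move=> /(_ measurableT A mA); congr measurable.
  by apply/seteqP; split => x /=; rewrite mulN1r addr0.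
rewrite -mN//; apply: le_measure_initial => //.
  by exists (- a0); rewrite /= opprK.
move=> a /H/(le_trans _); apply.
have mI : measurable (A `&` `]- a, +oo[) by exact: measurableI.
rewrite -(mN (A `&` _))//.
pose X1 := [set x : measurableTypeR R | (A `&` `]- a, +oo[%classic) (- x)].
pose X2 := [set x : measurableTypeR R | A (- x)] `&` [set a].
have -> : [set x | A (- x)] `&` `]-oo, a] = X1 `|` X2.
  apply/seteqP; split => x /=; rewrite /X1 /X2/= !in_itv/= ?andbT ?ltrN2.
    by move=> [Ax]; rewrite le_eqVlt => /orP[/eqP|] xa; [right|left].
  by move=> [[Ax xa]|[Ax xa]]; split => //; [exact: ltW|rewrite xa].
have m1 : measurable X1.
  rewrite -[X in measurable X]setTI.
  have := measurable_affine (-1) 0.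
  move=> /(_ measurableT _ mI); congr measurable.
  by apply/seteqP; split => x /=; rewrite mulN1r addr0.
have m2 : measurable X2 by exact: measurableI.
rewrite -[X in (_ <= X)%E]/(mu X1).
apply: (@le_trans _ _ (mu X1 + mu X2)%E); first exact: measureU2.
rewrite [X in (_ + X <= _)%E](_ : _ = 0%E) ?adde0//.
apply/eqP; rewrite eq_le measure_ge0 andbT.
rewrite -(lebesgue_measure_set1 a); apply: le_measure; rewrite ?inE//.
by move=> x [].
Qed.

(** If [a] is the last point of [A] and [b] the first one of [B], then [C] contains
[A + b] and [a + B], which overlap at most in a point.  In general this is used
for the part of [A] up to [a] and the part of [B] after [b]. *)
Lemma brunn_minkowski_line (A B C : set (measurableTypeR R)) :
  measurable A -> measurable B -> measurable C -> A !=set0 -> B !=set0 ->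
  (forall a b, A a -> B b -> C (a + b)) -> (mu A + mu B <= mu C)%E.
Proof.
move=> mA mB mC A0 B0 ABC.
have [->|Cfin] := eqVneq (mu C) +oo%E; first exact: leey.
have Cf : mu C \is a fin_num.
  by rewrite ge0_fin_numE// lt_neqAle Cfin leey.
have step a b : A a -> B b ->
    (mu (A `&` `]-oo, a]) + mu (B `&` `]b, +oo[) <= mu C)%E.
  move=> Aa Bb.
  have mAa : measurable (A `&` `]-oo, a]) by exact: measurableI.
  have mBb : measurable (B `&` `]b, +oo[) by exact: measurableI.
  rewrite -(measure_translate b mAa) -(measure_translate a mBb).
  rewrite -measureU//; first last.
  - apply/seteqP; split => x //= -[[_]]; rewrite in_itv/= lerBlDr => h [_].
    by rewrite in_itv/= andbT ltrBrDr addrC ltNge h.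
  - exact: measurable_translate.
  - exact: measurable_translate.
  apply: le_measure; rewrite ?inE//.
    by apply: measurableU; exact: measurable_translate.
  move=> x [[h _]|[h _]]; first by rewrite -(subrK b x); exact: ABC.
  by rewrite -(subrK a x) addrC; exact: ABC.
have step2 b : B b -> (mu A + mu (B `&` `]b, +oo[) <= mu C)%E.
  move=> Bb.
  have mBb : measurable (B `&` `]b, +oo[) by exact: measurableI.
  have Bfin : mu (B `&` `]b, +oo[) \is a fin_num.
    have [a Aa] := A0; rewrite ge0_fin_numE//.
    apply: (@le_lt_trans _ _ (mu C)); last by rewrite lt_neqAle Cfin leey.
    by apply: le_trans (step _ _ Aa Bb); rewrite leeDr.
  rewrite -leeBrDr//; apply: le_measure_initial => // a Aa.
  by rewrite leeBrDr//; exact: step.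
have Afin : mu A \is a fin_num.
  have [b Bb] := B0; rewrite ge0_fin_numE//.
  apply: (@le_lt_trans _ _ (mu C)); last by rewrite lt_neqAle Cfin leey.
  by apply: le_trans (step2 _ Bb); rewrite leeDl.
rewrite addeC -leeBrDr//; apply: le_measure_final => // b Bb.
by rewrite leeBrDr// addeC; exact: step2.
Qed.
End line.

(** Tonelli's theorem on the region under the graph. *)
Lemma layer_cake d (T : measurableType d) (R : realType)
    (m : {sigma_finite_measure set T -> \bar R}) (F : T -> \bar R) :
  measurable_fun setT F -> (forall x, 0 <= F x)%E ->
  (\int[m]_x F x = \int[@lebesgue_measure R]_(r in `[0%R, +oo[)
     m [set x | r%:E < F x])%E.
Proof.
move=> mF F0.
pose E := [set z : T * measurableTypeR R | 0 <= z.2 /\ (z.2%:E < F z.1)%E].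
have mE : measurable E.
  apply: measurableI.
    rewrite -[X in measurable X]setTI.
    have : measurable_fun setT (fun z : T * measurableTypeR R => z.2) by exact: measurable_snd.
    move=> /(_ measurableT `[0, +oo[%classic (measurable_itv _)).
    by congr measurable; apply/seteqP; split => z /=; rewrite in_itv/= andbT.
  rewrite -[X in measurable X]setTI.
  have := @emeasurable_fun_o_infty _ _ _ setT (fun z : T * measurableTypeR R => (F z.1 - z.2%:E)%E)
    measurableT.
  rewrite [X in measurable (_ `&` X)](_ : _ = [set z | (0 < F z.1 - z.2%:E)%E]).
    apply; apply: emeasurable_funB; first exact: measurableT_comp.
    by apply/measurable_EFinP; exact: measurable_snd.
  by apply/funext => z; rewrite -(sube_gt0 z.2%:E).
transitivity (\int[m]_x \int[@lebesgue_measure R]_r (\1_E (x, r))%:E)%E.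
  apply: eq_integral => x _.
  rewrite (_ : (fun r => _) = (fun r => (\1_(xsection E x) r)%:E)); last first.
    by apply/funext => r; rewrite !indicE mem_xsection.
  rewrite integral_indic//; last exact: measurable_xsection.
  rewrite setIT.
  have [Fx|Fx] := eqVneq (F x) +oo%E.
    rewrite (_ : xsection E x = `[0, +oo[%classic).
      by rewrite Fx -[RHS]/(lebesgue_measure _) lebesgue_measure_itv/= ltry.
    apply/seteqP; split => r; rewrite /xsection/= inE/= in_itv/= andbT; first by case.
    by move=> r0; split => //=; rewrite Fx ltry.
  have Ff : F x \is a fin_num by rewrite ge0_fin_numE// lt_neqAle Fx leey.
  rewrite (_ : xsection E x = `[0, fine (F x)[%classic).
    rewrite -[RHS]/(lebesgue_measure _) lebesgue_measure_itv/= lte_fin.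
    case: ifPn => [_|]; first by rewrite sube0 fineK.
    by rewrite -leNgt => h; rewrite -(fineK Ff); congr (_%:E); apply/eqP;
      rewrite eq_le h fine_ge0.
  apply/seteqP; split => r; rewrite /xsection/= inE/= in_itv/= /E/=.
    by move=> [-> ]; rewrite -{1}(fineK Ff) lte_fin => ->.
  by move=> /andP[-> h]; split => //; rewrite -(fineK Ff) lte_fin.
rewrite (@fubini_tonelli _ _ _ _ _ m lebesgue_measure (fun z => (\1_E z)%:E))//=; last first.
  by apply/measurable_EFinP; exact: measurable_indic.
rewrite [RHS]integral_mkcond; apply: eq_integral => r _.
have itvE : (r \in (`[0, +oo[%classic : set R)) = (0 <= r :> R).
  by apply/idP/idP; rewrite inE/= in_itv/= andbT.
rewrite patchE itvE; case: ifPn => r0.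
  rewrite (_ : (fun x => _) = (fun x => (\1_(ysection E r) x)%:E)); last first.
    by apply/funext => x; rewrite !indicE mem_ysection.
  rewrite integral_indic//; last exact: measurable_ysection.
  rewrite setIT; congr (m _); apply/seteqP; split => x; rewrite /ysection/= inE/=.
    by case.
  by [].
apply: integral0_eq => x _; rewrite indicE memNset// => -[].
by move: r0 => /[swap] /= ->.
Qed.

Lemma measurable_superlevel_measure d (T : measurableType d) (R : realType)
    (m : {sigma_finite_measure set T -> \bar R}) (F : T -> \bar R) :
  measurable_fun setT F ->
  measurable_fun [set: measurableTypeR R] (fun r => m [set x | (r%:E < F x)%E]).
Proof.
move=> mF.
pose E := [set z : T * measurableTypeR R | (z.2%:E < F z.1)%E].
have mE : measurable E.
  rewrite -[X in measurable X]setTI.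
  have := @emeasurable_fun_o_infty _ _ _ setT (fun z : T * measurableTypeR R => (F z.1 - z.2%:E)%E)
    measurableT.
  rewrite [X in measurable (_ `&` X)](_ : _ = [set z | (0 < F z.1 - z.2%:E)%E]).
    apply; apply: emeasurable_funB; first exact: measurableT_comp.
    by apply/measurable_EFinP; exact: measurable_snd.
  by apply/funext => z; rewrite /E/mkset -(sube_gt0 z.2%:E).
have := measurable_fun_ysection m mE; congr (measurable_fun _ _).
by apply/funext => r /=; congr (m _); apply/seteqP; split => x; rewrite /ysection/= inE.
Qed.

(** The superlevel sets of [F] and [G] add up into those of [H]; since they are
non-empty at the same levels, [brunn_minkowski_line] applies at each level. *)
Lemma prekopa_line (R : realType) (F G H : measurableTypeR R -> \bar R) :
  measurable_fun setT F -> measurable_fun setT G -> measurable_fun setT H ->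
  (forall x, 0 <= F x)%E -> (forall x, 0 <= G x)%E -> (forall x, 0 <= H x)%E ->
  (forall r, 0 <= r -> (exists x, r%:E < F x)%E <-> (exists x, r%:E < G x)%E) ->
  (forall x y r, 0 <= r -> (r%:E < F x -> r%:E < G y -> r%:E < H (x + y)%R)%E) ->
  (\int[@lebesgue_measure R]_x F x + \int[@lebesgue_measure R]_x G x <=
   \int[@lebesgue_measure R]_x H x)%E.
Proof.
move=> mF mG mH F0 G0 H0 FG FGH.
have ms (K : measurableTypeR R -> \bar R) (mK : measurable_fun setT K) :
    measurable_fun (`[0, +oo[%classic : set R) (fun r => (@lebesgue_measure R) [set x | (r%:E < K x)%E]).
  by apply: measurable_funTS; exact: measurable_superlevel_measure.
rewrite !layer_cake// -ge0_integralD//; [|exact: ms|exact: ms].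
have mlev (K : measurableTypeR R -> \bar R) (mK : measurable_fun setT K) r :
    measurable [set x | (r%:E < K x)%E].
  by rewrite -[X in measurable X]setTI; exact: emeasurable_fun_o_infty.
apply: ge0_le_integral => //.
- by move=> r _; exact: adde_ge0.
- by apply: emeasurable_funD; exact: ms.
- exact: ms.
move=> r; rewrite /= in_itv/= andbT => r0.
have [[x Fx]|noF] := pselect (exists x, (r%:E < F x)%E); last first.
  rewrite (_ : [set x | _] = set0); last by rewrite -subset0 => x Fx; apply: noF; exists x.
  rewrite (_ : [set x | (_ < G x)%E] = set0); last first.
    by rewrite -subset0 => x Gx; apply: noF; apply/FG => //; exists x.
  by rewrite !measure0 adde0.
have [y Gy] := (FG r r0).1 (ex_intro _ x Fx).
apply: brunn_minkowski_line => //; try exact: mlev.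
- by exists x.
- by exists y.
- by move=> a b /= Fa Gb; exact: FGH.
Qed.

Section powers.
Context {R : realType}.
Implicit Types x y t e : R.

Lemma weighted_amgm x y t : 0 <= x -> 0 <= y -> 0 < t < 1 ->
  x `^ t * y `^ (1 - t) <= t * x + (1 - t) * y.
Proof.
move=> x0 y0 /andP[t0 t1].
have t1' : 0 < 1 - t by rewrite subr_gt0.
have := @conjugate_powR R (x `^ t) (y `^ (1 - t)) t^-1 (1 - t)^-1
  (powR_ge0 _ _) (powR_ge0 _ _).
rewrite !invr_gt0 !invrK -!powRrM !mulfV ?gt_eqF// !powRr1// [x * _]mulrC [y * _]mulrC.
by apply => //; rewrite addrC subrK.
Qed.

Lemma weighted_amgm_le x y t : 0 <= x -> 0 <= y -> 0 <= t <= 1 ->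
  x `^ t * y `^ (1 - t) <= t * x + (1 - t) * y.
Proof.
move=> x0 y0 /andP[t0 t1].
have [->|tn0] := eqVneq t 0.
  by rewrite powRr0 subr0 powRr1// !mul1r mul0r add0r.
have [->|tn1] := eqVneq t 1.
  by rewrite subrr powRr0 powRr1// mulr1 mul1r mul0r addr0.
by apply: weighted_amgm => //; rewrite !lt_neqAle t0 t1 eq_sym tn0 tn1.
Qed.

(** The reverse Hölder inequality, for the powers [e] and [1 - e] of weights that add
up to one. *)
Lemma holder_two_points x y e : 0 < x < 1 -> 0 < y < 1 -> 1 <= e ->
  1 <= x `^ e * y `^ (1 - e) + (1 - x) `^ e * (1 - y) `^ (1 - e).
Proof.
move=> /andP[x0 x1] /andP[y0 y1] e1.
have e0 : 0 < e by exact: lt_le_trans e1.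
have ie : 0 <= e^-1 <= 1 by rewrite invr_ge0 (ltW e0)/= invf_le1.
have main (a b : R) : 0 < a -> 0 < b ->
    a <= e^-1 * (a `^ e * b `^ (1 - e)) + (1 - e^-1) * b.
  move=> a0 b0.
  have := @weighted_amgm_le (a `^ e * b `^ (1 - e)) b e^-1 _ (ltW b0) ie.
  rewrite mulr_ge0 ?powR_ge0// => /(_ isT); apply: le_trans.
  rewrite powRM ?powR_ge0// -!powRrM mulfV ?gt_eqF// powRr1 ?(ltW a0)//.
  rewrite -mulrA -powRD ?(gt_eqF b0) ?implybT//.
  rewrite (_ : (1 - e) / e + (1 - e^-1) = 0) ?powRr0 ?mulr1//.
  by field; rewrite gt_eqF.
have := lerD (main x y x0 y0) (main (1 - x) (1 - y) _ _).
rewrite !subr_gt0 => /(_ x1 y1).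
set S1 := x `^ e * _; set S2 := (1 - x) `^ e * _ => h.
have : 0 <= e^-1 * (S1 + S2 - 1) by lra.
by rewrite pmulr_rge0 ?invr_gt0// subr_ge0.
Qed.

Lemma balance_weights (a b e : R) : 0 < a -> 0 < b -> 0 < e ->
  exists2 l, 0 < l < 1 & l `^ e * a = (1 - l) `^ e * b.
Proof.
move=> a0 b0 e0.
pose A := a `^ e^-1; pose B := b `^ e^-1.
have A0 : 0 < A by exact: powR_gt0.
have B0 : 0 < B by exact: powR_gt0.
have AB0 : 0 < A + B by exact: addr_gt0.
exists (B / (A + B)).
  by rewrite divr_gt0//= ltr_pdivrMr// mul1r ltrDr.
rewrite (_ : 1 - _ = A / (A + B)); last by field; rewrite gt_eqF.
have ea : a = A `^ e by rewrite -powRrM mulVf ?gt_eqF// powRr1// ltW.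
have eb : b = B `^ e by rewrite -powRrM mulVf ?gt_eqF// powRr1// ltW.
clearbody A B; subst a b.
rewrite -!powRM ?divr_ge0 ?(ltW A0) ?(ltW B0) ?(ltW AB0)//.
by congr (_ `^ _); ring.
Qed.
End powers.

(** * The Borell-Brascamp-Lieb inequality *)

Lemma cvg_truncation (R : realType) (x : \bar R) : (0 <= x)%E ->
  (mine x n%:R%:E @[n --> \oo] --> x)%E.
Proof.
move=> x0; have [->|xfin] := eqVneq x +oo%E.
  apply/cvgeyPge => A; near=> n.
  rewrite min_r ?leey// lee_fin; near: n.
  exact: nbhs_infty_ger.
have xf : x \is a fin_num by rewrite ge0_fin_numE// lt_neqAle xfin leey.
apply: cvg_near_cst; near=> n.
rewrite min_l//; rewrite -(fineK xf) lee_fin; near: n.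
exact: nbhs_infty_ger.
Unshelve. all: by end_near. Qed.

(** A strict lower bound on an integral survives the truncation of the integrand at
a high enough level.  Bounded functions have finite suprema, which rescaling can
then make equal. *)
Lemma integral_truncation_gt d (T : measurableType d) (R : realType)
    (m : {measure set T -> \bar R}) (F : T -> \bar R) (k : R) (c : \bar R) :
  measurable_fun setT F -> (forall x, 0 <= F x)%E -> 0 <= k ->
  (c < k%:E * \int[m]_x F x)%E ->
  exists n0, forall n, (n0 <= n)%N ->
    (c < k%:E * \int[m]_x mine (F x) n%:R%:E)%E.
Proof.
move=> mF F0 k0 cF.
pose u (n : nat) := (k%:E * \int[m]_x mine (F x) n%:R%:E)%E.
have mF_ n : measurable_fun setT (fun x => mine (F x) n%:R%:E).
  by apply: measurable_mine => //; exact: measurable_cst.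
have ndu : {homo u : a b / (a <= b)%N >-> (a <= b)%E}.
  move=> a b ab; apply: lee_wpmul2l; first by rewrite lee_fin.
  apply: ge0_le_integral => //.
  - by move=> x _; rewrite le_min F0/= lee_fin.
  - by move=> x _; rewrite le_min !ge_min lexx/= lee_fin ler_nat ab orbT.
have cu : u n @[n --> \oo] --> (k%:E * \int[m]_x F x)%E.
  apply: cvgeZl => //.
  have := @cvg_monotone_convergence _ _ _ m setT measurableT
    (fun n x => mine (F x) n%:R%:E) mF_.
  rewrite (_ : (fun x => limn _) = F); last first.
    by apply/funext => x; apply/cvg_lim => //; exact: cvg_truncation.
  apply.
  - by move=> n x _; rewrite le_min F0/= lee_fin.
  - by move=> x _ a b ab; rewrite le_min !ge_min lexx/= lee_fin ler_nat ab orbT.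
apply: contrapT => h.
suff : (k%:E * \int[m]_x F x <= c)%E by rewrite leNgt cF.
rewrite -(cvg_lim _ cu)//; apply: lime_le; first by apply/cvg_ex; eexists; exact: cu.
apply: nearW => n; rewrite leNgt; apply/negP => cn; apply: h; exists n => j nj.
exact: lt_le_trans (ndu _ _ nj).
Qed.

(** The hypothesis of the Borell-Brascamp-Lieb inequality with exponent [-1/e],
written by superlevel sets: the harmonic-type mean
$(a^{-1/e} + b^{-1/e})^{-e}$ is the largest of the numbers
$\min(l^e a, (1-l)^e b)$, $0 < l < 1$.  In this form vanishing and infinite
values need no separate treatment, and [e = 0] gives the minimum. *)
Definition bbl (R : realType) (e : R) (a b c : \bar R) :=
  forall l s : R, 0 < l < 1 -> 0 <= s ->
  (s%:E < (l `^ e)%:E * a -> s%:E < ((1 - l) `^ e)%:E * b -> s%:E < c)%E.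

(** The weights [l] and [1 - l] are chosen such that [l ^ e F] and
[(1 - l) ^ e G] have the same supremum.  [prekopa_line] then bounds the sum of
their integrals, and [holder_two_points] compares that sum with the conclusion for
any other weights [nu] and [1 - nu]. *)
Lemma bbl_line (R : realType) (e : R) (F G H : measurableTypeR R -> \bar R) :
  1 <= e ->
  measurable_fun setT F -> measurable_fun setT G -> measurable_fun setT H ->
  (forall x, 0 <= F x)%E -> (forall x, 0 <= G x)%E -> (forall x, 0 <= H x)%E ->
  (forall x y, bbl e (F x) (G y) (H (x + y))) ->
  bbl (e - 1) (\int[@lebesgue_measure R]_x F x) (\int[@lebesgue_measure R]_x G x)
    (\int[@lebesgue_measure R]_x H x).
Proof.
move=> e1 mF mG mH F0 G0 H0 FGH nu r nu01 r0 rF rG.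
have e0 : 0 < e by exact: lt_le_trans e1.
have [n1 N1] := integral_truncation_gt mF F0 (powR_ge0 _ _) rF.
have [n2 N2] := integral_truncation_gt mG G0 (powR_ge0 _ _) rG.
pose n := maxn n1 n2.
have {}rF := N1 n (leq_maxl _ _). have {}rG := N2 n (leq_maxr _ _).
have bdd (K : measurableTypeR R -> \bar R) (mK : measurable_fun setT K)
    (K0 : forall x, (0 <= K x)%E) (k : R) :
    (r%:E < k%:E * \int[@lebesgue_measure R]_x mine (K x) n%:R%:E)%E ->
    exists2 a : R, 0 < a & ereal_sup (range (fun x => mine (K x) n%:R%:E)) = a%:E.
  move=> rK; set S := ereal_sup _.
  have S0 : (0 <= S)%E.
    apply: ereal_sup_ge; exists (mine (K 0) n%:R%:E); first by exists 0.
    by rewrite le_min K0/= lee_fin.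
  have Sn : (S <= n%:R%:E)%E.
    by apply: ge_ereal_sup => _ [x _ <-]; rewrite ge_min lexx orbT.
  have Sf : S \is a fin_num by rewrite ge0_fin_numE// (le_lt_trans Sn)// ltry.
  exists (fine S); last by rewrite fineK.
  rewrite lt_neqAle fine_ge0// andbT eq_sym; apply/eqP => S00.
  move: rK; rewrite integral0_eq ?mule0 ?lte_fin ?ltNge ?r0// => x _.
  apply/eqP; rewrite eq_le le_min K0 lee_fin ler0n/= andbT.
  have SE : S = 0%E by rewrite -(fineK Sf) S00.
  by rewrite -[X in (_ <= X)%E]SE; apply: ereal_sup_ubound; exists x.
have [a a0 Fa] := bdd F mF F0 _ rF.
have [b b0 Gb] := bdd G mG G0 _ rG.
have [l l01 lab] := balance_weights a0 b0 e0.
have /andP[l0 l1] := l01.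
have l1' : 0 < 1 - l by rewrite subr_gt0.
have le0 : 0 < l `^ e by exact: powR_gt0.
have le1 : 0 < (1 - l) `^ e by exact: powR_gt0.
pose F' x := ((l `^ e)%:E * mine (F x) n%:R%:E)%E.
pose G' x := (((1 - l) `^ e)%:E * mine (G x) n%:R%:E)%E.
have mF_ : measurable_fun setT (fun x => mine (F x) n%:R%:E).
  by apply: measurable_mine => //; exact: measurable_cst.
have mG_ : measurable_fun setT (fun x => mine (G x) n%:R%:E).
  by apply: measurable_mine => //; exact: measurable_cst.
have F_0 x : (0 <= mine (F x) n%:R%:E)%E by rewrite le_min F0/= lee_fin.
have G_0 x : (0 <= mine (G x) n%:R%:E)%E by rewrite le_min G0/= lee_fin.
have supE (K : measurableTypeR R -> \bar R) (c k : R) : 0 < k ->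
    ereal_sup (range K) = c%:E -> forall s,
    (exists x, s%:E < k%:E * K x)%E <-> s < k * c.
  move=> k0 Kc s; rewrite mulrC -ltr_pdivrMr// -lte_fin -Kc; split.
    move=> [x]; rewrite muleC -lte_pdivrMr// => /lt_le_trans; rewrite -EFinM; apply.
    by apply: ereal_sup_ubound; exists x.
  move=> /ereal_sup_gt[_ [x _ <-]] h; exists x.
  by rewrite muleC -lte_pdivrMr// -EFinM.
have : (\int[@lebesgue_measure R]_x F' x + \int[@lebesgue_measure R]_x G' x <=
    \int[@lebesgue_measure R]_x H x)%E.
  apply: prekopa_line => //.
  - exact: measurable_funeM.
  - exact: measurable_funeM.
  - by move=> x; rewrite mule_ge0 ?lee_fin// ltW.
  - by move=> x; rewrite mule_ge0 ?lee_fin// ltW.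
  - by move=> s s0; rewrite (supE _ _ _ le0 Fa) (supE _ _ _ le1 Gb) lab.
  - move=> x y s s0 sF sG; apply: (FGH x y l s) => //.
      by apply: lt_le_trans sF _; rewrite lee_wpmul2l ?lee_fin ?(ltW le0)// ge_min lexx.
    by apply: lt_le_trans sG _; rewrite lee_wpmul2l ?lee_fin ?(ltW le1)// ge_min lexx.
rewrite /F' /G' !ge0_integralZl_EFin ?(ltW le0) ?(ltW le1)//.
apply: lt_le_trans.
have iF0 : (0 <= \int[@lebesgue_measure R]_x mine (F x) n%:R%:E)%E by exact: integral_ge0.
have iG0 : (0 <= \int[@lebesgue_measure R]_x mine (G x) n%:R%:E)%E by exact: integral_ge0.
move: (\int[_]_x mine (F x) _)%E (\int[_]_x mine (G x) _)%E iF0 iG0 rF rG => X Y.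
have /andP[nu0 nu1] := nu01.
have nu1' : 0 < 1 - nu by rewrite subr_gt0.
have ne0 : 0 < nu `^ (e - 1) by exact: powR_gt0.
have ne1 : 0 < (1 - nu) `^ (e - 1) by exact: powR_gt0.
case: X => [X||]// ; case: Y => [Y||]//.
- rewrite !lee_fin => X0 Y0; rewrite -!EFinM -EFinD !lte_fin => rX rY.
  have hold := holder_two_points l01 nu01 e1.
  have inv (z : R) : 0 < z -> z `^ (1 - e) = (z `^ (e - 1))^-1.
    by move=> z0; rewrite -powRN opprB.
  have X1 : r * nu `^ (1 - e) < X by rewrite inv// ltr_pdivrMr// mulrC.
  have Y1 : r * (1 - nu) `^ (1 - e) < Y by rewrite inv// ltr_pdivrMr// mulrC.
  apply: (@le_lt_trans _ _ (l `^ e * (r * nu `^ (1 - e)) + (1 - l) `^ e * (r * (1 - nu) `^ (1 - e)))).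
    rewrite !(mulrCA _ r) -mulrDr; exact: ler_peMr.
  by apply: ltrD; rewrite ltr_pM2l.
- by move=> *; rewrite gt0_muley ?lte_fin// -EFinM addey// ltry.
- by move=> *; rewrite gt0_muley ?lte_fin// -EFinM addye// ltry.
- by move=> *; rewrite !gt0_muley ?lte_fin// addey// ltry.
Qed.

Section rV_fubini.
Context {R : realType}.

Lemma integral_rVS n (F : 'rV[R]_n.+1 -> \bar R) :
  measurable_fun setT F -> (forall x, 0 <= F x)%E ->
  (\int[lebesgue_rV n.+1]_z F z =
   \int[@lebesgue_measure R]_a \int[lebesgue_rV n]_x F (cons_rV (a, x)))%E.
Proof.
move=> mF F0.
pose m := ((@lebesgue_measure R) \x lebesgue_rV n)%E.
have mc : measurable_fun setT (@cons_rV R n) by exact: measurable_cons_rV.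
transitivity (\int[image_measure m mc]_z F z)%E.
  by apply: eq_measure_integral.
rewrite ge0_integral_image_measure//.
rewrite (@fubini_tonelli1 _ _ _ _ _ _ _ (fun z => F (cons_rV z)))//.
exact: measurableT_comp.
Qed.

Lemma measurable_slice n (F : 'rV[R]_n.+1 -> \bar R) (a : R) :
  measurable_fun setT F -> measurable_fun setT (fun x => F (cons_rV (a, x))).
Proof.
move=> mF; apply: measurableT_comp => //.
apply: (measurableT_comp (@measurable_cons_rV R n)).
exact: pair1_measurable.
Qed.

Lemma measurable_slice_integral n (F : 'rV[R]_n.+1 -> \bar R) :
  measurable_fun setT F -> (forall x, 0 <= F x)%E ->
  measurable_fun [set: measurableTypeR R]
    (fun a => \int[lebesgue_rV n]_x F (cons_rV (a, x)))%E.
Proof.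
move=> mF F0.
apply: (@measurable_fun_fubini_tonelli_F _ _ _ _ _ _ (fun z => F (cons_rV z))) => //.
by apply: measurableT_comp => //; exact: measurable_cons_rV.
Qed.

Lemma cons_rVD n (a b : R) (x y : 'rV[R]_n) :
  cons_rV (a, x) + cons_rV (b, y) = cons_rV (a + b, x + y).
Proof.
apply/rowP => i; rewrite /cons_rV !mxE.
by case: unliftP => [j _|_] //=; rewrite !mxE.
Qed.

Lemma rV0E (x : 'rV[R]_0) : x = 0.
Proof. by apply/rowP => -[]. Qed.

Lemma integral_rV0 (F : 'rV[R]_0 -> \bar R) :
  measurable_fun setT F -> (\int[lebesgue_rV 0]_x F x = F 0%R)%E.
Proof.
by move=> mF; rewrite /= integral_dirac//= diracT mul1e.
Qed.

(** Integrating out one coordinate costs one unit of the exponent. *)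
Theorem borell_brascamp_lieb n (e : R) (F G H : 'rV[R]_n -> \bar R) :
  n%:R <= e ->
  measurable_fun setT F -> measurable_fun setT G -> measurable_fun setT H ->
  (forall x, 0 <= F x)%E -> (forall x, 0 <= G x)%E -> (forall x, 0 <= H x)%E ->
  (forall x y, bbl e (F x) (G y) (H (x + y))) ->
  bbl (e - n%:R) (\int[lebesgue_rV n]_x F x) (\int[lebesgue_rV n]_x G x)
    (\int[lebesgue_rV n]_x H x).
Proof.
elim: n F G H => [|n IH] F G H ne mF mG mH F0 G0 H0 FGH.
  rewrite !integral_rV0// subr0.
  by have := FGH 0 0; rewrite addr0.
rewrite !integral_rVS//.
have -> : e - n.+1%:R = (e - n%:R) - 1 by rewrite -natr1; ring.
apply: bbl_line.
- by rewrite lerBrDl natr1.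
- exact: measurable_slice_integral.
- exact: measurable_slice_integral.
- exact: measurable_slice_integral.
- by move=> a; apply: integral_ge0.
- by move=> a; apply: integral_ge0.
- by move=> a; apply: integral_ge0.
move=> a b; apply: IH => //.
- by apply: le_trans ne; rewrite ler_nat.
- exact: measurable_slice.
- exact: measurable_slice.
- exact: measurable_slice.
by move=> x y; have := FGH (cons_rV (a, x)) (cons_rV (b, y)); rewrite cons_rVD.
Qed.
End rV_fubini.

(** * Linear weights, slices, and Borel sets of the space of row vectors *)

(** For the conclusion with the weight $\lambda$, the hypothesis is used with the
weight $((e-c)\lambda + c\theta)/e$, where $\theta = l/(l+l')$; the arithmetic mean
of $\lambda$ and $\theta$ in these proportions is at least their geometric mean. *)
Lemma bbl_weight (R : realType) (e c l l' : R) (a b h : \bar R) :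
  0 <= c <= e -> 0 < l -> 0 < l' -> bbl e a b h ->
  bbl (e - c) (a * (l `^ c)%:E) (b * (l' `^ c)%:E) (h * ((l + l') `^ c)%:E).
Proof.
move=> /andP[c0 ce] l0 l'0 abh.
have [->|cn0] := eqVneq c 0; first by rewrite !powRr0 subr0 !mule1.
have {cn0}c_gt0 : 0 < c by rewrite lt_neqAle eq_sym cn0.
have e0 : 0 < e by exact: lt_le_trans ce.
have ll0 : 0 < l + l' by exact: addr_gt0.
move=> nu s /andP[nu0 nu1] s0.
pose t := l / (l + l').
have t0 : 0 < t by exact: divr_gt0.
have t1 : 0 < 1 - t.
  by rewrite subr_gt0 /t ltr_pdivrMr// mul1r ltrDl.
have t1E : 1 - t = l' / (l + l') by rewrite /t; field; rewrite gt_eqF.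
have nu1' : 0 < 1 - nu by rewrite subr_gt0.
(* the weights balance the two exponents, and stay conjugate because they are
   arithmetic means *)
pose mean x y := (1 - c / e) * x + c / e * y.
have ce0 : 0 < c / e by exact: divr_gt0.
have ce1 : 0 <= 1 - c / e by rewrite subr_ge0 ler_pdivrMr// mul1r.
have ce01 : 0 <= c / e <= 1 by rewrite (ltW ce0) -subr_ge0.
have main x y : 0 < x -> 0 < y -> x `^ (e - c) * y `^ c <= mean x y `^ e.
  move=> x0 y0.
  have := @weighted_amgm_le _ y x (c / e) (ltW y0) (ltW x0) ce01.
  move=> /(@ge0_ler_powR _ e (ltW e0)); rewrite !nnegrE.
  rewrite mulr_ge0 ?powR_ge0//.
  rewrite (addr_ge0 (mulr_ge0 (ltW ce0) (ltW y0)) (mulr_ge0 ce1 (ltW x0))).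
  move=> /(_ isT isT); rewrite (_ : mean x y = c / e * y + (1 - c / e) * x); last first.
    by rewrite /mean addrC.
  apply: le_trans.
  rewrite powRM ?powR_ge0// -!powRrM mulrC.
  rewrite (_ : c / e * e = c); last by field; rewrite gt_eqF.
  by rewrite (_ : (1 - c / e) * e = e - c)//; field; rewrite gt_eqF.
have m01 : 0 < mean nu t < 1.
  have p0 : 0 < mean nu t := ltr_wpDl (mulr_ge0 ce1 (ltW nu0)) (mulr_gt0 ce0 t0).
  have p1 : 0 < mean (1 - nu) (1 - t) :=
    ltr_wpDl (mulr_ge0 ce1 (ltW nu1')) (mulr_gt0 ce0 t1).
  rewrite p0 -subr_gt0 (_ : 1 - mean nu t = mean (1 - nu) (1 - t))//.
  by rewrite /mean; ring.
have m1E : 1 - mean nu t = mean (1 - nu) (1 - t) by rewrite /mean; ring.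
have L0 : 0 < (l + l') `^ c by exact: powR_gt0.
have key (x y z : R) (k : \bar R) : 0 < x -> 0 < y -> 0 < z ->
    y = z / (l + l') ->
    (s%:E < (x `^ (e - c))%:E * (k * (z `^ c)%:E) ->
     (s / (l + l') `^ c)%:E < (mean x y `^ e)%:E * k)%E.
  move=> x0 y0 z0 yz sk.
  have k0 : (0 <= k)%E.
    rewrite leNgt; apply/negP => k0.
    suff /(lt_le_trans sk) : ((x `^ (e - c))%:E * (k * (z `^ c)%:E) <= 0)%E.
      by rewrite lte_fin ltNge s0.
    by rewrite mule_ge0_le0 ?lee_fin ?powR_ge0// mule_le0_ge0 ?lee_fin ?powR_ge0// (ltW k0).
  have : (s%:E / ((l + l') `^ c)%:E < (x `^ (e - c) * y `^ c)%:E * k)%E.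
    rewrite inver (gt_eqF L0) lte_pdivrMr//.
    rewrite muleAC -EFinM -mulrA yz powRM ?invr_ge0 ?(ltW z0) ?(ltW ll0)//.
    rewrite -mulrA -powRM ?invr_ge0 ?(ltW ll0)// mulVf ?gt_eqF// powR1 mulr1.
    by rewrite EFinM muleAC -muleA.
  rewrite inver (gt_eqF L0) -EFinM => /lt_le_trans; apply.
  by apply: lee_wpmul2r => //; rewrite lee_fin; exact: main.
move=> sa sb; rewrite -lte_pdivrMr// -EFinM; apply: (abh (mean nu t)) => //.
- by rewrite divr_ge0// ltW.
- exact: key sa.
- by rewrite m1E; exact: key sb.
Qed.

Section rV_lebesgue.
Context {R : realType}.

Lemma measurable_rV_affine n (c : R) (b : 'rV[R]_n) :
  measurable_fun setT (fun x : 'rV[R]_n => c *: x + b).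
Proof.
apply: measurable_fun_rVP => i; under eq_fun do rewrite !mxE.
apply: measurable_funD; last exact: measurable_cst.
by apply: measurable_funM; [exact: measurable_cst|exact: measurable_coor].
Qed.

Lemma integral_rV_affine n (c : R) (b : 'rV[R]_n) (F : 'rV[R]_n -> \bar R) :
  c != 0 -> measurable_fun setT F -> (forall x, 0 <= F x)%E ->
  (\int[lebesgue_rV n]_x F x =
   (`|c| ^+ n)%:E * \int[lebesgue_rV n]_x F (c *: x + b)%R)%E.
Proof.
move=> c0; elim: n b F => [|n IH] b F mF F0.
  have mF' : measurable_fun setT (fun x : 'rV[R]_0 => F (c *: x + b)).
    by apply: measurableT_comp => //; exact: measurable_rV_affine.
  by rewrite !integral_rV0// expr0 mul1e (rV0E (_ + _)).
have mF' : measurable_fun setT (fun x : 'rV[R]_n.+1 => F (c *: x + b)).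
  by apply: measurableT_comp => //; exact: measurable_rV_affine.
rewrite (integral_rVS mF F0) (integral_rVS mF' (fun=> F0 _)).
rewrite (@integral_affine _ c (b ord0 ord0))//; last 2 first.
- exact: measurable_slice_integral.
- by move=> a; exact: integral_ge0.
rewrite exprS EFinM -muleA; congr (_ * _)%E.
rewrite -ge0_integralZl_EFin//; first last.
- exact: (measurable_slice_integral mF').
- by move=> a _; exact: integral_ge0.
apply: eq_integral => a _.
rewrite (IH (\row_j b ord0 (lift ord0 j)))//; last exact: measurable_slice.
congr (_ * _)%E; apply: eq_integral => x _; congr F.
apply/rowP => i; rewrite /cons_rV !mxE.
by case: unliftP => [j ->|->] /=; rewrite ?mxE.
Qed.

Lemma integral_rV_translate n (b : 'rV[R]_n) (F : 'rV[R]_n -> \bar R) :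
  measurable_fun setT F -> (forall x, 0 <= F x)%E ->
  (\int[lebesgue_rV n]_x F x = \int[lebesgue_rV n]_x F (x + b)%R)%E.
Proof.
move=> mF F0; rewrite (integral_rV_affine b (oner_neq0 R) mF F0).
rewrite normr1 expr1n mul1e.
by apply: eq_integral => x _; rewrite scale1r.
Qed.

Definition slice_sup n (F : 'rV[R]_n.+1 -> \bar R) : \bar R :=
  ereal_sup (range (fun a => \int[lebesgue_rV n]_x F (cons_rV (a, x))))%E.

(** Slices satisfy the Borell-Brascamp-Lieb inequality with the exponent equal
to their dimension, whose conclusion is a minimum; when the largest slices
agree, integrating over the first coordinate turns the minimum into a sum. *)
Lemma slice_brunn_minkowski n (F G H : 'rV[R]_n.+1 -> \bar R) :
  measurable_fun setT F -> measurable_fun setT G -> measurable_fun setT H ->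
  (forall x, 0 <= F x)%E -> (forall x, 0 <= G x)%E -> (forall x, 0 <= H x)%E ->
  (forall x y, bbl n%:R (F x) (G y) (H (x + y))) ->
  slice_sup F = slice_sup G ->
  (\int[lebesgue_rV n.+1]_x F x + \int[lebesgue_rV n.+1]_x G x <=
   \int[lebesgue_rV n.+1]_x H x)%E.
Proof.
move=> mF mG mH F0 G0 H0 FGH FG; rewrite !integral_rVS//.
apply: prekopa_line.
- exact: measurable_slice_integral.
- exact: measurable_slice_integral.
- exact: measurable_slice_integral.
- by move=> a; apply: integral_ge0.
- by move=> a; apply: integral_ge0.
- by move=> a; apply: integral_ge0.
- have lev (K : 'rV[R]_n.+1 -> \bar R) r :
      (exists a, r%:E < \int[lebesgue_rV n]_x K (cons_rV (a, x)))%E <->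
      (r%:E < slice_sup K)%E.
    split=> [[a] /lt_le_trans|/ereal_sup_gt[_ [a _ <-] ra]]; last by exists a.
    by apply; apply: ereal_sup_ubound; exists a.
  by move=> r _; rewrite !lev FG.
move=> a b r r0 rF rG.
have := @borell_brascamp_lieb _ n n%:R (fun x => F (cons_rV (a, x)))
  (fun x => G (cons_rV (b, x))) (fun x => H (cons_rV (a + b, x))) (lexx _).
move=> /(_ (measurable_slice _ mF) (measurable_slice _ mG) (measurable_slice _ mH)).
move=> /(_ (fun=> F0 _) (fun=> G0 _) (fun=> H0 _)); rewrite subrr.
have h x y : bbl n%:R (F (cons_rV (a, x))) (G (cons_rV (b, y))) (H (cons_rV (a + b, x + y))).
  by have := FGH (cons_rV (a, x)) (cons_rV (b, y)); rewrite cons_rVD.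
by move=> /(_ h 2^-1 r); rewrite !powRr0 !mul1e invr_gt0 invf_lt1 ?ltr1n// ltr0n; apply.
Qed.

(** The slices have dimension [n], so this is the dilation that preserves their
masses, while it multiplies the total mass by [s]. *)
Lemma slice_sup_dilate n (s : R) (G : 'rV[R]_n.+1 -> \bar R) : 0 < s ->
  measurable_fun setT G -> (forall x, 0 <= G x)%E ->
  slice_sup (fun y => (s ^- n)%:E * G (s^-1 *: y))%E = slice_sup G.
Proof.
move=> s0 mG G0; rewrite /slice_sup.
have E a : (\int[lebesgue_rV n]_x G (cons_rV (a, x)) =
    \int[lebesgue_rV n]_x ((s ^- n)%:E * G (s^-1 *: cons_rV ((s * a)%R, x))))%E.
  have iv0 : s^-1 != 0 by rewrite invr_eq0 gt_eqF.
  rewrite (integral_rV_affine 0 iv0)//; last exact: measurable_slice.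
  rewrite normfV gtr0_norm// -exprVn -ge0_integralZl_EFin//; last 2 first.
  - apply: (measurableT_comp (measurable_slice a mG)).
    exact: measurable_rV_affine.
  - by rewrite exprn_ge0// invr_ge0 ltW.
  apply: eq_integral => x _; congr (_ * G _)%E.
  apply/rowP => i; rewrite /cons_rV !mxE addr0.
  by case: (unlift ord0 i) => [j|] /=; rewrite ?mxE ?addr0// mulKf ?gt_eqF.
congr ereal_sup; apply/seteqP; split => _ [a _ <-].
  by exists (s^-1 * a) => //; rewrite E mulVKf ?gt_eqF.
by exists (s * a).
Qed.

Lemma measurable_rV_ball n (x : 'rV[R]_n) (e : R) : measurable (ball x e).
Proof.
have [e0|e0] := leP e 0.
  by rewrite (_ : ball x e = set0)// -subset0 => y [] /=; rewrite ltNge e0.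
rewrite (_ : ball x e = \bigcap_(i in [set: 'I_n])
   ((fun z : 'rV[R]_n => z ord0 i : measurableTypeR R) @^-1` (ball (x ord0 i) e))).
  apply: fin_bigcap_measurable => // i _.
  by rewrite -[X in measurable X]setTI; apply: measurable_coor => //; exact: measurable_ball.
apply/seteqP; split => y /=; first by move=> [_ h] i _; exact: h.
by move=> h; split => // i j; rewrite ord1; exact: h.
Qed.

(** Open sets are countable unions of sup-norm balls with rational centres, which
are boxes. *)
Lemma open_rV_measurable n (U : set 'rV[R]_n) : open U -> measurable U.
Proof.
move=> oU.
pose qpt (q : 'rV[rat]_n) : 'rV[R]_n := map_mx ratr q.
pose D (z : 'rV[rat]_n * nat) : set 'rV[R]_n :=
  if pselect (ball (qpt z.1) z.2.+1%:R^-1 `<=` U) then ball (qpt z.1) z.2.+1%:R^-1 else set0.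
have -> : U = \bigcup_z D z.
  apply/seteqP; split => [x Ux|x [z _]]; last first.
    by rewrite /D; case: pselect => //; apply.
  have /nbhs_ballP[e e0 xe] := open_nbhs_nbhs (conj oU Ux).
  pose k := Num.truncn (2 / e).
  have k0 : 0 < k.+1%:R^-1 :> R by rewrite invr_gt0.
  have ke : 2 * k.+1%:R^-1 < e.
    by rewrite ltr_pdivrMr// mulrC -ltr_pdivrMr//; exact: truncnS_gt.
  have [d dE] : exists d : R, k.+1%:R^-1 = d by eexists.
  rewrite dE in k0 ke.
  have H (i : 'I_n) : exists q : rat, `|x ord0 i - ratr q| < d.
    have /rat_in_itvoo[q] : x ord0 i - d < x ord0 i + d by lra.
    rewrite in_itv/= => /andP[q1 q2]; exists q; rewrite ltr_norml.
    by apply/andP; split; lra.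
  pose q : 'rV[rat]_n := \row_i sval (cid (H i)).
  have qx : ball (qpt q) d x.
    split => // i j; rewrite ord1 !mxE; case: cid => /= r.
    by rewrite /ball/= distrC.
  exists (q, k) => //; rewrite /D; rewrite /= dE; case: pselect => //= -[] y qy; apply: xe.
  apply: (@le_ball _ _ _ (d + d)); first by lra.
  by apply: (ball_triangle (y := qpt q)) => //; exact: ball_sym.
apply: countable_bigcupT_measurable; first exact: countableP.
by move=> z; rewrite /D; case: (pselect _) => h /=; [exact: measurable_rV_ball|exact: measurable0].
Qed.

Lemma measurable_fun_open_preimage d (T : measurableType d) (D : set T) (f : T -> R) :
  measurable D -> (forall r, measurable (D `&` [set x | r < f x])) ->
  measurable_fun D f.
Proof.
move=> mD H; apply: (measurability _ (RGenOInfty.measurableE R)) => //.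
by move=> /= _ [_ [a ->] <-]; rewrite preimage_itvoy.
Qed.

Lemma continuous_rV_measurable n (U : set 'rV[R]_n) (f : 'rV[R]_n -> R) :
  open U -> {in U, continuous f} -> measurable_fun U f.
Proof.
move=> oU cf; apply: measurable_fun_open_preimage.
  exact: open_rV_measurable.
move=> r; apply: open_rV_measurable.
rewrite openE => x [Ux rx]; rewrite /interior.
apply: filterI; first exact: open_nbhs_nbhs.
have : f y @[y --> x] --> f x by apply: cf; rewrite inE.
move=> /(_ [set z | r < z]); apply.
by apply: open_nbhs_nbhs; split => //; exact: open_gt.
Qed.
End rV_lebesgue.

(** * The Euclidean norm, and inequalities between powers *)

Section euclidean.
Context {R : realType} {n : nat}.
Implicit Types x y z a : 'rV[R]_n.

Lemma dotpC x y : dotp x y = dotp y x.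
Proof. by apply: eq_bigr => i _; rewrite mulrC. Qed.

Lemma dotpDr a x y : dotp a (x + y) = dotp a x + dotp a y.
Proof. by rewrite /dotp -big_split; apply: eq_bigr => i _; rewrite mxE mulrDr. Qed.

Lemma dotpZr c a x : dotp a (c *: x) = c * dotp a x.
Proof. by rewrite /dotp mulr_sumr; apply: eq_bigr => i _; rewrite mxE mulrCA. Qed.

Lemma dotpNr a x : dotp a (- x) = - dotp a x.
Proof. by rewrite -scaleN1r dotpZr mulN1r. Qed.

Lemma dotpBr a x y : dotp a (x - y) = dotp a x - dotp a y.
Proof. by rewrite dotpDr dotpNr. Qed.

Lemma dotpDl x y a : dotp (x + y) a = dotp x a + dotp y a.
Proof. by rewrite dotpC dotpDr !(dotpC a). Qed.

Lemma dotpZl c x a : dotp (c *: x) a = c * dotp x a.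
Proof. by rewrite dotpC dotpZr (dotpC a). Qed.

Lemma dotpNl x a : dotp (- x) a = - dotp x a.
Proof. by rewrite dotpC dotpNr (dotpC a). Qed.

Lemma dotpBl x y a : dotp (x - y) a = dotp x a - dotp y a.
Proof. by rewrite dotpDl dotpNl. Qed.

Lemma dotp0r a : dotp a 0 = 0.
Proof. by rewrite -(scale0r 0) dotpZr mul0r. Qed.

Lemma dotp_ge0 x : 0 <= dotp x x.
Proof. by apply: sumr_ge0 => i _; rewrite -expr2 sqr_ge0. Qed.

Lemma dotp_eq0 x : dotp x x = 0 -> x = 0.
Proof.
move=> /eqP; rewrite psumr_eq0; last by move=> i _; rewrite -expr2 sqr_ge0.
move=> /allP h; apply/rowP => i; rewrite mxE.
by have := h i (mem_index_enum i); rewrite /= mulf_eq0 orbb => /eqP.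
Qed.

Lemma enorm_ge0 x : 0 <= enorm x.
Proof. exact: sqrtr_ge0. Qed.

Lemma sqr_enorm x : enorm x ^+ 2 = dotp x x.
Proof. by rewrite sqr_sqrtr// dotp_ge0. Qed.

Lemma enorm0 : enorm (0 : 'rV[R]_n) = 0.
Proof. by rewrite /enorm dotp0r sqrtr0. Qed.

Lemma enormZ c x : enorm (c *: x) = `|c| * enorm x.
Proof.
rewrite /enorm dotpZl dotpZr mulrA -expr2 sqrtrM ?sqr_ge0//.
by rewrite sqrtr_sqr.
Qed.

Lemma enormN x : enorm (- x) = enorm x.
Proof. by rewrite -scaleN1r enormZ normrN1 mul1r. Qed.

Lemma cauchy_schwarz x y : `|dotp x y| <= enorm x * enorm y.
Proof.
rewrite -(@ler_pXn2r _ 2)// ?nnegrE ?mulr_ge0 ?enorm_ge0//.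
rewrite exprMn !sqr_enorm real_normK ?num_real//.
have [y0|y0] := eqVneq (dotp y y) 0.
  by rewrite y0 mulr0 (dotp_eq0 y0) dotp0r expr0n.
have yy : 0 < dotp y y by rewrite lt_neqAle eq_sym y0 dotp_ge0.
have := dotp_ge0 (dotp y y *: x - dotp x y *: y).
rewrite dotpBl !dotpBr !dotpZl !dotpZr (dotpC y x).
set A := dotp x x; set B := dotp x y; set C := dotp y y in yy *.
have -> : C * (C * A) - C * (B * B) - (B * (C * B) - B * (B * C)) = C * (A * C - B ^+ 2).
  by rewrite expr2; ring.
by rewrite pmulr_rge0// subr_ge0.
Qed.

Lemma enormD x y : enorm (x + y) <= enorm x + enorm y.
Proof.
rewrite -(@ler_pXn2r _ 2)// ?nnegrE ?addr_ge0 ?enorm_ge0//.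
rewrite sqrrD !sqr_enorm dotpDl !dotpDr (dotpC y x).
have := le_trans (ler_norm _) (cauchy_schwarz x y); lra.
Qed.

Lemma enorm_le_norm x : enorm x <= n.+1%:R * `|x|.
Proof.
rewrite -(@ler_pXn2r _ 2)// ?nnegrE ?mulr_ge0 ?enorm_ge0//.
rewrite sqr_enorm exprMn.
apply: (@le_trans _ _ (\sum_(i < n) `|x| ^+ 2)).
  apply: ler_sum => i _; rewrite -expr2 -(@real_normK _ (x _ _)) ?num_real//.
  rewrite ler_pXn2r// ?nnegrE//.
  rewrite [leRHS]/Num.norm/= mx_normrE.
  exact: (le_bigmax _ (fun ij : 'I_1 * 'I_n => `|x ij.1 ij.2|) (ord0, i)).
rewrite sumr_const card_ord -[X in X <= _]mulr_natl.
apply: ler_wpM2r; first exact: sqr_ge0.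
by rewrite -natrX ler_nat (leq_trans (leqnSn n))// expnS expn1 leq_pmulr.
Qed.

Lemma coord_le_enorm x i : `|x ord0 i| <= enorm x.
Proof.
rewrite -(@ler_pXn2r _ 2)// ?nnegrE ?enorm_ge0//.
rewrite sqr_enorm real_normK ?num_real// /dotp (bigD1 i)//= -expr2 lerDl.
by apply: sumr_ge0 => j _; rewrite -expr2 sqr_ge0.
Qed.

Lemma norm_le_enorm x : `|x| <= enorm x.
Proof.
rewrite [leLHS]/Num.norm/= mx_normrE; apply: bigmax_le; first exact: enorm_ge0.
by move=> [i j] _ /=; rewrite ord1 coord_le_enorm.
Qed.

Lemma measurable_dotp a : measurable_fun setT (dotp a : 'rV[R]_n -> R).
Proof.
rewrite (_ : dotp a = fun x => \sum_(i < n) a ord0 i * x ord0 i)//.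
apply: measurable_sum => i; apply: measurable_funM; first exact: measurable_cst.
exact: measurable_coor.
Qed.

Lemma measurable_enorm : measurable_fun setT (enorm : 'rV[R]_n -> R).
Proof.
apply: (measurable_comp (F := setT)) => //.
  apply: continuous_measurable_fun; exact: sqrt_continuous.
rewrite (_ : (fun x => dotp x x) = fun x : 'rV[R]_n => \sum_(i < n) x ord0 i * x ord0 i)//.
by apply: measurable_sum => i; apply: measurable_funM; exact: measurable_coor.
Qed.

Lemma coord_continuous_rV (i : 'I_n) : continuous (fun x : 'rV[R]_n => x ord0 i).
Proof. exact: coord_continuous. Qed.

Lemma continuous_sum (I : Type) (r : seq I) (f : I -> 'rV[R]_n -> R) :
  (forall i, continuous (f i)) -> continuous (fun x => \sum_(i <- r) f i x).
Proof.
move=> cf x; elim: r => [|i r IH].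
  by under eq_fun do rewrite big_nil; exact: cst_continuous.
by under eq_fun do rewrite big_cons; apply: continuousD => //; exact: cf.
Qed.

Lemma dotp_continuous a : continuous (dotp a : 'rV[R]_n -> R).
Proof.
apply: continuous_sum => i x.
by apply: continuousM; [exact: cst_continuous|exact: coord_continuous_rV].
Qed.

Lemma sqr_enorm_continuous : continuous (fun x : 'rV[R]_n => dotp x x).
Proof.
by apply: continuous_sum => i x; apply: continuousM; exact: coord_continuous_rV.
Qed.

Lemma enorm_continuous : continuous (enorm : 'rV[R]_n -> R).
Proof.
move=> x; apply: (@continuous_comp _ _ _ (fun y : 'rV[R]_n => dotp y y) Num.sqrt).
  exact: sqr_enorm_continuous.
exact: sqrt_continuous.
Qed.
End euclidean.

Section power_inequalities.
Context {R : realType}.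
Implicit Types a b t p k : R.

Lemma powR_tangent a b p : 1 <= p -> 0 <= a -> 0 <= b ->
  p * a `^ (p - 1) * b <= b `^ p + (p - 1) * a `^ p.
Proof.
move=> p1 a0 b0; have p0 : 0 < p by exact: lt_le_trans p1.
have ip : 0 <= p^-1 <= 1 by rewrite invr_ge0 (ltW p0)/= invf_le1.
have := @weighted_amgm_le _ (b `^ p) (a `^ p) p^-1 (powR_ge0 _ _) (powR_ge0 _ _) ip.
rewrite -!powRrM mulfV ?gt_eqF// powRr1//.
have -> : p * (1 - p^-1) = p - 1 by field; rewrite gt_eqF.
move=> /(ler_wpM2l (ltW p0)).
have -> : p * (p^-1 * b `^ p + (1 - p^-1) * a `^ p) = b `^ p + (p - 1) * a `^ p.
  by field; rewrite gt_eqF.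
by rewrite (mulrC b) mulrA.
Qed.

(** Negative powers are convex, so the graph lies above its tangents. *)
Lemma powRN_tangent a b k : 0 < k -> 0 < a -> 0 < b ->
  a `^ (- k) - k * a `^ (- k - 1) * (b - a) <= b `^ (- k).
Proof.
move=> k0 a0 b0; have k1 : 0 < 1 + k by rewrite addr_gt0.
have ik : 0 <= (1 + k)^-1 <= 1.
  by rewrite invr_ge0 (ltW k1)/= invf_le1// lerDl ltW.
have := @weighted_amgm_le _ (b `^ (- k)) (a `^ (- k - 1) * b) (1 + k)^-1
  (powR_ge0 _ _) (mulr_ge0 (powR_ge0 _ _) (ltW b0)) ik.
rewrite powRM ?powR_ge0 ?(ltW b0)// -!powRrM.
set t := (1 + k)^-1.
have tE : (1 + k) * t = 1 by rewrite /t mulfV ?gt_eqF.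
have -> : (- k - 1) * (1 - t) = - k.
  by transitivity ((1 + k) * t - (1 + k)); [ring|rewrite tE; ring].
rewrite mulrCA -powRD; last by rewrite (gt_eqF b0) implybT.
have -> : - k * t + (1 - t) = 0.
  by transitivity (1 - (1 + k) * t); [ring|rewrite tE; ring].
rewrite powRr0 mulr1 => /(ler_wpM2l (ltW k1)).
have -> : (1 + k) * (t * b `^ (- k) + (1 - t) * (a `^ (- k - 1) * b)) =
  b `^ (- k) + k * a `^ (- k - 1) * b.
  transitivity (((1 + k) * t) * b `^ (- k) +
    (1 + k - (1 + k) * t) * (a `^ (- k - 1) * b)); first ring.
  by rewrite tE; ring.
have aa : a `^ (- k - 1) * a = a `^ (- k).
  by rewrite -{2}(powRr1 (ltW a0)) -powRD ?subrK// (gt_eqF a0) implybT.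
by rewrite -aa; lra.
Qed.

(** The last term is the Legendre transform of $r^{p'}$ at $kX$. *)
Lemma scaled_young (p p' k X r : R) : 1 < p -> p^-1 + p'^-1 = 1 -> 0 < k ->
  0 <= X -> 0 <= r ->
  k * X * r <= r `^ p' + (p' - 1) * (k / p') `^ p * X `^ p.
Proof.
move=> p1 pp' k0 X0 r0.
have p0 : 0 < p by exact: lt_trans p1.
have ip' : 0 < p'^-1.
  by rewrite -(addKr p^-1 p'^-1) pp' addrC subr_gt0 invf_lt1.
have p'0 : 0 < p' by rewrite -invr_gt0.
have := @conjugate_powR R r (k / p' * X) p' p r0 _ p'0 p0.
rewrite mulr_ge0 ?divr_ge0 ?(ltW k0) ?(ltW p'0)// => /(_ isT).
rewrite addrC => /(_ pp') /(ler_wpM2l (ltW p'0)).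
have -> : p' * (r * (k / p' * X)) = k * X * r by field; rewrite gt_eqF.
rewrite powRM ?divr_ge0 ?(ltW k0) ?(ltW p'0)//.
have -> : p' * (r `^ p' / p' + (k / p') `^ p * X `^ p / p) =
  r `^ p' + (p' / p) * (k / p') `^ p * X `^ p by field; rewrite !gt_eqF.
have -> // : p' / p = p' - 1.
have -> : p^-1 = 1 - p'^-1 by rewrite -pp' addrK.
by field; rewrite gt_eqF.
Qed.

Lemma powR_continuous_at a p : 0 < a -> {for a, continuous (@powR R ^~ p)}.
Proof.
move=> a0; apply: differentiable_continuous; apply/derivable1_diffP.
by apply: derivable_powR; rewrite in_itv/= andbT.
Qed.
End power_inequalities.

(** * The mean of two powers and its first order expansion *)

Section harmonic_mean.
Context {R : realType}.
Implicit Types (e k s V F r : R).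

Lemma ler_powRN (a b t : R) : 0 <= t -> 0 < a -> a <= b -> b `^ (- t) <= a `^ (- t).
Proof.
move=> t0 a0 ab; have b0 : 0 < b by exact: lt_le_trans ab.
rewrite !powRN lef_pV2 ?posrE ?powR_gt0//.
by apply: ge0_ler_powR => //; rewrite ?nnegrE ltW.
Qed.

(** The value produced by sup-convolving $F^{ke}$ with $(s V)^{-e}$ at a single
pair of points, extended by its limit [0] at [F = 0]. *)
Definition hmean e k s V F : R :=
  if F == 0 then 0 else (F `^ (- k) + s * V) `^ (- e).

Lemma hmean_le e k s V F F' : 0 < e -> 0 < k -> 0 <= s -> 0 <= V ->
  0 <= F -> F <= F' -> hmean e k s V F <= hmean e k s V F'.
Proof.
move=> e0 k0 s0 V0 F0 FF'; rewrite /hmean.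
have [F00|Fn0] := eqVneq F 0.
  by case: ifP => // _; exact: powR_ge0.
have Fp : 0 < F by rewrite lt_neqAle eq_sym Fn0.
have F'p : 0 < F' by exact: lt_le_trans FF'.
rewrite (gt_eqF F'p); apply: ler_powRN; first exact: ltW.
  by rewrite ltr_pwDl ?powR_gt0// mulr_ge0.
by rewrite lerD2r; apply: ler_powRN => //; exact: ltW.
Qed.

Lemma hmean_le_pow e k s V F : 0 < e -> 0 <= s -> 0 <= V -> 0 <= F ->
  hmean e k s V F <= F `^ (k * e).
Proof.
move=> e0 s0 V0 F0; rewrite /hmean; case: ifPn => [_|Fn0]; first exact: powR_ge0.
have Fp : 0 < F by rewrite lt_neqAle eq_sym Fn0.
have -> : F `^ (k * e) = (F `^ (- k)) `^ (- e) by rewrite -powRrM mulrNN.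
by apply: ler_powRN; rewrite ?powR_gt0 ?(ltW e0)// lerDl mulr_ge0.
Qed.

Lemma bbl_hmean e k s V F : 0 < e -> 0 < s -> 0 < V -> 0 <= F -> 0 < k ->
  bbl e (F `^ (k * e))%:E ((s `^ (- e)) * V `^ (- e))%:E (hmean e k s V F)%:E.
Proof.
move=> e0 s0 V0 F0 k0 l r /andP[l0 l1] r0; rewrite -!EFinM !lte_fin.
rewrite /hmean; case: ifPn => [/eqP ->|Fn0].
  by rewrite powR0 ?mulr0 ?mulf_neq0 ?gt_eqF// ltNge r0.
have Fp : 0 < F by rewrite lt_neqAle eq_sym Fn0.
have l1' : 0 < 1 - l by rewrite subr_gt0.
set U := F `^ (- k).
have U0 : 0 < U by exact: powR_gt0.
have sV0 : 0 < s * V by exact: mulr_gt0.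
have -> : F `^ (k * e) = U `^ (- e) by rewrite -powRrM mulrNN.
have E (a t : R) : 0 < a -> 0 < t -> t `^ e * a `^ (- e) = (a / t) `^ (- e).
  move=> a0 t0; rewrite powRM ?invr_ge0 ?(ltW a0) ?(ltW t0)// mulrC; congr (_ * _).
  by rewrite -(powR_inv1 (ltW t0)) -powRrM mulN1r opprK.
rewrite E// -powRM ?(ltW s0) ?(ltW V0)// E// => rU rV.
have [h|h] := leP (U / l) (s * V / (1 - l)).
  apply: lt_le_trans rV _; apply: ler_powRN; rewrite ?(ltW e0) ?addr_gt0//.
  move: h; rewrite ler_pdivlMr// mulrAC ler_pdivrMr// ler_pdivlMr//; nra.
apply: lt_le_trans rU _; apply: ler_powRN; rewrite ?(ltW e0) ?addr_gt0//.
move: h; rewrite ltr_pdivlMr// mulrAC ltr_pdivrMr// ler_pdivlMr//; nra.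
Qed.

(** Strict lower bounds persist when [F] decreases a little.  This makes the
sup-convolution lower semicontinuous, hence measurable. *)
Lemma hmean_lsc e k s V F r : 0 < e -> 0 < k -> 0 <= s -> 0 <= V -> 0 <= F ->
  0 <= r -> r < hmean e k s V F ->
  exists2 F0, 0 <= F0 < F & r < hmean e k s V F0.
Proof.
move=> e0 k0 s0 V0 F0 r0; rewrite {1}/hmean; case: ifPn => [_|Fn0].
  by rewrite ltNge r0.
have Fp : 0 < F by rewrite lt_neqAle eq_sym Fn0.
move=> rF.
have U0 : 0 < F `^ (- k) + s * V by rewrite ltr_pwDl ?powR_gt0// mulr_ge0.
have c1 : {for F, continuous (fun F' : R => F' `^ (- k) + s * V)}.
  by apply: continuousD; [exact: powR_continuous_at|exact: cst_continuous].
have c2 : {for F, continuous (fun F' : R => (F' `^ (- k) + s * V) `^ (- e))}.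
  apply: (@continuous_comp _ _ _ (fun F' : R => F' `^ (- k) + s * V)
    (fun u => u `^ (- e)) F) => //.
  exact: powR_continuous_at.
have near1 : \forall F' \near F, r < (F' `^ (- k) + s * V) `^ (- e).
  move: c2 => /(_ [set u | r < u]); apply.
  by apply: open_nbhs_nbhs; split => //; exact: open_gt.
have /nbhs_ballP[d /= d0 dF] := near1.
pose F1 := Num.max (F / 2) (F - d / 2).
have F1F : F1 < F by rewrite /F1 gt_max; apply/andP; split; lra.
have F10 : 0 < F1 by rewrite /F1 lt_max divr_gt0.
exists F1; first by rewrite (ltW F10).
rewrite /hmean (gt_eqF F10); apply: dF; rewrite /ball/= gtr0_norm ?subr_gt0//.
have : F - d / 2 <= F1 by rewrite /F1 le_max lexx orbT.
lra.
Qed.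

(** First order expansion of the sup-convolution at a point where [F] is
positive: convexity of negative powers turns the variation of [F] into a linear
perturbation of [F^-k], and Young's inequality absorbs its dependence on the
displacement [y] into [V], whence a bound uniform in [y]. *)
Lemma hmean_expand (e k p p' s F F1 X y : R) : 0 < e -> 0 < k -> 1 < p ->
  p^-1 + p'^-1 = 1 -> 0 < s -> 0 < F -> 0 <= F1 -> 0 <= X -> 0 <= y ->
  F1 <= F + s * X * y ->
  0 < F `^ (- k) - s * ((p' - 1) * (k / p') `^ p * (F `^ (- k - 1) * X) `^ p - 1) ->
  hmean e k s (1 + y `^ p') F1 <=
  (F `^ (- k) - s * ((p' - 1) * (k / p') `^ p * (F `^ (- k - 1) * X) `^ p - 1)) `^ (- e).
Proof.
move=> e0 k0 p1 pp' s0 F0 F10 X0 y0 F1F L0.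
have V0 : 0 <= 1 + y `^ p' by rewrite addr_ge0// powR_ge0.
have Fs : 0 < F + s * X * y by rewrite ltr_pwDl// !mulr_ge0// ltW.
apply: (le_trans (hmean_le e0 k0 (ltW s0) V0 F10 F1F)).
rewrite /hmean (gt_eqF Fs); apply: ler_powRN => //; first exact: ltW.
have := powRN_tangent k0 F0 Fs.
have := @scaled_young _ p p' k (F `^ (- k - 1) * X) y p1 pp' k0 _ y0.
rewrite mulr_ge0 ?powR_ge0// => /(_ isT) /(ler_wpM2l (ltW s0)).
set A := F `^ (- k); set B := F `^ (- k - 1).
set Q := (p' - 1) * _ * _; set P := (F + _) `^ _; set Y := y `^ p'.
lra.
Qed.
End harmonic_mean.

(** * Weighted cones and sup-convolution *)

Lemma bbl_le (R : realType) (e : R) (a b c c' : \bar R) :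
  (c <= c')%E -> bbl e a b c -> bbl e a b c'.
Proof. by move=> cc abc l s l01 s0 sa sb; apply: lt_le_trans cc; exact: (abc l). Qed.

Lemma bbl0l (R : realType) (e : R) (b c : \bar R) : bbl e 0 b c.
Proof. by move=> l s l01 s0; rewrite mule0 lte_fin ltNge s0. Qed.

Lemma bbl0r (R : realType) (e : R) (a c : \bar R) : bbl e a 0 c.
Proof. by move=> l s l01 s0 _; rewrite mule0 lte_fin ltNge s0. Qed.

Lemma measurable_eball (R : realType) n (r : R) :
  measurable [set x : 'rV[R]_n | enorm x < r].
Proof.
rewrite -[X in measurable X]setTI.
rewrite (_ : [set x | _] = enorm @^-1` `]-oo, r[%classic).
  by apply: measurable_enorm => //; exact: measurable_itv.
by apply/seteqP; split => x /=; rewrite in_itv.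
Qed.

Lemma eball_finite (R : realType) n (r : R) :
  (lebesgue_rV n [set x : 'rV[R]_n | (enorm x < r)%R] < +oo)%E.
Proof.
pose B := [set x : 'rV[R]_n | forall i, (`[- r, r]%classic : set (measurableTypeR R)) (x ord0 i)].
apply: (@le_lt_trans _ _ (lebesgue_rV n B)).
  apply: le_measure; rewrite ?inE.
  - exact: measurable_eball.
  - rewrite (_ : B = \bigcap_(i in [set: 'I_n])
     ((fun z : 'rV[R]_n => z ord0 i : measurableTypeR R) @^-1` `[- r, r]%classic)).
      apply: fin_bigcap_measurable => // i _.
      by rewrite -[X in measurable X]setTI; apply: measurable_coor.
    by apply/seteqP; split => y h i; [move=> _; exact: h|exact: h].
  - move=> x /= xr i; change (is_true (x ord0 i \in `[- r, r])).
    rewrite in_itv/= -ler_norml.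
    by apply: (le_trans (coord_le_enorm x i)); exact: ltW.
rewrite /B (@lebesgue_rV_box _ n (fun=> (`[(- r)%R, r]%classic : set R)))//.
pose I : set R := `[- r, r]%classic.
suff /andP[] : (0 <= \prod_(i < n) lebesgue_measure I < +oo)%E by [].
elim/big_ind : _ => [|x y /andP[x0 xf] /andP[y0 yf]|i _].
- by rewrite lee_fin ler01 ltry.
- by rewrite mule_ge0//= lte_mul_pinfty// ge0_fin_numE.
- rewrite measure_ge0/= lebesgue_measure_itv/=; case: ifP => _; last exact: ltry.
  by rewrite -EFinB ltry.
Qed.

(** An open convex cone with a weight on it.  The last field is what remains of
the concavity of $w^{1/g}$: multiplying by [w] lowers the exponent of the
Borell-Brascamp-Lieb hypothesis by the degree [g]. *)
Record cone_weight (R : realType) n (W : set 'rV[R]_n) (w : 'rV[R]_n -> R) (g : R)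
    : Prop := ConeWeight {
  cw_degree : 0 <= g;
  cw_open : open W;
  cw_add : forall x y, W x -> W y -> W (x + y);
  cw_scale : forall c x, 0 < c -> W x -> W (c *: x);
  cw_ge0 : forall x, 0 <= w x;
  cw_gt0 : forall x, W x -> 0 < w x;
  cw_hom : forall c x, 0 < c -> w (c *: x) = c `^ g * w x;
  cw_meas : measurable_fun setT w;
  cw_bound : forall r, exists M, forall x, enorm x <= r -> w x <= M;
  cw_bbl : forall e a b h x y, g <= e -> W x -> W y -> bbl e a b h ->
    bbl (e - g) (a * (w x)%:E) (b * (w y)%:E) (h * (w (x + y))%:E)
}.

(** The conditions on the modulus [F] of a test function and the modulus [G] of
its gradient that the sup-convolution argument uses. *)
Record profile (R : realType) n (W : set 'rV[R]_n) (F G : 'rV[R]_n -> R)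
    (rho M L : R) : Prop := Profile {
  pf_ge0 : forall x, 0 <= F x;
  pf_cont : forall x, W x -> {for x, continuous F};
  pf_supp : forall x, W x -> rho < enorm x -> F x = 0;
  pf_bound : forall x, W x -> F x <= M;
  pf_lip : forall x y, W x -> W y -> F x <= F y + L * enorm (x - y);
  pf_gge0 : forall x, 0 <= G x;
  pf_gmeas : measurable_fun W G;
  pf_gsupp : forall x, W x -> rho < enorm x -> G x = 0;
  pf_gbound : forall x, W x -> G x <= L;
  pf_slope : forall z eps, W z -> 0 < eps -> exists2 d, 0 < d &
    forall x, W x -> enorm (x - z) < d -> F x <= F z + (G z + eps) * enorm (x - z)
}.

Section sup_convolution.
Context {R : realType} {n : nat} (W : set 'rV[R]_n) (w : 'rV[R]_n -> R) (g : R).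
Context (cw : cone_weight W w g).
Context (F G : 'rV[R]_n -> R) (rho M L : R) (pf : profile W F G rho M L).
Context (e k p' T : R) (e0 : 0 < e) (k0 : 0 < k) (T0 : 0 < T).

Definition supconv_values (s : R) (z : 'rV[R]_n) : set R := [set 0] `|`
  [set hmean e k s (1 + enorm y `^ p') (F (z - s *: y)) | y in
    [set y | [/\ W y, enorm y < T & W (z - s *: y)]]].

(** The sup-convolution, at [z], of $F^{ke}$ and of the dilate
$s^{-e} V(y/s)$ of $V(y) = (1+|y|^{p'})^{-e}$ restricted to the ball of radius
[T], where the supremum is over decompositions of [z] inside the cone.  The
radius keeps the displacements bounded. *)
Definition supconv s z : R := sup (supconv_values s z).

Let V0 (y : 'rV[R]_n) : 0 <= 1 + enorm y `^ p'.
Proof. by rewrite addr_ge0// powR_ge0. Qed.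

Lemma supconv_values_neq0 s z : supconv_values s z !=set0.
Proof. by exists 0; left. Qed.

Lemma supconv_values_ub s z (c : R) : 0 <= s -> 0 <= c ->
  (forall y, W y -> enorm y < T -> W (z - s *: y) -> F (z - s *: y) <= c) ->
  ubound (supconv_values s z) (c `^ (k * e)).
Proof.
move=> s0 c0 H _ [->|[y [Wy yT Wzy] <-]]; first exact: powR_ge0.
apply: (le_trans (hmean_le_pow _ e0 s0 (V0 y) (pf_ge0 pf _))).
apply: ge0_ler_powR; rewrite ?nnegrE ?(pf_ge0 pf)//; last exact: H.
by rewrite mulr_ge0// ltW.
Qed.

Lemma supconv_values_has_sup s z : 0 <= s -> has_sup (supconv_values s z).
Proof.
move=> s0; split; first exact: supconv_values_neq0.
exists (Num.max M 0 `^ (k * e)); apply: supconv_values_ub => //.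
  by rewrite le_max lexx orbT.
by move=> y _ _ Wzy; rewrite le_max (pf_bound pf).
Qed.

Lemma supconv_ge0 s z : 0 <= s -> 0 <= supconv s z.
Proof.
move=> s0; apply: ub_le_sup; last by left.
by have [] := supconv_values_has_sup z s0.
Qed.

Lemma supconv_le s z (c : R) : 0 <= s -> 0 <= c ->
  (forall y, W y -> enorm y < T -> W (z - s *: y) -> F (z - s *: y) <= c) ->
  supconv s z <= c `^ (k * e).
Proof.
move=> s0 c0 H; apply: ge_sup; first exact: supconv_values_neq0.
exact: supconv_values_ub.
Qed.

Lemma hmean_le_supconv s x y : 0 < s -> W x -> W y -> enorm y < T ->
  hmean e k s (1 + enorm y `^ p') (F x) <= supconv s (x + s *: y).
Proof.
move=> s0 Wx Wy yT; apply: ub_le_sup.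
  by have [] := supconv_values_has_sup (x + s *: y) (ltW s0).
by right; exists y; [split|]; rewrite ?addrK.
Qed.

Lemma measurable_supconv s : 0 < s -> measurable_fun W (supconv s).
Proof.
move=> s0; have mW := open_rV_measurable (cw_open cw).
apply: measurable_fun_open_preimage => // r.
have [r0|r0] := ltP r 0.
  rewrite (_ : _ `&` _ = W)//; apply/seteqP; split => [x []//|x Wx]; split => //=.
  by apply: lt_le_trans r0 _; exact: supconv_ge0 (ltW s0).
apply: open_rV_measurable; rewrite openE => z [Wz /=].
move=> /(sup_gt (supconv_values_neq0 _ _))[_ [->|[y [Wy yT Wzy] <-]]].
  by rewrite ltNge r0.
move=> /(hmean_lsc e0 k0 (ltW s0) (V0 y) (pf_ge0 pf _) r0)[F1 /andP[F10 F1F] rF1].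
rewrite /interior; apply: filterI; first exact: open_nbhs_nbhs (conj (cw_open cw) Wz).
have cz : {for z, continuous (fun x : 'rV[R]_n => x - s *: y)}.
  by apply: continuousB; [exact: id|exact: cst_continuous].
have n1 : nbhs z [set x | W (x - s *: y)].
  by apply: cz; apply: open_nbhs_nbhs; split => //; exact: (cw_open cw).
have n2 : nbhs z [set x | F1 < F (x - s *: y)].
  have := continuous_comp cz (pf_cont pf Wzy).
  move=> /(_ [set u | F1 < u]); apply.
  by apply: open_nbhs_nbhs; split => //; exact: open_gt.
apply: filterS (filterI n1 n2) => x [/= Wx F1x].
apply: (lt_le_trans rF1); apply: (@le_trans _ _ (hmean e k s (1 + enorm y `^ p') (F (x - s *: y)))).
  by apply: hmean_le => //; exact: ltW.
by have := hmean_le_supconv s0 Wx Wy yT; rewrite subrK.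
Qed.

Lemma supconv_le_lip s z : 0 <= s -> W z -> supconv s z <= (F z + s * (T * L)) `^ (k * e).
Proof.
move=> s0 Wz.
have L0 : 0 <= L by exact: le_trans (pf_gge0 pf z) (pf_gbound pf Wz).
apply: supconv_le => //.
  by rewrite addr_ge0 ?(pf_ge0 pf)// !mulr_ge0// ltW.
move=> y Wy yT Wzy; apply: (le_trans (pf_lip pf Wzy Wz)).
rewrite lerD2l addrAC subrr add0r enormN enormZ ger0_norm//.
rewrite mulrCA ler_wpM2l// mulrC ler_wpM2r//; exact: ltW.
Qed.

Lemma supconv_out s z : 0 <= s <= 1 -> rho + T < enorm z -> supconv s z = 0.
Proof.
move=> /andP[s0 s1] zr; apply/eqP; rewrite eq_le supconv_ge0// andbT.
have ke0 : 0 < k * e by exact: mulr_gt0.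
rewrite -[leRHS](powR0 (lt0r_neq0 ke0)); apply: supconv_le => // y Wy yT Wzy.
rewrite (pf_supp pf Wzy)//.
have : enorm z <= enorm (z - s *: y) + enorm (s *: y).
  by rewrite -{1}(subrK (s *: y) z) enormD.
rewrite enormZ ger0_norm//.
have : s * enorm y <= T.
  by apply: (@le_trans _ _ (enorm y)); rewrite ?(ltW yT)// ler_piMl// enorm_ge0.
lra.
Qed.
End sup_convolution.

(** * First order behaviour of the sup-convolution *)

Section asymptotics.
Context {R : realType} {n : nat} (W : set 'rV[R]_n).
Context (F G : 'rV[R]_n -> R) (rho M L : R) (pf : profile W F G rho M L).
Context (e k p p' T : R) (e0 : 0 < e) (k0 : 0 < k) (T0 : 0 < T).
Context (p1 : 1 < p) (pp' : p^-1 + p'^-1 = 1) (kE : (k + 1) * p = k * (e + 1)).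

Let K := e * ((p' - 1) * (k / p') `^ p).

Lemma conjugate_gt1 : 1 < p'.
Proof.
have p0 : 0 < p by exact: lt_trans p1.
have i1 : 0 < p^-1 by rewrite invr_gt0.
have i2 : p^-1 < 1 by rewrite invf_lt1.
have ip' : 0 < p'^-1 by rewrite -(addKr p^-1 p'^-1) pp' addrC subr_gt0.
have p'0 : 0 < p' by rewrite -invr_gt0.
by rewrite -invf_lt1// -pp' ltrDr.
Qed.

Lemma ke_gt1 : 1 < k * e.
Proof.
have -> : k * e = k * (p - 1) + p by move: kE; lra.
by apply: ltr_wpDl => //; apply: mulr_ge0; [exact: ltW|rewrite subr_ge0 ltW].
Qed.

Lemma K_ge0 : 0 <= K.
Proof.
rewrite /K mulr_ge0 ?(ltW e0)// mulr_ge0 ?powR_ge0// subr_ge0.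
exact: ltW conjugate_gt1.
Qed.

(** Where [F] is positive, [hmean_expand] bounds all competitors by
$(F^{-k} - s\Lambda)^{-e}$, whose derivative at [s = 0] is the stated one, with
[pf_slope] as the control on [F].  Where [F] vanishes, the Lipschitz bound makes the
sup-convolution of order $s^{ke}$, and $ke > 1$. *)
Lemma supconv_slope z eta : W z -> 0 < eta -> exists2 s0, 0 < s0 &
  forall s, 0 < s < s0 -> supconv W F e k p' T s z <=
    F z `^ (k * e) + s * (K * G z `^ p - e * F z `^ (k * (e + 1)) + eta).
Proof.
move=> Wz eta0.
have L0 : 0 <= L by exact: le_trans (pf_gge0 pf z) (pf_gbound pf Wz).
have G0 := pf_gge0 pf z.
have := pf_ge0 pf z; rewrite le_eqVlt => /orP[/eqP Fz0|Fz].
  have ke1 : 0 < k * e - 1 by rewrite subr_gt0 ke_gt1.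
  have ke0 : 0 < k * e by exact: mulr_gt0.
  have ke10 : 0 < k * (e + 1) by rewrite mulr_gt0// addr_gt0.
  pose C := (T * L) `^ (k * e) + 1.
  have C0 : 0 < C by rewrite ltr_wpDl// powR_ge0.
  exists ((eta / C) `^ (k * e - 1)^-1); first by rewrite powR_gt0// divr_gt0.
  move=> s /andP[s0 ss].
  apply: (le_trans (supconv_le_lip pf p' e0 k0 T0 (ltW s0) Wz)).
  rewrite -Fz0 add0r !powR0 ?gt_eqF// mulr0 subr0 add0r.
  rewrite powRM ?(ltW s0) ?mulr_ge0// ?(ltW T0)//.
  have -> : s `^ (k * e) = s * s `^ (k * e - 1).
    by rewrite mulr_powRB1// ltW.
  have sC : s `^ (k * e - 1) <= eta / C.
    have -> : eta / C = ((eta / C) `^ (k * e - 1)^-1) `^ (k * e - 1).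
      by rewrite -powRrM mulVf ?gt_eqF// powRr1// divr_ge0// ltW.
    by apply: ge0_ler_powR; rewrite ?nnegrE ?powR_ge0// ltW.
  rewrite -mulrA ler_pM2l//.
  apply: (@le_trans _ _ (eta / C * C)).
    apply: ler_pM => //; rewrite ?powR_ge0//.
    by rewrite /C lerDl.
  by rewrite divfK ?gt_eqF// lerDr mulr_ge0 ?K_ge0// powR_ge0.
set U := F z `^ (- k).
have U0 : 0 < U by exact: powR_gt0.
have [eps /andP[eps0 eps1] epsP] : exists2 eps, 0 < eps <= 1 &
    K * (G z + eps) `^ p <= K * G z `^ p + eta / 2.
  pose C := K * (p * (G z + 1) `^ (p - 1)) + 1.
  have p0 : 0 < p by exact: lt_trans p1.
  have C0 : 0 < C.
    by rewrite ltr_wpDl// mulr_ge0 ?K_ge0// mulr_ge0 ?powR_ge0// ltW.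
  exists (Num.min 1 (eta / 2 / C)).
    by rewrite lt_min ltr01 !divr_gt0//= ge_min lexx.
  set eps := Num.min _ _.
  have eps0 : 0 < eps by rewrite lt_min ltr01 !divr_gt0.
  have eps1 : eps <= 1 by rewrite ge_min lexx.
  have := @powR_tangent R (G z + eps) (G z) p (ltW p1) (addr_ge0 G0 (ltW eps0)) G0.
  have pE : (G z + eps) `^ p = (G z + eps) * (G z + eps) `^ (p - 1).
    by rewrite mulr_powRB1// addr_ge0// ltW.
  have mono : (G z + eps) `^ (p - 1) <= (G z + 1) `^ (p - 1).
    have p10 : 0 <= p - 1 by rewrite subr_ge0 ltW.
    apply: (ge0_ler_powR p10); rewrite ?nnegrE ?lerD2l//; apply: addr_ge0 => //.
    exact: ltW.
  have epsC : eps * C <= eta / 2.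
    by rewrite -ler_pdivlMr// ge_min lexx orbT.
  move=> tan.
  have h1 : (G z + eps) `^ p <= G z `^ p + p * (G z + eps) `^ (p - 1) * eps.
    move: tan; rewrite pE; set Y := (G z + eps) `^ (p - 1); lra.
  apply: (le_trans (ler_wpM2l K_ge0 h1)).
  rewrite mulrDr lerD2l; apply: le_trans epsC; rewrite /C.
  have h2 : K * (p * (G z + eps) `^ (p - 1) * eps) <=
      K * (p * (G z + 1) `^ (p - 1) * eps).
    apply: ler_wpM2l; first exact: K_ge0.
    by rewrite ler_pM2r// ler_pM2l.
  apply: (le_trans h2); rewrite mulrDr mulr1 -subr_ge0.
  set Y := (G z + 1) `^ (p - 1).
  by rewrite (_ : _ - _ = eps) ?(ltW eps0)//; ring.
have [d d0 dP] := pf_slope pf Wz eps0.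
set X := G z + eps in epsP dP.
have X0 : 0 <= X by rewrite addr_ge0// ltW.
pose Q := (p' - 1) * (k / p') `^ p * (F z `^ (- k - 1) * X) `^ p.
pose lam := Q - 1.
have c1 : {for 0, continuous (fun s : R => U - s * lam)}.
  by apply: continuousB; [exact: cst_continuous|apply: continuousM => //; exact: cst_continuous].
have U00 : 0 < U - 0 * lam by rewrite mul0r subr0.
have c2 : {for 0, continuous (fun s : R => (e * lam) * (U - s * lam) `^ (- e - 1))}.
  apply: continuousM; first exact: cst_continuous.
  apply: (@continuous_comp _ _ _ (fun s : R => U - s * lam) (fun u => u `^ (- e - 1)) 0) => //.
  exact: powR_continuous_at.
have n1 : \forall s \near (0 : R), 0 < U - s * lam.
  move: c1 => /(_ [set u | 0 < u]); apply.
  by apply: open_nbhs_nbhs; split => //; exact: open_gt.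
have n2 : \forall s \near (0 : R), (e * lam) * (U - s * lam) `^ (- e - 1) <
    (e * lam) * U `^ (- e - 1) + eta / 2.
  move: c2 => /(_ [set u | u < (e * lam) * U `^ (- e - 1) + eta / 2]); apply.
  apply: open_nbhs_nbhs; split; first exact: open_lt.
  by rewrite /= mul0r subr0 ltrDl divr_gt0.
have n3 : nbhs (0 : R) [set s | 0 < U - s * lam /\
    (e * lam) * (U - s * lam) `^ (- e - 1) < (e * lam) * U `^ (- e - 1) + eta / 2].
  exact: filterI n1 n2.
have /nbhs_ballP[s0 /= s00 sP] := n3.
exists (Num.min s0 (d / T)); first by rewrite lt_min s00 divr_gt0.
move=> s /andP[s_gt0]; rewrite lt_min => /andP[ss0 sd].
have [/= s1 s2] : 0 < U - s * lam /\ (e * lam) * (U - s * lam) `^ (- e - 1) <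
    (e * lam) * U `^ (- e - 1) + eta / 2.
  by apply: sP; rewrite /ball/= sub0r normrN gtr0_norm.
have step1 : supconv W F e k p' T s z <= (U - s * lam) `^ (- e).
  apply: ge_sup; first exact: supconv_values_neq0.
  move=> _ [->|[y [Wy yT Wzy] <-]]; first exact: powR_ge0.
  apply: hmean_expand => //; [exact: (pf_ge0 pf)|exact: enorm_ge0|].
  have zs : enorm (z - s *: y - z) = s * enorm y.
    by rewrite addrAC subrr add0r enormN enormZ gtr0_norm.
  have := dP _ Wzy; rewrite zs mulrCA mulrA; apply.
  apply: (@lt_trans _ _ (s * T)); first by rewrite ltr_pM2l.
  by rewrite -ltr_pdivlMr.
apply: (le_trans step1).
have := powRN_tangent e0 s1 U0.
rewrite (_ : U - (U - s * lam) = s * lam); last by ring.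
have UE : U `^ (- e) = F z `^ (k * e) by rewrite -powRrM mulrNN.
have UE1 : U `^ (- e - 1) = F z `^ (k * (e + 1)).
  by rewrite -powRrM; congr (_ `^ _); ring.
have FF : F z `^ (k * (e + 1)) * (F z `^ (- k - 1)) `^ p = 1.
  rewrite -powRrM -powRD; last by rewrite (gt_eqF Fz) implybT.
  by rewrite (_ : _ + _ = 0) ?powRr0//; rewrite -kE; ring.
have lamE : (e * lam) * U `^ (- e - 1) = K * X `^ p - e * F z `^ (k * (e + 1)).
  rewrite UE1 /lam /Q /K (powRM _ (powR_ge0 _ _) X0).
  transitivity (e * ((p' - 1) * (k / p') `^ p) * X `^ p *
     (F z `^ (k * (e + 1)) * (F z `^ (- k - 1)) `^ p) - e * F z `^ (k * (e + 1))); first ring.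
  by rewrite FF mulr1.
rewrite UE => tan.
have {}s2 : s * ((e * lam) * (U - s * lam) `^ (- e - 1)) <= s * (K * G z `^ p
    - e * F z `^ (k * (e + 1)) + eta).
  rewrite ler_pM2l//; apply: (le_trans (ltW s2)); rewrite lamE.
  rewrite [leLHS]addrAC [leRHS]addrAC lerD2r.
  have -> : K * G z `^ p + eta = K * G z `^ p + eta / 2 + eta / 2 by rewrite -addrA -splitr.
  by rewrite lerD2r.
move: tan s2; set A := (U - _) `^ (- e); set B := (U - _) `^ _; set Y := F z `^ _ .
set Z := s * (_ + eta); move=> h1 h2.
have : e * B * (s * lam) <= Z by apply: le_trans h2; rewrite le_eqVlt; apply/orP; left; apply/eqP; ring.
by move: h1; rewrite lerBlDr => h1 h3; apply: (le_trans h1); rewrite lerD2l.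
Qed.

(** The bound does not depend on [s], as dominated convergence requires. *)
Lemma supconv_quotient_bound s z : 0 < s <= 1 -> W z ->
  supconv W F e k p' T s z - F z `^ (k * e) <=
  s * (k * e * (T * L) * (M + T * L) `^ (k * e - 1)).
Proof.
move=> /andP[s0 s1] Wz.
have L0 : 0 <= L by exact: le_trans (pf_gge0 pf z) (pf_gbound pf Wz).
have F0 := pf_ge0 pf z.
have TL0 : 0 <= T * L by rewrite mulr_ge0// ltW.
have ke1 := ke_gt1.
have ke0 : 0 < k * e by exact: mulr_gt0.
have Fs : 0 <= F z + s * (T * L) by rewrite addr_ge0// mulr_ge0// ltW.
have := supconv_le_lip pf p' e0 k0 T0 (ltW s0) Wz.
have := powR_tangent (ltW ke1) Fs F0.
have E : (F z + s * (T * L)) `^ (k * e) =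
    (F z + s * (T * L)) * (F z + s * (T * L)) `^ (k * e - 1) by rewrite mulr_powRB1.
rewrite E.
have mono : (F z + s * (T * L)) `^ (k * e - 1) <= (M + T * L) `^ (k * e - 1).
  apply: ge0_ler_powR => //; rewrite ?nnegrE ?subr_ge0 ?(ltW ke1)//.
    by rewrite addr_ge0// (le_trans F0)// (pf_bound pf).
  by rewrite lerD ?(pf_bound pf)// ler_piMl.
have m2 : k * e * (s * (T * L)) * (F z + s * (T * L)) `^ (k * e - 1) <=
    k * e * (s * (T * L)) * (M + T * L) `^ (k * e - 1).
  by apply: ler_wpM2l => //; rewrite !mulr_ge0// ltW.
move: m2 {mono E}; set A := (F z + _) `^ _; set B := (M + _) `^ _; set H := supconv _ _ _ _ _ _ _ _.
set Y := F z `^ _; lra.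
Qed.
End asymptotics.

(** * The Sobolev inequality for profiles with normalised slices *)

Section weighted_integral.
Context {R : realType} {n : nat} (W : set 'rV[R]_n) (w : 'rV[R]_n -> R) (g : R).
Context (cw : cone_weight W w g).
Implicit Types (phi psi : 'rV[R]_n -> R) (c B r : R).

Definition wint (phi : 'rV[R]_n -> R) : \bar R :=
  (\int[lebesgue_rV n]_(x in W) (phi x * w x)%:E)%E.

Lemma cone_measurable : measurable W.
Proof. exact: open_rV_measurable (cw_open cw). Qed.

Lemma measurable_wint phi : measurable_fun W phi ->
  measurable_fun W (fun x => (phi x * w x)%:E).
Proof.
move=> mphi; apply/measurable_EFinP; apply: measurable_funM => //.
exact: measurable_funTS (cw_meas cw).
Qed.

Lemma wint_ge0 phi : (forall x, W x -> 0 <= phi x) -> (0 <= wint phi)%E.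
Proof.
move=> phi0; apply: integral_ge0 => x Wx.
by rewrite lee_fin mulr_ge0 ?phi0// (cw_ge0 cw).
Qed.

Lemma le_wint phi psi : measurable_fun W phi -> measurable_fun W psi ->
  (forall x, W x -> 0 <= phi x <= psi x) -> (wint phi <= wint psi)%E.
Proof.
move=> mphi mpsi H; apply: ge0_le_integral.
- exact: cone_measurable.
- by move=> x /H/andP[? _]; rewrite lee_fin mulr_ge0// (cw_ge0 cw).
- exact: measurable_wint.
- exact: measurable_wint.
- by move=> x /H/andP[_ ?]; rewrite lee_fin ler_wpM2r// (cw_ge0 cw).
Qed.

Lemma eq_wint phi psi : (forall x, W x -> phi x = psi x) -> wint phi = wint psi.
Proof. by move=> H; apply: eq_integral => x; rewrite inE => /H ->. Qed.

Lemma wintZ c phi : measurable_fun W phi -> 0 <= c -> (forall x, W x -> 0 <= phi x) ->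
  wint (fun x => c * phi x) = (c%:E * wint phi)%E.
Proof.
move=> mphi c0 phi0; rewrite /wint -ge0_integralZl_EFin//.
- by apply: eq_integral => x _; rewrite -EFinM mulrA.
- exact: cone_measurable.
- by move=> x Wx; rewrite lee_fin mulr_ge0 ?phi0// (cw_ge0 cw).
- exact: measurable_wint.
Qed.

Lemma wintD phi psi : measurable_fun W phi -> measurable_fun W psi ->
  (forall x, W x -> 0 <= phi x) -> (forall x, W x -> 0 <= psi x) ->
  wint (fun x => phi x + psi x) = (wint phi + wint psi)%E.
Proof.
move=> mphi mpsi phi0 psi0; rewrite /wint -ge0_integralD//.
- by apply: eq_integral => x _; rewrite -EFinD mulrDl.
- exact: cone_measurable.
- by move=> x Wx; rewrite lee_fin mulr_ge0 ?phi0// (cw_ge0 cw).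
- exact: measurable_wint.
- by move=> x Wx; rewrite lee_fin mulr_ge0 ?psi0// (cw_ge0 cw).
- exact: measurable_wint.
Qed.

Lemma wint_lty phi B r : measurable_fun W phi ->
  (forall x, W x -> 0 <= phi x <= B) ->
  (forall x, W x -> r < enorm x -> phi x = 0) -> (wint phi < +oo)%E.
Proof.
move=> mphi phiB supp.
pose ball := [set x : 'rV[R]_n | enorm x < r + 1].
have mb : measurable ball by exact: measurable_eball.
have mW := cone_measurable.
have [C wC] := cw_bound cw (r + 1).
have -> : wint phi = (\int[lebesgue_rV n]_(x in W `&` ball) (phi x * w x)%:E)%E.
  rewrite integral_mkcondr; apply: eq_integral => x; rewrite inE => Wx.
  rewrite patchE; case: ifPn => //; rewrite notin_setE /ball/= => /negP; rewrite -leNgt => h.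
  by rewrite supp ?mul0r//; apply: lt_le_trans h; rewrite ltrDl.
apply: (@le_lt_trans _ _ (\int[lebesgue_rV n]_(x in W `&` ball) (cst (Num.max 0 B * Num.max 0 C)%:E) x)%E).
  apply: ge0_le_integral.
  - exact: measurableI.
  - by move=> x [/phiB/andP[? _] _]; rewrite lee_fin mulr_ge0// (cw_ge0 cw).
  - by apply: measurable_funS (measurable_wint mphi) => // x [].
  - exact: measurable_cst.
  - move=> x [Wx /ltW/wC wx]; have /andP[? ?] := phiB _ Wx.
    by rewrite lee_fin ler_pM ?(cw_ge0 cw)// le_max ?wx ?orbT//; apply/orP; right.
rewrite integral_cst; last exact: measurableI.
rewrite lte_mul_pinfty// ?lee_fin ?mulr_ge0 ?le_max ?lexx//.
apply: (@le_lt_trans _ _ (lebesgue_rV n ball)); last exact: eball_finite.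
by apply: le_measure; rewrite ?inE//; exact: measurableI.
Qed.

Lemma wint_dominated (phi : nat -> 'rV[R]_n -> R) (psi dom : 'rV[R]_n -> R) :
  (forall m, measurable_fun W (phi m)) -> measurable_fun W psi -> measurable_fun W dom ->
  (wint dom < +oo)%E ->
  (forall m x, W x -> 0 <= phi m x <= dom x) ->
  (forall x, W x -> phi m x @[m --> \oo] --> psi x) ->
  (wint (phi m) @[m --> \oo] --> wint psi)%E.
Proof.
move=> mphi mpsi mdom dfin dom_phi cvg_phi.
have := @dominated_convergence _ _ _ (lebesgue_rV n) W cone_measurable
  (fun m x => (phi m x * w x)%:E) (fun x => (psi x * w x)%:E) (fun x => (dom x * w x)%:E).
case.
- by move=> m; exact: measurable_wint.
- exact: measurable_wint.
- apply: aeW => x Wx; apply: cvg_EFin; first exact: nearW.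
  by apply: cvgM; [exact: cvg_phi|exact: cvg_cst].
- apply/integrableP; split; first exact: measurable_wint.
  apply: le_lt_trans dfin; rewrite le_eqVlt; apply/orP; left; apply/eqP.
  apply: eq_integral => x; rewrite inE => Wx; rewrite gee0_abs//.
  have /andP[h1 h2] := dom_phi 0%N _ Wx.
  by rewrite lee_fin mulr_ge0 ?(le_trans h1 h2)// (cw_ge0 cw).
- apply: aeW => x m Wx; have /andP[h1 h2] := dom_phi m _ Wx.
  rewrite gee0_abs ?lee_fin ?mulr_ge0 ?(cw_ge0 cw)//.
  by rewrite ler_wpM2r// (cw_ge0 cw).
- by [].
Qed.
End weighted_integral.
Arguments wint {R n}.

Section normalized_sobolev.
Context {R : realType} {n : nat} (W : set 'rV[R]_n.+1) (w : 'rV[R]_n.+1 -> R) (g : R).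
Context (cw : cone_weight W w g).
Context (F G : 'rV[R]_n.+1 -> R) (rho M L : R) (pf : profile W F G rho M L).
Context (k p p' T : R) (k0 : 0 < k) (T0 : 0 < T).
Let e := n%:R + g.
Context (e0 : 0 < e).
Context (p1 : 1 < p) (pp' : p^-1 + p'^-1 = 1) (kE : (k + 1) * p = k * (e + 1)).

Let K := e * ((p' - 1) * (k / p') `^ p).

Local Notation Fpow r := (fun x => (F x `^ r)%R).
Local Notation Gpow r := (fun x => (G x `^ r)%R).
Implicit Types (phi : 'rV[R]_n.+1 -> R) (s : R).

Definition model (y : 'rV[R]_n.+1) : R := (1 + enorm y `^ p') `^ (- e).

Definition truncated_model (y : 'rV[R]_n.+1) : R := if enorm y < T then model y else 0.

Definition cone_mass (phi : 'rV[R]_n.+1 -> R) : 'rV[R]_n.+1 -> \bar R :=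
  (fun x => (phi x * w x)%:E) \_ W.

Lemma measurable_cone_mass phi : measurable_fun W phi ->
  measurable_fun setT (cone_mass phi).
Proof.
move=> mphi; apply/(measurable_restrictT _ _).1; first exact: cone_measurable cw.
exact: measurable_wint cw _ mphi.
Qed.

Lemma cone_mass_ge0 phi : (forall x, W x -> 0 <= phi x) ->
  forall x, (0 <= cone_mass phi x)%E.
Proof.
move=> phi0 x; rewrite /cone_mass patchE; case: ifPn => //; rewrite inE => Wx.
by rewrite lee_fin mulr_ge0 ?phi0// (cw_ge0 cw).
Qed.

Lemma integral_cone_mass phi :
  (\int[lebesgue_rV n.+1]_x cone_mass phi x = wint W w phi)%E.
Proof. by rewrite /wint [RHS]integral_mkcond. Qed.

Lemma measurable_truncated_model : measurable_fun setT truncated_model.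
Proof.
apply: measurable_fun_if => //.
- exact: measurable_fun_ltr measurable_enorm _.
- apply: measurable_funTS; rewrite /model.
  apply: (measurableT_comp (measurable_powR _)).
  apply: measurable_funD => //.
  exact: (measurableT_comp (measurable_powR _) measurable_enorm).
Qed.

Lemma truncated_model_ge0 y : 0 <= truncated_model y.
Proof. by rewrite /truncated_model; case: ifP => // _; exact: powR_ge0. Qed.

Lemma measurable_profile : measurable_fun W F.
Proof.
by apply: continuous_rV_measurable (cw_open cw) _ => x; rewrite inE; exact: (pf_cont pf).
Qed.

(** The model dilated by [s] and multiplied by [s ^- e] has total mass [s] times
that of the model, because weight and volume scale with degree [n + 1 + g], while
its slices keep their masses; so the hypothesis does not involve [s]. *)
Lemma supconv_brunn_minkowski s : 0 < s ->
  slice_sup (cone_mass (Fpow (k * e))) = slice_sup (cone_mass truncated_model) ->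
  (wint W w (Fpow (k * e)) + s%:E * wint W w truncated_model <=
   wint W w (supconv W F e k p' T s))%E.
Proof.
move=> s0 FV.
have mF : measurable_fun W (Fpow (k * e)).
  exact: (measurableT_comp (measurable_powR _) measurable_profile).
have mV := measurable_funTS (D := W) measurable_truncated_model.
have mH := measurable_supconv cw pf p' T e0 k0 s0.
pose Vs y := ((s ^- n)%:E * cone_mass truncated_model (s^-1 *: y))%E.
have sn0 : 0 <= s ^- n by rewrite invr_ge0 exprn_ge0// ltW.
have mVs : measurable_fun setT Vs.
  apply: measurable_funeM; apply: (measurableT_comp (measurable_cone_mass mV)).
  have := @measurable_rV_affine R n.+1 s^-1 0; congr measurable_fun.
  by apply/funext => x; rewrite addr0.
have V0 := cone_mass_ge0 (fun x _ => truncated_model_ge0 x).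
have Vs0 y : (0 <= Vs y)%E by rewrite mule_ge0.
have F0 := cone_mass_ge0 (fun x (_ : W x) => powR_ge0 (F x) (k * e)).
have H0 := cone_mass_ge0 (fun x (_ : W x) => supconv_ge0 pf p' T e0 k0 x (ltW s0)).
have intVs : (\int[lebesgue_rV n.+1]_y Vs y = s%:E * wint W w truncated_model)%E.
  have sv0 : s^-1 != 0 by rewrite invr_eq0 gt_eqF.
  rewrite ge0_integralZl_EFin//; last first.
    apply: (measurableT_comp (measurable_cone_mass mV)).
    have := @measurable_rV_affine R n.+1 s^-1 0; congr measurable_fun.
    by apply/funext => x; rewrite addr0.
  rewrite -integral_cone_mass (integral_rV_affine 0 sv0 (measurable_cone_mass mV) V0).
  under [in RHS]eq_integral do rewrite addr0.
  rewrite muleA -EFinM; congr (_%:E * _)%E.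
  rewrite normfV gtr0_norm// exprVn exprS invfM mulrA mulfV ?gt_eqF// mul1r//.
rewrite -intVs -!integral_cone_mass.
apply: slice_brunn_minkowski => //.
- exact: measurable_cone_mass.
- exact: measurable_cone_mass.
- move=> x y; rewrite /Vs {1}/cone_mass patchE; case: ifPn => [|_]; last exact: bbl0l.
  rewrite inE => Wx.
  have [Ws|nWs] := pselect (W (s^-1 *: y)); last first.
    rewrite {1}/cone_mass patchE memNset// mule0; exact: bbl0r.
  have sy : s *: (s^-1 *: y) = y by rewrite scalerA mulfV ?gt_eqF// scale1r.
  have Wy : W y by rewrite -sy; exact: (cw_scale cw).
  have [yT|yT] := ltP (enorm (s^-1 *: y)) T; last first.
    rewrite {1}/cone_mass patchE mem_set//= /truncated_model ltNge yT/= mul0r mule0.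
    exact: bbl0r.
  rewrite {1}/cone_mass patchE mem_set// /truncated_model yT.
  rewrite /cone_mass patchE mem_set; last exact: (cw_add cw).
  have wy : w (s^-1 *: y) = s `^ (- g) * w y.
    have := cw_hom cw (s^-1 *: y) s0; rewrite sy => ->.
    rewrite mulrA -powRD; last by rewrite (gt_eqF s0) implybT.
    by rewrite addNr powRr0 mul1r.
  have -> : ((s ^- n)%:E * (model (s^-1 *: y) * w (s^-1 *: y))%:E =
      ((s `^ (- e)) * model (s^-1 *: y))%:E * (w y)%:E)%E.
    rewrite -!EFinM wy; congr (_%:E).
    rewrite -powR_invn ?(ltW s0)//.
    rewrite (_ : - e = - n%:R + - g); last by rewrite /e; ring.
    by rewrite powRD; [ring|rewrite (gt_eqF s0) implybT].
  rewrite !EFinM.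
  have -> : n%:R = e - g by rewrite /e; ring.
  apply: (cw_bbl cw) => //; first by rewrite /e lerDr.
  have := bbl_hmean (V := 1 + enorm (s^-1 *: y) `^ p') e0 s0 _ (pf_ge0 pf x) k0.
  have V1 : 0 < 1 + enorm (s^-1 *: y) `^ p' by rewrite ltr_wpDr// powR_ge0.
  move=> /(_ V1); rewrite /model EFinM; apply: bbl_le.
  rewrite lee_fin; have := hmean_le_supconv pf p' e0 k0 s0 Wx Ws yT.
  by rewrite sy.
- by rewrite FV [RHS](@slice_sup_dilate _ _ s)//; exact: measurable_cone_mass.
Qed.

(** The Sobolev inequality with a free parameter: the sup-convolution gains at
least the mass of the model at first order in [s], and [supconv_slope] bounds
that gain from above. *)
Theorem sobolev_normalized :
  slice_sup (cone_mass (Fpow (k * e))) = slice_sup (cone_mass truncated_model) ->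
  (wint W w truncated_model + e%:E * wint W w (Fpow (k * (e + 1))) <=
   K%:E * wint W w (Gpow p))%E.
Proof.
move=> FV.
have ke0 : 0 < k * e by exact: mulr_gt0.
have ke10 : 0 < k * (e + 1) by rewrite mulr_gt0// addr_gt0.
have K0 : 0 <= K by exact: K_ge0.
have p0 : 0 < p by exact: lt_trans p1.
have mFp r : measurable_fun W (Fpow r).
  exact: (measurableT_comp (measurable_powR _) measurable_profile).
have mGp : measurable_fun W (Gpow p).
  exact: (measurableT_comp (measurable_powR _) (pf_gmeas pf)).
pose s m : R := m.+1%:R^-1.
have s0 m : 0 < s m by rewrite invr_gt0.
have s1 m : s m <= 1 by rewrite invf_le1// ler1n.
pose phi z := K * G z `^ p - e * F z `^ (k * (e + 1)).
pose Q m z := (supconv W F e k p' T (s m) z - F z `^ (k * e)) / s m.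
pose E m z := Num.max 0 (Q m z - phi z).
have mH m := measurable_supconv cw pf p' T e0 k0 (s0 m).
have mphi : measurable_fun W phi.
  by apply: measurable_funB; apply: measurable_funM => //; exact: measurable_cst.
have mE m : measurable_fun W (E m).
  apply: measurable_maxr; first exact: measurable_cst.
  apply: measurable_funB => //; apply: measurable_funM; last exact: measurable_cst.
  exact: measurable_funB.
have E0 m z : 0 <= E m z by rewrite le_max lexx.
pose B := k * e * (T * L) * (M + T * L) `^ (k * e - 1) + e * M `^ (k * (e + 1)).
pose dom (z : 'rV[R]_n.+1) : R := if enorm z < rho + T + 1 then `|B| else 0.
have mdom : measurable_fun W dom.
  apply: measurable_funTS; apply: measurable_fun_if => //.
  exact: measurable_fun_ltr measurable_enorm _.
have E_dom m z : W z -> 0 <= E m z <= dom z.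
  move=> Wz; rewrite E0/= /dom; case: ifPn => [_|].
    rewrite /E ge_max normr_ge0/=; apply: le_trans (ler_norm _).
    have Qb : Q m z <= k * e * (T * L) * (M + T * L) `^ (k * e - 1).
      rewrite /Q ler_pdivrMr// [leRHS]mulrC.
      by apply: (supconv_quotient_bound pf p' e0 k0 T0 p1 kE) => //; rewrite s0 s1.
    have Fb : F z `^ (k * (e + 1)) <= M `^ (k * (e + 1)).
      apply: ge0_ler_powR; rewrite ?nnegrE ?(ltW ke10) ?(pf_ge0 pf) ?(pf_bound pf)//.
      by rewrite (le_trans (pf_ge0 pf z))// (pf_bound pf).
    have Gb : 0 <= K * G z `^ p by rewrite mulr_ge0// powR_ge0.
    rewrite /phi /B opprB addrA lerBlDr.
    rewrite -[leRHS]addrA; apply: lerD => //.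
    by rewrite -[leLHS]addr0; apply: lerD => //; rewrite ler_pM2l.
  rewrite -leNgt => zr.
  have zT : rho + T < enorm z by apply: lt_le_trans zr; rewrite ltrDl.
  have zrho : rho < enorm z by apply: lt_trans zT; rewrite ltrDl.
  rewrite /E /Q /phi (supconv_out pf p' e0 k0)// ?(ltW (s0 m)) ?s1//.
  rewrite (pf_supp pf Wz zrho) (pf_gsupp pf Wz zrho) !powR0 ?gt_eqF//.
  by rewrite !mulr0 !subr0 mul0r maxxx.
have dom_fin : (wint W w dom < +oo)%E.
  apply: (wint_lty cw (B := `|B|) (r := rho + T + 1) mdom).
    by move=> x _; rewrite /dom; case: ifP; rewrite ?lexx ?normr_ge0.
  by move=> x _ /ltW; rewrite leNgt /dom => /negbTE ->.
have E_cvg z : W z -> E m z @[m --> \oo] --> (0 : R).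
  move=> Wz; apply/cvgrPdist_le => eta eta0.
  have [r0 r00 r0P] := supconv_slope pf e0 k0 T0 p1 pp' kE Wz eta0.
  have sm0 : s m @[m --> \oo] --> (0 : R) by exact: cvg_harmonic.
  have : \forall m \near \oo, s m < r0.
    move: sm0 => /cvgrPdist_lt/(_ _ r00); apply: filterS => m.
    by rewrite sub0r normrN gtr0_norm.
  apply: filterS => m smr.
  rewrite sub0r normrN ger0_norm// /E ge_max (ltW eta0)/= /Q.
  have := r0P (s m); rewrite s0 smr => /(_ isT).
  rewrite -lerBlDl -ler_pdivrMl// mulrC => h.
  by rewrite lerBlDl.
have intE : (wint W w (E m) @[m --> \oo] --> 0)%E.
  have -> : 0%E = wint W w (cst 0).
    by rewrite /wint integral0_eq// => x _; rewrite mul0r.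
  apply: (wint_dominated cw mE _ mdom dom_fin E_dom E_cvg).
  exact: measurable_cst.
have main m : (wint W w truncated_model + e%:E * wint W w (Fpow (k * (e + 1))) <=
   K%:E * wint W w (Gpow p) + wint W w (E m))%E.
  have BM := supconv_brunn_minkowski (s0 m) FV.
  have mV := measurable_funTS (D := W) measurable_truncated_model.
  have F0 z r : 0 <= F z `^ r by exact: powR_ge0.
  have G0 z : 0 <= G z `^ p by exact: powR_ge0.
  have X : (wint W w (supconv W F e k p' T (s m)) +
      (s m)%:E * (e%:E * wint W w (Fpow (k * (e + 1)))) <=
      wint W w (Fpow (k * e)) +
      (s m)%:E * (K%:E * wint W w (Gpow p) + wint W w (E m)))%E.
    rewrite -(wintZ cw (mFp _) (ltW e0)); last by move=> x _.
    rewrite -(wintZ cw _ (ltW (s0 m))); last 2 first.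
    - by apply: measurable_funM => //; exact: measurable_cst.
    - by move=> x _; rewrite mulr_ge0// ltW.
    rewrite -(wintZ cw mGp K0); last by move=> x _.
    rewrite -(wintD cw _ (mE m)); last 3 first.
    - by apply: measurable_funM => //; exact: measurable_cst.
    - by move=> x _; rewrite mulr_ge0.
    - by move=> x _.
    rewrite -(wintZ cw _ (ltW (s0 m))); last 2 first.
    - by apply: measurable_funD => //; apply: measurable_funM => //; exact: measurable_cst.
    - by move=> x _; rewrite addr_ge0// mulr_ge0.
    rewrite -(wintD cw (mH m)); last 3 first.
    - by do 2 (apply: measurable_funM; first exact: measurable_cst).
    - by move=> x _; exact: (supconv_ge0 pf p' T e0 k0 x (ltW (s0 m))).
    - by move=> x _; rewrite mulr_ge0 ?(ltW (s0 m))// mulr_ge0// ltW.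
    rewrite -(wintD cw (mFp _)); last 3 first.
    - apply: measurable_funM; first exact: measurable_cst.
      by apply: measurable_funD => //; apply: measurable_funM => //; exact: measurable_cst.
    - by move=> x _.
    - by move=> x _; rewrite mulr_ge0 ?(ltW (s0 m))// addr_ge0// mulr_ge0.
    apply: (le_wint cw).
    - apply: measurable_funD => //.
      by do 2 (apply: measurable_funM; first exact: measurable_cst).
    - apply: measurable_funD => //; apply: measurable_funM; first exact: measurable_cst.
      by apply: measurable_funD => //; apply: measurable_funM => //; exact: measurable_cst.
    move=> z Wz; apply/andP; split.
      rewrite addr_ge0// ?(supconv_ge0 pf p' T e0 k0 z (ltW (s0 m)))//.
      by rewrite mulr_ge0 ?(ltW (s0 m))// mulr_ge0// ltW.
    have : Q m z - phi z <= E m z by rewrite /E le_max lexx orbT.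
    rewrite lerBlDr /Q ler_pdivrMr// /phi.
    set H := supconv _ _ _ _ _ _ _ _; set Y := F z `^ (k * e).
    set A := F z `^ _; set C := G z `^ p; set Em := E m z; set sm := s m.
    rewrite lerBlDr => h; rewrite -lerBrDr; apply: (le_trans h).
    by rewrite le_eqVlt; apply/orP; left; apply/eqP; ring.
  have Yfin : wint W w (Fpow (k * e)) \is a fin_num.
    rewrite ge0_fin_numE; last by apply: (wint_ge0 cw) => x _; exact: powR_ge0.
    apply: (wint_lty cw (B := M `^ (k * e)) (r := rho) (mFp _)).
      move=> x Wx; rewrite powR_ge0/=; apply: ge0_ler_powR; rewrite ?nnegrE ?(ltW ke0)//.
      - exact: (pf_ge0 pf).
      - by rewrite (le_trans (pf_ge0 pf x))// (pf_bound pf).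
      - exact: (pf_bound pf).
    by move=> x Wx xr; rewrite (pf_supp pf Wx xr) powR0// gt_eqF.
  have I0 : (0 <= wint W w truncated_model)%E.
    by apply: (wint_ge0 cw) => x _; exact: truncated_model_ge0.
  have Q0 : (0 <= e%:E * wint W w (Fpow (k * (e + 1))))%E.
    rewrite mule_ge0 ?lee_fin ?(ltW e0)//.
    by apply: (wint_ge0 cw) => x _; exact: powR_ge0.
  have := le_trans (leeD2r _ BM) X.
  by rewrite -addeA leeD2lE// -ge0_muleDr// lee_pmul2l ?lte_fin.
rewrite -[X in (_ <= X)%E]adde0.
have [KPfin|KPinf] := boolP ((K%:E * wint W w (Gpow p))%E \is a fin_num); last first.
  rewrite adde0; suff -> : (K%:E * wint W w (Gpow p))%E = +oo%E by exact: leey.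
  apply/eqP; move: KPinf; rewrite ge0_fin_numE ?lt_neqAle ?leey ?andbT ?negbK//.
  by rewrite mule_ge0// (wint_ge0 cw)// => x _; exact: powR_ge0.
have cv : (K%:E * wint W w (Gpow p) + wint W w (E m) @[m --> \oo] -->
    K%:E * wint W w (Gpow p) + 0)%E.
  apply: cvgeD => //; last exact: cvg_cst.
  by rewrite fin_num_adde_defl.
rewrite -(cvg_lim _ cv)//; apply: lime_ge; first by apply/cvg_ex; eexists; exact: cv.
exact: nearW.
Qed.
End normalized_sobolev.

(** * The Sobolev inequality with a truncated model *)

Lemma open_rV_gt0 (R : realType) n (U : set 'rV[R]_n) : open U -> U !=set0 ->
  (0 < lebesgue_rV n U)%E.
Proof.
move=> oU [x Ux].
have /nbhs_ballP[e /= e0 xe] : nbhs x U by exact: open_nbhs_nbhs.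
apply: (@lt_le_trans _ _ (lebesgue_rV n (ball x e))); last first.
  apply: le_measure; rewrite ?inE//; first exact: measurable_rV_ball.
  exact: open_rV_measurable.
rewrite (_ : ball x e = [set y : 'rV[R]_n | forall i, (ball (x ord0 i) e : set (measurableTypeR R)) (y ord0 i)]); last first.
  apply/seteqP; split => y /=; first by move=> [_ h] i; exact: h.
  by move=> h; split => // i j; rewrite ord1; exact: h.
rewrite (@lebesgue_rV_box _ n (fun i => ball (x ord0 i) e)); last first.
  by move=> i; exact: measurable_ball.
elim/big_ind : _ => [|a b a0 b0|i _]; first by rewrite lte_fin ltr01.
  by rewrite mule_gt0.
by rewrite lebesgue_measure_ball ?(ltW e0)// lte_fin mulrn_wgt0.
Qed.

Section positivity.
Context {R : realType} {n : nat} (W : set 'rV[R]_n) (w : 'rV[R]_n -> R) (g : R).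
Context (cw : cone_weight W w g).

Lemma wint_gt0 (phi : 'rV[R]_n -> R) (U : set 'rV[R]_n) : measurable_fun W phi ->
  (forall x, W x -> 0 <= phi x) -> open U -> U !=set0 -> U `<=` W ->
  (forall x, U x -> 0 < phi x) -> (0 < wint W w phi)%E.
Proof.
move=> mphi phi0 oU U0 UW phiU.
rewrite lt_neqAle (wint_ge0 cw phi0) andbT eq_sym; apply/eqP => h0.
have := (ae_eq_integral_abs (lebesgue_rV n) (cone_measurable cw) (measurable_wint cw mphi)).1.
have -> : (\int[lebesgue_rV n]_(x in W) `|(phi x * w x)%:E|)%E = 0%E.
  rewrite -[RHS]h0; apply: eq_integral => x; rewrite inE => Wx.
  by rewrite gee0_abs// lee_fin mulr_ge0 ?phi0// (cw_ge0 cw).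
move=> /(_ erefl)[N [mN N0 NP]].
have UN : U `<=` N.
  move=> x Ux; apply: NP => /= /(_ (UW _ Ux)) [] /eqP.
  by rewrite mulf_eq0 !gt_eqF ?phiU// (cw_gt0 cw)//; exact: UW.
have := open_rV_gt0 oU U0; rewrite ltNge => /negP; apply.
by rewrite -N0; apply: le_measure; rewrite ?inE//; exact: open_rV_measurable.
Qed.

Lemma profile_scale (F G : 'rV[R]_n -> R) (rho M L c : R) : 0 < c ->
  profile W F G rho M L ->
  profile W (fun x => c * F x) (fun x => c * G x) rho (c * M) (c * L).
Proof.
move=> c0 pf; split.
- by move=> x; rewrite mulr_ge0 ?(ltW c0)// (pf_ge0 pf).
- move=> x Wx; apply: continuousM; first exact: cst_continuous.
  exact: (pf_cont pf).
- by move=> x Wx xr; rewrite (pf_supp pf Wx xr) mulr0.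
- by move=> x Wx; rewrite ler_pM2l// (pf_bound pf).
- by move=> x y Wx Wy; rewrite -mulrA -mulrDr ler_pM2l// (pf_lip pf).
- by move=> x; rewrite mulr_ge0 ?(ltW c0)// (pf_gge0 pf).
- by apply: measurable_funM; [exact: measurable_cst|exact: (pf_gmeas pf)].
- by move=> x Wx xr; rewrite (pf_gsupp pf Wx xr) mulr0.
- by move=> x Wx; rewrite ler_pM2l// (pf_gbound pf).
- move=> z eps Wz eps0.
  have [d d0 dP] := pf_slope pf Wz (divr_gt0 eps0 c0).
  exists d => // x Wx xz.
  rewrite (_ : c * F z + (c * G z + eps) * enorm (x - z) =
    c * (F z + (G z + eps / c) * enorm (x - z))); first by rewrite ler_pM2l// dP.
  by field; rewrite gt_eqF.
Qed.
End positivity.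

Section slices.
Context {R : realType} {n : nat}.
Implicit Types F : 'rV[R]_n.+1 -> \bar R.

Lemma slice_sup_gt0 F : measurable_fun setT F -> (forall x, 0 <= F x)%E ->
  (0 < \int[lebesgue_rV n.+1]_x F x)%E -> (0 < slice_sup F)%E.
Proof.
move=> mF F0; rewrite integral_rVS// !ltNge => h; apply/negP => S0; move/negP : h; apply.
rewrite integral0_eq// => a _; apply/eqP; rewrite eq_le integral_ge0// andbT.
by apply: le_trans S0; apply: ereal_sup_ubound; exists a.
Qed.

Lemma slice_supZ F (c : R) : 0 < c -> measurable_fun setT F -> (forall x, 0 <= F x)%E ->
  slice_sup (fun x => c%:E * F x)%E = (c%:E * slice_sup F)%E.
Proof.
move=> c0 mF F0; rewrite /slice_sup -ereal_sup_pZl//; congr ereal_sup.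
have E a : (\int[lebesgue_rV n]_x (c%:E * F (cons_rV (a, x))) =
    c%:E * \int[lebesgue_rV n]_x F (cons_rV (a, x)))%E.
  by rewrite ge0_integralZl_EFin ?(ltW c0)//; exact: measurable_slice.
apply/seteqP; split => y /=.
  by move=> [a _ <-]; exists (\int[lebesgue_rV n]_x F (cons_rV (a, x)))%E; [exists a|rewrite E].
by move=> [_ [b _ <-] <-]; exists b => //; rewrite E.
Qed.

Lemma slice_sup_lty F (B r : R) : measurable_fun setT F -> (forall x, 0 <= F x <= B%:E)%E ->
  (forall x, r <= enorm x -> F x = 0%E) -> (slice_sup F < +oo)%E.
Proof.
move=> mF FB supp.
have B0 : 0 <= B by have /andP[h1 h2] := FB 0; rewrite -lee_fin (le_trans h1).
pose b := [set x : 'rV[R]_n | enorm x < r].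
have mb : measurable b by exact: measurable_eball.
apply: (@le_lt_trans _ _ (B%:E * lebesgue_rV n b)%E); last first.
  by rewrite lte_mul_pinfty//; exact: eball_finite.
apply: ge_ereal_sup => _ [a _ <-].
rewrite -integral_cst// [leRHS]integral_mkcond.
apply: ge0_le_integral => //.
- by move=> x _; have /andP[] := FB (cons_rV (a, x)).
- exact: measurable_slice.
- by apply/(measurable_restrictT _ _).1.
move=> x _; rewrite patchE; case: ifPn => [_|]; first by have /andP[] := FB (cons_rV (a, x)).
rewrite notin_setE /b/= => /negP; rewrite -leNgt => rx.
rewrite supp//; apply: le_trans rx _.
rewrite /enorm ler_wsqrtr// /dotp big_ord_recl/= /cons_rV mxE unlift_none/= -expr2.
rewrite [leLHS](_ : _ = \sum_(i < n) (\row_i0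
    match unlift ord0 i0 with
    | Some j => (a, x).2 ord0 j
    | None => (a, x).1
    end) ord0 (lift ord0 i) * (\row_i0
    match unlift ord0 i0 with
    | Some j => (a, x).2 ord0 j
    | None => (a, x).1
    end) ord0 (lift ord0 i)); last by apply: eq_bigr => i _; rewrite !mxE liftK.
by rewrite lerDr sqr_ge0.
Qed.
End slices.

(** The weighted inequality between the arithmetic and the geometric mean, with
weights for which the powers of [c] cancel. *)
Lemma scale_absorption (R : realType) (e K P Q I c p q t : R) :
  0 < e -> 0 < c -> 0 < t -> t < 1 -> 0 <= Q -> 0 <= I -> q * t = p ->
  I + e * (c `^ q * Q) <= K * (c `^ p * P) ->
  (e * Q / t) `^ t * (I / (1 - t)) `^ (1 - t) <= K * P.
Proof.
move=> e0 c0 t0 t1 Q0 I0 qt main.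
have t1' : 0 < 1 - t by rewrite subr_gt0.
have cp0 : 0 < c `^ p by exact: powR_gt0.
rewrite -[leRHS](mulfK (lt0r_neq0 cp0)) ler_pdivlMr//.
have -> : K * P * c `^ p = K * (c `^ p * P) by ring.
apply: le_trans main.
have x0 : 0 <= e * (c `^ q * Q) / t.
  by rewrite divr_ge0 ?(ltW t0)// mulr_ge0 ?(ltW e0)// mulr_ge0 ?powR_ge0.
have y0 : 0 <= I / (1 - t) by rewrite divr_ge0// ltW.
have t01 : 0 <= t <= 1 by rewrite !ltW.
have := weighted_amgm_le x0 y0 t01.
have -> : t * (e * (c `^ q * Q) / t) + (1 - t) * (I / (1 - t)) = I + e * (c `^ q * Q).
  by field; rewrite !gt_eqF.
apply: le_trans; rewrite le_eqVlt; apply/orP; left; apply/eqP.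
have -> : e * (c `^ q * Q) / t = c `^ q * (e * Q / t) by ring.
rewrite [in RHS]powRM ?powR_ge0//; last by rewrite divr_ge0 ?(ltW t0)// mulr_ge0// ltW.
by rewrite -powRrM qt; ring.
Qed.

Section cone_sobolev.
Context {R : realType} {n : nat} (W : set 'rV[R]_n.+1) (w : 'rV[R]_n.+1 -> R) (g : R).
Context (cw : cone_weight W w g) (W0 : W !=set0).
Context (k p p' : R) (k0 : 0 < k).
Let e := n%:R + g.
Context (e0 : 0 < e).
Context (p1 : 1 < p) (pp' : p^-1 + p'^-1 = 1) (kE : (k + 1) * p = k * (e + 1)).
Let q := k * (e + 1).
Let t := p / q.
Let K := e * ((p' - 1) * (k / p') `^ p).
Local Notation Fpow f r := (fun x => (f x `^ r)%R).

Lemma wint_pow_lty (F : 'rV[R]_n.+1 -> R) r rho M : 0 < r -> measurable_fun W F ->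
  (forall x, W x -> 0 <= F x <= M) -> (forall x, W x -> rho < enorm x -> F x = 0) ->
  (wint W w (Fpow F r) < +oo)%E.
Proof.
move=> r0 mF FM supp.
apply: (wint_lty cw (B := M `^ r) (r := rho)).
- exact: (measurableT_comp (measurable_powR _) mF).
- move=> x Wx; have /andP[h1 h2] := FM _ Wx; rewrite powR_ge0/=.
  by apply: ge0_ler_powR; rewrite ?nnegrE ?(ltW r0)// (le_trans h1).
- by move=> x Wx xr; rewrite supp// powR0// gt_eqF.
Qed.

Lemma truncated_model_int_gt0 T : 0 < T ->
  (0 < wint W w (truncated_model (n := n) g p' T))%E.
Proof.
move=> T0; apply: (wint_gt0 cw (U := W `&` [set x | enorm x < T])).
- exact: measurable_funTS (measurable_truncated_model g p' T).
- by move=> x _; exact: truncated_model_ge0.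
- apply: openI; first exact: (cw_open cw).
  apply: (@open_comp _ _ (enorm : 'rV[R]_n.+1 -> R) [set u | u < T]); last exact: open_lt.
  by move=> x _; exact: enorm_continuous.
- have [x Wx] := W0; pose c := T / (enorm x + 1) / 2.
  have x1 : 0 < enorm x + 1 by rewrite ltr_wpDl// enorm_ge0.
  have c0 : 0 < c by rewrite !divr_gt0.
  exists (c *: x); split; first exact: (cw_scale cw).
  rewrite /= enormZ gtr0_norm// /c.
  rewrite mulrAC ltr_pdivrMr// mulrAC ltr_pdivrMr//.
  have := enorm_ge0 x; nra.
- by move=> x [].
- move=> x [_ /= xT]; rewrite /truncated_model xT /model powR_gt0//.
  by rewrite ltr_wpDr// powR_ge0.
Qed.

(** Rescaling [F] balances the largest slices of its mass and of the model; the
value of the scale does not matter, since the weighted inequality between means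
absorbs it. *)
Lemma sobolev_truncated (F G : 'rV[R]_n.+1 -> R) (rho M L T : R) :
  profile W F G rho M L -> 0 < T ->
  (e * fine (wint W w (Fpow F q)) / t) `^ t *
    (fine (wint W w (truncated_model (n := n) g p' T)) / (1 - t)) `^ (1 - t) <=
  K * fine (wint W w (Fpow G p)).
Proof.
move=> pf T0.
have p0 : 0 < p by exact: lt_trans p1.
have ke0 : 0 < k * e by exact: mulr_gt0.
have q0 : 0 < q by rewrite mulr_gt0// addr_gt0.
have K0 : 0 <= K by exact: K_ge0.
have t0 : 0 < t by exact: divr_gt0.
have t1 : t < 1.
  by rewrite /t ltr_pdivrMr// mul1r /q -kE ltr_pMl// ltrDr.
have t1' : 0 < 1 - t by rewrite subr_gt0.
have mF := measurable_profile cw pf.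
have mG := pf_gmeas pf.
have FM x : W x -> 0 <= F x <= M by move=> Wx; rewrite (pf_ge0 pf) (pf_bound pf).
have GL x : W x -> 0 <= G x <= L by move=> Wx; rewrite (pf_gge0 pf) (pf_gbound pf).
have Qfin := wint_pow_lty q0 mF FM (pf_supp pf).
have Pfin := wint_pow_lty p0 mG GL (pf_gsupp pf).
have Yfin := wint_pow_lty ke0 mF FM (pf_supp pf).
have mFp r : measurable_fun W (Fpow F r) by exact: (measurableT_comp (measurable_powR _) mF).
have mGp r : measurable_fun W (Fpow G r) by exact: (measurableT_comp (measurable_powR _) mG).
have Q0 : (0 <= wint W w (Fpow F q))%E by apply: (wint_ge0 cw) => x _; exact: powR_ge0.
have P0 : (0 <= wint W w (Fpow G p))%E by apply: (wint_ge0 cw) => x _; exact: powR_ge0.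
have [Qz|Qnz] := eqVneq (wint W w (Fpow F q)) 0%E.
  rewrite Qz /= mulr0 mul0r powR0 ?gt_eqF// mul0r mulr_ge0//.
  by rewrite fine_ge0.
have Qpos : (0 < wint W w (Fpow F q))%E by rewrite lt_neqAle eq_sym Qnz; exact: Q0.
pose V := truncated_model (n := n) g p' T.
have mV : measurable_fun W V := measurable_funTS (measurable_truncated_model g p' T).
have V0 x : 0 <= V x by exact: truncated_model_ge0.
have V1 x : V x <= 1.
  rewrite /V /truncated_model; case: ifP => // _; 
  have one : (1 : R) `^ (- e) = 1 by rewrite powR1.
  rewrite /model -[leRHS]one.
  by apply: ler_powRN; rewrite ?(ltW e0)// lerDl powR_ge0.
have Ipos := truncated_model_int_gt0 T0.
have Ifin : (wint W w V < +oo)%E.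
  apply: (wint_lty cw (B := 1) (r := T) mV); first by move=> x _; rewrite V0 V1.
  by move=> x _ xT; rewrite /V /truncated_model ltNge (ltW xT).
have Ypos : (0 < wint W w (Fpow F (k * e)))%E.
  rewrite ltNge; apply/negP => Y0; move: Qpos; rewrite ltNge => /negP; apply.
  apply: (@le_trans _ _ (wint W w (fun x => (`|M| `^ k * F x `^ (k * e))%R))).
    apply: (le_wint cw) => //; first by apply: measurable_funM => //; exact: measurable_cst.
    move=> x Wx; rewrite powR_ge0/= /q mulrDr mulr1 addrC.
    have [->|Fx] := eqVneq (F x) 0.
      by rewrite powR0 ?mulr_ge0 ?powR_ge0// gt_eqF// addr_gt0.
    rewrite powRD ?Fx ?implybT// ler_wpM2r ?powR_ge0//.
    apply: ge0_ler_powR; rewrite ?nnegrE ?(ltW k0) ?(pf_ge0 pf)//.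
    by apply: (le_trans (pf_bound pf Wx)); exact: ler_norm.
  rewrite (wintZ cw) ?powR_ge0//; last by move=> x _; exact: powR_ge0.
  by rewrite mule_ge0_le0// lee_fin powR_ge0.
have mass_lty (phi : 'rV[R]_n.+1 -> R) (B r : R) : measurable_fun W phi ->
    (forall x, W x -> 0 <= phi x <= B) -> (forall x, W x -> r < enorm x -> phi x = 0) ->
    (slice_sup (cone_mass W w phi) < +oo)%E.
  move=> mphi phiB supp; have [C wC] := cw_bound cw (r + 1).
  apply: (@slice_sup_lty _ _ _ (Num.max 0 B * Num.max 0 C) (r + 1)).
  - exact: measurable_cone_mass cw _ mphi.
  - move=> x; rewrite (cone_mass_ge0 cw); last by move=> y /phiB/andP[].
    rewrite /cone_mass patchE; case: ifPn => [|_]; last first.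
      by rewrite lee_fin mulr_ge0// le_max lexx.
    rewrite inE => Wx; rewrite lee_fin; have /andP[h1 h2] := phiB _ Wx.
    have [xr|xr] := leP (enorm x) (r + 1).
      by rewrite ler_pM ?(cw_ge0 cw)// le_max ?h2 ?orbT// wC// orbT.
    rewrite supp ?mul0r//; last by apply: lt_trans xr; rewrite ltrDl.
    by rewrite mulr_ge0// le_max lexx.
  - move=> x xr; rewrite /cone_mass patchE; case: ifPn => // /[!inE] Wx.
    by rewrite supp ?mul0r//; apply: lt_le_trans xr; rewrite ltrDl.
have SFpos : (0 < slice_sup (cone_mass W w (Fpow F (k * e))))%E.
  apply: slice_sup_gt0.
  - exact: measurable_cone_mass cw _ (mFp _).
  - by apply: (cone_mass_ge0 cw) => x _; exact: powR_ge0.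
  - by rewrite integral_cone_mass.
have SVpos : (0 < slice_sup (cone_mass W w V))%E.
  apply: slice_sup_gt0.
  - exact: measurable_cone_mass cw _ mV.
  - exact: (cone_mass_ge0 cw).
  - by rewrite integral_cone_mass.
have SFfin : (slice_sup (cone_mass W w (Fpow F (k * e))) < +oo)%E.
  apply: (mass_lty _ (M `^ (k * e)) rho) => //.
    move=> x Wx; have /andP[h1 h2] := FM _ Wx; rewrite powR_ge0/=.
    by apply: ge0_ler_powR; rewrite ?nnegrE ?(ltW ke0)// (le_trans h1).
  by move=> x Wx xr; rewrite (pf_supp pf Wx xr) powR0// gt_eqF.
have SVfin : (slice_sup (cone_mass W w V) < +oo)%E.
  apply: (mass_lty _ 1 T) => //; first by move=> x _; rewrite V0 V1.
  by move=> x _ xT; rewrite /V /truncated_model ltNge (ltW xT).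
have SFf : slice_sup (cone_mass W w (Fpow F (k * e))) \is a fin_num.
  by rewrite (ge0_fin_numE (ltW SFpos)); exact: SFfin.
have SVf : slice_sup (cone_mass W w V) \is a fin_num.
  by rewrite (ge0_fin_numE (ltW SVpos)); exact: SVfin.
pose a := fine (slice_sup (cone_mass W w V)) / fine (slice_sup (cone_mass W w (Fpow F (k * e)))).
have a0 : 0 < a by rewrite divr_gt0// fine_gt0// ?SFpos ?SFfin ?SVpos ?SVfin.
pose c := a `^ (k * e)^-1.
have c0 : 0 < c by exact: powR_gt0.
have cke : c `^ (k * e) = a by rewrite -powRrM mulVf ?gt_eqF// powRr1// ltW.
have cFE r x : W x -> (c * F x) `^ r = c `^ r * F x `^ r.
  by move=> Wx; rewrite powRM// ?(ltW c0)// (pf_ge0 pf).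
have cGE r x : W x -> (c * G x) `^ r = c `^ r * G x `^ r.
  by move=> Wx; rewrite powRM// ?(ltW c0)// (pf_gge0 pf).
have balance : slice_sup (cone_mass W w (fun x => (c * F x) `^ (k * e))) =
    slice_sup (cone_mass W w V).
  have -> : cone_mass W w (fun x => (c * F x) `^ (k * e)) =
      (fun x => a%:E * cone_mass W w (Fpow F (k * e)) x)%E.
    apply/funext => x; rewrite /cone_mass !patchE; case: ifPn; last by rewrite mule0.
    by rewrite inE => Wx; rewrite cFE// cke -EFinM mulrA.
  rewrite slice_supZ//; last 2 first.
  - exact: measurable_cone_mass cw _ (mFp _).
  - by apply: (cone_mass_ge0 cw) => x _; exact: powR_ge0.
  rewrite -(fineK SFf) -(fineK SVf) -EFinM /a divfK//.
  by rewrite gt_eqF// fine_gt0// SFpos SFfin.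
have main := sobolev_normalized cw (profile_scale c0 pf) k0 T0 e0 p1 pp' kE balance.
have EQ : wint W w (fun x => ((c * F x) `^ q)%R) = ((c `^ q)%:E * wint W w (Fpow F q))%E.
  rewrite -(wintZ cw (mFp q) (powR_ge0 _ _)); last by move=> x _; exact: powR_ge0.
  by apply: eq_wint => x; exact: cFE.
have EP : wint W w (fun x => ((c * G x) `^ p)%R) = ((c `^ p)%:E * wint W w (Fpow G p))%E.
  rewrite -(wintZ cw (mGp p) (powR_ge0 _ _)); last by move=> x _; exact: powR_ge0.
  by apply: eq_wint => x; exact: cGE.
move: main; rewrite EQ EP -/V.
have Qf : wint W w (Fpow F q) \is a fin_num by rewrite (ge0_fin_numE Q0); exact: Qfin.
have Pf : wint W w (Fpow G p) \is a fin_num by rewrite (ge0_fin_numE P0); exact: Pfin.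
have If : wint W w V \is a fin_num by rewrite (ge0_fin_numE (ltW Ipos)); exact: Ifin.
rewrite -(fineK Qf) -(fineK Pf) -(fineK If) -!EFinM -EFinD lee_fin /=.
have Qr0 : 0 < fine (wint W w (Fpow F q)) by rewrite fine_gt0// Qpos; exact: Qfin.
have Ir0 : 0 < fine (wint W w V) by rewrite fine_gt0// Ipos; exact: Ifin.
move=> main; apply: (scale_absorption e0 c0 t0 t1 (ltW Qr0) (ltW Ir0) _ main).
by rewrite /t mulrCA mulfV ?gt_eqF// mulr1.
Qed.
End cone_sobolev.

(** * The Gamma function *)

Section gamma_integrals.
Context {R : realType}.
Notation mu := (@lebesgue_measure R).
Implicit Types (s t a b X : R).

(** Euler's integral before it is known to converge. *)
Definition gammae s : \bar R :=
  (\int[mu]_(t in `]0%R, +oo[) (t `^ (s - 1) * expR (- t))%:E)%E.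

Lemma measurable_gamma_integrand s a (D : set (measurableTypeR R)) :
  measurable_fun D (fun t => t `^ (s - 1) * expR (- (a * t))).
Proof.
apply: measurable_funTS; apply: measurable_funM; first exact: measurable_powR.
apply: (measurableT_comp (@measurable_expR R)).
by apply: measurable_funN; apply: measurable_funM.
Qed.

Lemma measurable_gamma_integrand1 s (D : set (measurableTypeR R)) :
  measurable_fun D (fun t => t `^ (s - 1) * expR (- t)).
Proof.
have := @measurable_gamma_integrand s 1 D.
by congr (measurable_fun _ _); apply/funext => t; rewrite mul1r.
Qed.

Lemma gammae_ge0 s : (0 <= gammae s)%E.
Proof. by apply: integral_ge0 => t _; rewrite lee_fin mulr_ge0 ?powR_ge0 ?expR_ge0. Qed.

Lemma gammae_scale s a : 0 < a ->
  (\int[mu]_(t in `]0%R, +oo[) (t `^ (s - 1) * expR (- (a * t))%R)%:E =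
   (a `^ (- s))%:E * gammae s)%E.
Proof.
move=> a0.
pose I : set R := `]0, +oo[%classic.
pose f1 (t : R) := (t `^ (s - 1) * expR (- t))%:E.
rewrite -[X in _ = (_ * X)%E]/(\int[mu]_(t in I) f1 t)%E.
rewrite [LHS]integral_mkcond [X in _ = (_ * X)%E]integral_mkcond.
have mI : measurable I by exact: measurable_itv.
have mf1 : measurable_fun setT (f1 \_ I).
  apply: (measurable_restrictT _ mI).1; apply/measurable_EFinP.
  exact: measurable_gamma_integrand1.
have f10 x : (0 <= (f1 \_ I) x)%E.
  by apply: erestrict_ge0 => t _; rewrite lee_fin mulr_ge0 ?powR_ge0 ?expR_ge0.
rewrite [in RHS](integral_affine 0 (lt0r_neq0 a0) mf1 f10) gtr0_norm//.
rewrite muleA -EFinM -ge0_integralZl_EFin//; last 2 first.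
- by apply: (measurableT_comp mf1); exact: measurable_affine.
- by rewrite mulr_ge0 ?powR_ge0// ltW.
apply: eq_integral => t _; rewrite addr0 !patchE.
have -> : (a * t \in I) = (t \in (`]0, +oo[%classic : set R)).
  by apply/idP/idP; rewrite !inE /I/= !in_itv/= !andbT pmulr_rgt0.
case: ifPn; last by rewrite mule0.
rewrite inE/= in_itv/= andbT => t0; rewrite /f1 -EFinM; congr (_%:E).
rewrite powRM ?(ltW t0) ?(ltW a0)//.
have -> : a `^ (- s) * a * (a `^ (s - 1) * t `^ (s - 1) * expR (- (a * t))) =
  a `^ (- s) * a * a `^ (s - 1) * (t `^ (s - 1) * expR (- (a * t))) by ring.
rewrite -[LHS]mul1r; congr (_ * _).
rewrite -[X in _ * X * _](powRr1 (ltW a0)) -!powRD ?(gt_eqF a0) ?implybT//.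
by rewrite (_ : _ + _ = 0) ?powRr0//; ring.
Qed.

Lemma integral_expRN X :
  (\int[mu]_(t in `]X, +oo[) (expR (- t))%:E = (expR (- X))%:E)%E.
Proof.
have cE : continuous (fun t : R => expR (- t)).
  move=> t; apply: continuous_comp; first exact: opp_continuous.
  exact: continuous_expR.
rewrite integral_itv_obnd_cbnd; last first.
  apply: measurable_funTS; apply/measurable_EFinP.
  exact: continuous_measurable_fun.
have -> : (expR (- X))%:E = (0%R%:E - (- expR (- X))%:E)%E.
  by rewrite -EFinB sub0r opprK.
apply: (@ge0_continuous_FTC2y _ (fun t => expR (- t)) (fun t => - expR (- t)) X 0).
- by move=> t _; exact: expR_ge0.
- exact: continuous_subspaceT.
- by rewrite -oppr0; apply: cvgN; exact: cvgr_expR.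
- by move=> t _; apply: derivableN; exact: ex_derive.
- by apply: cvgN; apply: cvg_at_right_filter; exact: cE.
- move=> t _; rewrite derive1E deriveN; last exact: ex_derive.
  rewrite derive_val /GRing.scale/=.
  by rewrite ?mulrN ?mulNr ?mulr1 ?mul1r opprK.
Qed.

(** The interval is exhausted by compact ones, away from the singularity at the
origin. *)
Lemma integral_powR_unit s : 0 < s ->
  (\int[mu]_(x in `]0%R, 1%R]) (x `^ (s - 1))%:E = (s^-1)%:E)%E.
Proof.
move=> s0.
pose I n : set R := `[n.+2%:R^-1, 1]%classic.
have IU : (`]0, 1]%classic : set R) = \bigcup_n I n.
  apply/seteqP; split => x /=.
    rewrite in_itv/= => /andP[x0 x1]; exists (Num.truncn x^-1) => //=.
    rewrite /I/= in_itv/= x1 andbT -[leRHS]invrK lef_pV2 ?posrE ?invr_gt0//.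
    by apply: (le_trans (ltW (truncnS_gt _))); rewrite ler_nat.
  move=> [n _]; rewrite /I/= !in_itv/= => /andP[h ->]; rewrite andbT.
  by apply: lt_le_trans h; rewrite invr_gt0.
have pos n x : n.+2%:R^-1 <= x -> 0 < x :> R.
  by apply: lt_le_trans; rewrite invr_gt0.
have IE n : (\int[mu]_(x in I n) (x `^ (s - 1))%:E = ((1 - n.+2%:R^-1 `^ s) / s)%:E)%E.
  have ab : n.+2%:R^-1 < 1 :> R by rewrite invf_lt1// ltr1n.
  have cF x : 0 < x -> {for x, continuous (fun u : R => u `^ s / s)}.
    move=> x0; apply: continuousM; last exact: cst_continuous.
    exact: powR_continuous_at.
  rewrite /I (@continuous_FTC2 _ (fun x => x `^ (s - 1)) (fun x => x `^ s / s))//.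
  - by rewrite powR1 mul1r -EFinB mulrBl mul1r.
  - apply: continuous_in_subspaceT => x /[!inE]/=; rewrite in_itv/= => /andP[h _].
    exact: powR_continuous_at (pos _ _ h).
  - split.
    + move=> x; rewrite in_itv/= => /andP[h _].
      apply: derivableM => //; apply: derivable_powR.
      by rewrite in_itv/= andbT; exact: pos (ltW h).
    + by apply: cvg_at_right_filter; apply: cF; rewrite invr_gt0.
    + by apply: cvg_at_left_filter; exact: cF.
  - move=> x; rewrite in_itv/= => /andP[/ltW/pos x0 _].
    rewrite (_ : (fun x => x `^ s / s) = (fun x => s^-1 *: (x `^ s : R^o))); last first.
      by apply/funext => u; rewrite mulrC.
    have dx : derivable (@powR R ^~ s) x 1 by apply: derivable_powR; rewrite in_itv/= andbT.
    rewrite derive1E deriveZ// -derive1E powR_derive1 ?in_itv/= ?andbT//.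
    by rewrite /GRing.scale/= mulKf// gt_eqF.
have cv : (\int[mu]_(x in I n) (x `^ (s - 1))%:E @[n --> \oo] -->
    \int[mu]_(x in `]0%R, 1%R]) (x `^ (s - 1))%:E)%E.
  rewrite IU; apply: ge0_nondecreasing_set_cvg_integral.
  - move=> n m nm; apply/subsetPset => x; rewrite /I/= !in_itv/= => /andP[h ->].
    by rewrite andbT (le_trans _ h)// lef_pV2 ?posrE// ler_nat !ltnS.
  - by move=> n; exact: measurable_itv.
  - by move=> n; apply/measurable_EFinP; apply: measurable_funTS; exact: measurable_powR.
  - by move=> n x _; rewrite lee_fin powR_ge0.
rewrite -(cvg_lim _ cv)//; apply/cvg_lim => //.
under eq_fun do rewrite IE.
suff cvR : (1 - n.+2%:R^-1 `^ s) / s @[n --> \oo] --> s^-1.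
  by apply: cvg_EFin => //; exact: nearW.
rewrite -[X in _ --> X]mul1r; apply: cvgM; last exact: cvg_cst.
rewrite -[in X in _ --> X](subr0 1).
apply: cvgB; first exact: cvg_cst.
apply/cvgrPdist_le => eps eps0.
have : \forall n \near \oo, n.+1%:R^-1 < eps `^ s^-1 :> R.
  have := @cvg_harmonic R => /cvgrPdist_lt/(_ _ (powR_gt0 s^-1 eps0)).
  by apply: filterS => n; rewrite sub0r normrN gtr0_norm// invr_gt0.
apply: filterS => n nE; rewrite sub0r normrN ger0_norm ?powR_ge0//.
rewrite [leRHS](_ : eps = (eps `^ s^-1) `^ s); last first.
  by rewrite -powRrM mulVf ?gt_eqF// powRr1// ltW.
apply: ge0_ler_powR; rewrite ?nnegrE ?(ltW s0) ?powR_ge0 ?invr_ge0//.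
by apply: le_trans (ltW nE); rewrite lef_pV2 ?posrE// ler_nat.
Qed.

Lemma integral_powR_segment s X : 0 < s -> 0 < X ->
  (\int[mu]_(x in `]0%R, X]) (x `^ (s - 1))%:E = (X `^ s / s)%:E)%E.
Proof.
move=> s0 X0.
pose I : set R := `]0, X]%classic; pose I1 : set R := `]0, 1]%classic.
pose f (t : R) := (t `^ (s - 1))%:E.
rewrite -[LHS]/(\int[mu]_(t in I) f t)%E [LHS]integral_mkcond.
have mI : measurable I by exact: measurable_itv.
have mf_ (D : set (measurableTypeR R)) : measurable_fun D f.
  by apply/measurable_EFinP; apply: measurable_funTS; exact: measurable_powR.
have mf : measurable_fun setT (f \_ I).
  by apply: (measurable_restrictT _ mI).1; exact: mf_.
have f0 x : (0 <= (f \_ I) x)%E.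
  by apply: erestrict_ge0 => t _; rewrite lee_fin powR_ge0.
rewrite (integral_affine 0 (lt0r_neq0 X0) mf f0) gtr0_norm//.
rewrite -(mulr_powRB1 (ltW X0) s0) -mulrA EFinM; congr (_ * _)%E.
rewrite EFinM -integral_powR_unit// -[X in _ = (_ * X)%E]/(\int[mu]_(t in I1) f t)%E.
rewrite [X in _ = (_ * X)%E]integral_mkcond -ge0_integralZl_EFin ?powR_ge0//.
- apply: eq_integral => x _; rewrite addr0 !patchE.
  have -> : (X * x \in I) = (x \in I1).
    by apply/idP/idP; rewrite !inE /I /I1/= !in_itv/= pmulr_rgt0// ger_pMr.
  case: ifPn; last by rewrite mule0.
  rewrite inE /I1/= in_itv/= => /andP[x0 _].
  by rewrite /f powRM ?(ltW X0) ?(ltW x0)// EFinM.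
- by move=> x _; apply: erestrict_ge0 => t _; rewrite lee_fin powR_ge0.
- by apply: (measurable_restrictT _ _).1 => //; exact: measurable_itv.
Qed.
End gamma_integrals.

Lemma tonelli_rectangle d1 d2 (T1 : measurableType d1) (T2 : measurableType d2) (R : realType)
    (m1 : {sigma_finite_measure set T1 -> \bar R})
    (m2 : {sigma_finite_measure set T2 -> \bar R})
    (A : set T1) (B : set T2) (f : T1 * T2 -> \bar R) :
  measurable A -> measurable B -> measurable_fun setT f -> (forall z, 0 <= f z)%E ->
  (\int[m1]_(x in A) \int[m2]_(y in B) f (x, y) =
   \int[m2]_(y in B) \int[m1]_(x in A) f (x, y))%E.
Proof.
move=> mA mB mf f0.
have mf' : measurable_fun setT (f \_ (A `*` B)).
  apply: (measurable_restrictT _ _).1; first exact: measurableX.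
  exact: measurable_funTS.
have f'0 z : (0 <= (f \_ (A `*` B)) z)%E by apply: erestrict_ge0 => ? _.
have := @fubini_tonelli _ _ _ _ R m1 m2 _ mf' f'0 => H.
rewrite integral_mkcond [RHS]integral_mkcond.
transitivity (\int[m1]_x \int[m2]_y (f \_ (A `*` B)) (x, y))%E; last rewrite H.
  apply: eq_integral => x _; rewrite patchE.
  case: ifPn => xA.
    rewrite integral_mkcond; apply: eq_integral => y _.
    by rewrite !patchE in_setX xA.
  by rewrite integral0_eq// => y _; rewrite patchE in_setX (negPf xA).
apply: eq_integral => y _; rewrite [RHS]patchE.
case: ifPn => yB.
  rewrite [RHS]integral_mkcond; apply: eq_integral => x _.
  by rewrite !patchE in_setX yB andbT.
by rewrite integral0_eq// => x _; rewrite patchE in_setX (negPf yB) andbF.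
Qed.

Section gamma_function.
Context {R : realType}.
Notation mu := (@lebesgue_measure R).
Implicit Types (s t a b X : R).

Lemma measurable_below_diagonal (f h : R -> R) :
  measurable_fun setT f -> measurable_fun setT h ->
  measurable_fun [set: measurableTypeR R * measurableTypeR R]
    (fun z => if z.1 <= z.2 then f z.1 * h z.2 else 0).
Proof.
move=> mf mh; apply: measurable_fun_if => //.
- exact: measurable_fun_ler.
- apply: measurable_funTS; apply: measurable_funM.
    exact: (measurableT_comp mf).
  exact: (measurableT_comp mh).
Qed.

(** Integration by parts, in the form of an exchange of integrals over
[0 < x <= t]. *)
Lemma gammaeS s : 0 < s -> (gammae (s + 1) = s%:E * gammae s)%E.
Proof.
move=> s0.
pose I : set R := `]0, +oo[%classic.
have mI : measurable I by exact: measurable_itv.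
pose f (z : measurableTypeR R * measurableTypeR R) : R :=
  if z.1 <= z.2 then (s * z.1 `^ (s - 1)) * expR (- z.2) else 0.
have f0 z : 0 <= f z.
  by rewrite /f; case: ifP => // _; rewrite !mulr_ge0 ?expR_ge0 ?powR_ge0// ltW.
have mf : measurable_fun setT f.
  apply: (measurable_below_diagonal (f := fun x => s * x `^ (s - 1)) (h := fun x => expR (- x))).
    by apply: measurable_funM => //; exact: measurable_powR.
  exact: (measurableT_comp (@measurable_expR R)).
have E1 t : 0 < t -> (\int[mu]_(x in I) (f (x, t))%:E = (t `^ s * expR (- t))%:E)%E.
  move=> t0.
  transitivity ((s * expR (- t))%:E * \int[mu]_(x in `]0%R, t]) (x `^ (s - 1))%:E)%E; last first.
    rewrite integral_powR_segment// -EFinM; congr EFin.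
    by rewrite mulrC -!mulrA; congr (_ * _); rewrite mulKf// gt_eqF.
  rewrite -ge0_integralZl_EFin//.
  - rewrite [LHS]integral_mkcond [RHS]integral_mkcond; congr (integral _ _ _).
    apply/funext => x; rewrite !patchE /f /= !mem_setE /I !in_itv/= andbT.
    by case: (0 < x) => //=; case: ifP => // _; rewrite -EFinM mulrAC.
  - by move=> x _; rewrite lee_fin powR_ge0.
  - by apply/measurable_EFinP; apply: measurable_funTS; exact: measurable_powR.
  - by rewrite mulr_ge0 ?expR_ge0// ltW.
have E2 x : 0 < x ->
    (\int[mu]_(t in I) (f (x, t))%:E = s%:E * (x `^ (s - 1) * expR (- x))%:E)%E.
  move=> x0; rewrite -EFinM mulrA EFinM -integral_expRN integral_itv_obnd_cbnd; last first.
    apply/measurable_EFinP; apply: measurable_funTS.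
    exact: (measurableT_comp (@measurable_expR R)).
  rewrite -ge0_integralZl_EFin//.
  - rewrite [LHS]integral_mkcond [RHS]integral_mkcond; congr (integral _ _ _).
    apply/funext => t; rewrite !patchE /f /= !mem_setE /I !in_itv/= !andbT.
    have [xt|xt] := leP x t; first by rewrite (lt_le_trans x0 xt).
    by case: ifP.
  - apply/measurable_EFinP; apply: measurable_funTS.
    exact: (measurableT_comp (@measurable_expR R)).
  - by rewrite mulr_ge0 ?powR_ge0// ltW.
have := @tonelli_rectangle _ _ _ _ R mu mu I I (EFin \o f) mI mI.
move=> /(_ ((measurable_EFinP _ _).2 mf)).
move=> /(_ (fun z => f0 z : (0 <= (EFin \o f) z)%E)) T.
transitivity (\int[mu]_(y in I) \int[mu]_(x in I) (f (x, y))%:E)%E; last rewrite -T.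
  apply: eq_integral => t; rewrite inE /I/= in_itv/= andbT => t0.
  by rewrite addrK E1.
transitivity (\int[mu]_(x in I) (s%:E * (x `^ (s - 1) * expR (- x))%:E))%E.
  by apply: eq_integral => x; rewrite inE /I/= in_itv/= andbT => /E2.
apply: ge0_integralZl_EFin; last exact: ltW.
- exact: mI.
- by move=> x _; rewrite lee_fin mulr_ge0 ?powR_ge0 ?expR_ge0.
- by apply/measurable_EFinP; exact: measurable_gamma_integrand1.
Qed.

Lemma gammae1 : gammae 1 = 1%E :> \bar R.
Proof.
rewrite -[RHS]/((1 : R)%:E) -[X in X%:E](@expR0 R) -{1}oppr0 -integral_expRN.
by apply: eq_integral => t _; rewrite subrr powRr0 mul1r.
Qed.

Lemma gammae_nat_lty n : (gammae (R := R) n.+1%:R < +oo)%E.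
Proof.
elim: n => [|n IH]; first by rewrite gammae1 ltry.
by rewrite -[n.+2%:R]natr1 gammaeS// lte_mul_pinfty.
Qed.

(** For [s >= 1] the integrand is dominated by those at [1] and at an integer
above [s]; smaller [s] reduce to [s + 1]. *)
Lemma gammae_lty s : 0 < s -> (gammae s < +oo)%E.
Proof.
have big (u : R) : 1 <= u -> (gammae u < +oo)%E.
  move=> u1; pose m := Num.truncn u.
  apply: (@le_lt_trans _ _ (gammae 1 + gammae m.+1%:R)%E); last first.
    by apply: lte_add_pinfty; rewrite ?gammae1 ?ltry// gammae_nat_lty.
  rewrite /gammae -ge0_integralD//.
  - apply: ge0_le_integral => //.
    + by move=> t _; rewrite lee_fin mulr_ge0 ?powR_ge0 ?expR_ge0.
    + by apply/measurable_EFinP; exact: measurable_gamma_integrand1.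
    + by apply: emeasurable_funD; apply/measurable_EFinP; exact: measurable_gamma_integrand1.
    + move=> t; rewrite /= in_itv/= andbT => t0.
      rewrite -EFinD lee_fin -mulrDl ler_wpM2r ?expR_ge0// subrr powRr0.
      have [t1|t1] := leP t 1.
        rewrite ler_wpDr ?powR_ge0//.
        rewrite [leRHS](_ : 1 = 1 `^ (u - 1)); last by rewrite powR1.
        by apply: ge0_ler_powR; rewrite ?nnegrE ?subr_ge0// ltW.
      rewrite ler_wpDl// ler_powR ?(ltW t1)// lerD2r.
      by apply: ltW; exact: truncnS_gt.
  - by move=> t _; rewrite lee_fin mulr_ge0 ?powR_ge0 ?expR_ge0.
  - by apply/measurable_EFinP; exact: measurable_gamma_integrand1.
  - by move=> t _; rewrite lee_fin mulr_ge0 ?powR_ge0 ?expR_ge0.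
  - by apply/measurable_EFinP; exact: measurable_gamma_integrand1.
move=> s0; have := big (s + 1); rewrite lerDr => /(_ (ltW s0)).
rewrite gammaeS// => h; rewrite ltNge leye_eq; apply/negP => /eqP h'.
by move: h; rewrite h' gt0_muley ?ltxx// lte_fin.
Qed.

Lemma Gamma_fine s : Gamma s = fine (gammae s).
Proof. by []. Qed.

Lemma gammaeE s : 0 < s -> gammae s = (Gamma s)%:E.
Proof.
by move=> s0; rewrite Gamma_fine fineK// (ge0_fin_numE (gammae_ge0 s)); exact: gammae_lty.
Qed.

Lemma GammaS s : 0 < s -> Gamma (s + 1) = s * Gamma s.
Proof.
move=> s0; apply: EFin_inj; rewrite -gammaeE ?addr_gt0// gammaeS// EFinM.
by rewrite gammaeE.
Qed.

Lemma Gamma_gt0 s : 0 < s -> 0 < Gamma s.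
Proof.
move=> s0; rewrite -lte_fin -gammaeE//.
pose c : R := expR (-1) * 1 `^ s / s.
apply: (@lt_le_trans _ _ (c%:E)).
  by rewrite lte_fin /c !mulr_gt0 ?expR_gt0 ?invr_gt0// powR_gt0.
rewrite /c -mulrA EFinM -integral_powR_segment// -ge0_integralZl_EFin ?expR_ge0//.
- rewrite /gammae integral_mkcond [leRHS]integral_mkcond.
  apply: ge0_le_integral => //.
  + by move=> x _; apply: erestrict_ge0 => t _; rewrite -EFinM lee_fin mulr_ge0 ?powR_ge0 ?expR_ge0.
  + apply: (measurable_restrictT _ _).1 => //; apply/measurable_EFinP.
    by apply: measurable_funM => //; apply: measurable_funTS; exact: measurable_powR.
  + apply: (measurable_restrictT _ _).1 => //; apply/measurable_EFinP.
    exact: measurable_gamma_integrand1.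
  + move=> x _; rewrite !patchE !mem_setE !in_itv/= andbT.
    case: (0 < x) => //=; case: ifP => x1; rewrite -?EFinM lee_fin ?mulr_ge0 ?powR_ge0 ?expR_ge0//.
    by rewrite mulrC ler_wpM2l ?powR_ge0// ler_expR lerN2.
- by move=> x _; rewrite lee_fin powR_ge0.
- by apply/measurable_EFinP; apply: measurable_funTS; exact: measurable_powR.
Qed.
End gamma_function.

(** * Radial integrals over a weighted cone *)

Section radial_integrals.
Context {R : realType} {n : nat} (W : set 'rV[R]_n) (w : 'rV[R]_n -> R) (g : R).
Context (cw : cone_weight W w g) (W0 : W !=set0).
Let D : R := n%:R + g.
Context (D0 : 0 < D).
Notation mu := (@lebesgue_measure R).
Implicit Types (a b c r t : R).

Lemma wint_dilate (phi : 'rV[R]_n -> R) c : 0 < c -> measurable_fun setT phi ->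
  (forall x, 0 <= phi x) ->
  (wint W w phi = (c `^ D)%:E * wint W w (fun x => phi (c *: x)%R))%E.
Proof.
move=> c0 mphi phi0.
have mW := cone_measurable cw.
have m1 : measurable_fun setT ((fun x => (phi x * w x)%:E) \_ W).
  by apply: (measurable_restrictT _ mW).1; exact: (measurable_wint cw (measurable_funTS mphi)).
have m10 x : (0 <= ((fun x => (phi x * w x)%:E) \_ W) x)%E.
  by apply: erestrict_ge0 => y Wy; rewrite lee_fin mulr_ge0// (cw_ge0 cw).
rewrite /wint [LHS]integral_mkcond [X in _ = (_ * X)%E]integral_mkcond.
rewrite (integral_rV_affine 0 (lt0r_neq0 c0) m1 m10) gtr0_norm//.
rewrite /D powRD ?(gt_eqF c0) ?implybT// powR_mulrn ?(ltW c0)// EFinM -muleA; congr (_ * _)%E.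
rewrite -ge0_integralZl_EFin ?powR_ge0//; last 2 first.
- by move=> x _; apply: erestrict_ge0 => y Wy; rewrite lee_fin mulr_ge0// (cw_ge0 cw).
- apply: (measurable_restrictT _ mW).1; apply: (measurable_wint cw); apply: measurable_funTS.
  apply: measurableT_comp mphi _.
  have := @measurable_rV_affine R n c 0.
  by congr (measurable_fun _ _); apply/funext => x; rewrite addr0.
apply: eq_integral => x _; rewrite addr0 !patchE.
have -> : (c *: x \in W) = (x \in W).
  apply/idP/idP; rewrite !inE; last exact: (cw_scale cw).
  have ci0 : 0 < c^-1 by rewrite invr_gt0.
  by move=> /(cw_scale cw ci0); rewrite scalerA mulVf ?gt_eqF// scale1r.
case: ifPn; last by rewrite mule0.
by move=> _; rewrite (cw_hom cw)// -EFinM mulrCA.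
Qed.

Definition sector_mass : \bar R := wint W w (fun x => if enorm x < 1 then 1 else 0).

Lemma measurable_ball_indicator r :
  measurable_fun setT (fun x : 'rV[R]_n => if enorm x < r then 1 else 0 : R).
Proof.
by apply: measurable_fun_if => //; apply: measurable_fun_ltr => //; exact: measurable_enorm.
Qed.

Lemma sector_mass_gt0 : (0 < sector_mass)%E.
Proof.
apply: (wint_gt0 cw (U := W `&` [set x | enorm x < 1])).
- exact: measurable_funTS (measurable_ball_indicator _).
- by move=> x _; case: ifP.
- apply: openI; first exact: (cw_open cw).
  apply: (@open_comp _ _ (enorm : 'rV[R]_n -> R) [set u | u < 1]); last exact: open_lt.
  by move=> x _; exact: enorm_continuous.
- have [x Wx] := W0.
  have x1 : 0 < (enorm x + 1)^-1 by rewrite invr_gt0 ltr_wpDl// enorm_ge0.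
  exists ((enorm x + 1)^-1 *: x); split; first exact: (cw_scale cw).
  by rewrite /= enormZ gtr0_norm// mulrC ltr_pdivrMr ?mul1r ?ltrDl// -invr_gt0.
- by move=> x [].
- by move=> x [_ /= ->].
Qed.

Lemma sector_mass_lty : (sector_mass < +oo)%E.
Proof.
apply: (wint_lty cw (B := 1) (r := 1)).
- exact: measurable_funTS (measurable_ball_indicator _).
- by move=> x _; case: ifP; rewrite ?ler01 ?lexx.
- by move=> x _ x1; rewrite ltNge (ltW x1).
Qed.

Let V := fine sector_mass.

Let VE : sector_mass = V%:E.
Proof. by rewrite fineK// (ge0_fin_numE (ltW sector_mass_gt0)); exact: sector_mass_lty. Qed.

Let V0 : 0 < V.
Proof. by rewrite /V fine_gt0// sector_mass_gt0 sector_mass_lty. Qed.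

Lemma sector_mass_dilate r : 0 < r ->
  wint W w (fun x => if enorm x < r then 1 else 0) = (r `^ D * V)%:E.
Proof.
move=> r0; rewrite (wint_dilate r0) ?EFinM -?VE; last 2 first.
- exact: measurable_ball_indicator.
- by move=> x; case: ifP.
congr (_ * _)%E; apply: eq_wint => x _.
by rewrite enormZ gtr0_norm// gtr_pMr.
Qed.

Let I : set R := `]0, +oo[%classic.
Let mI : measurable I. Proof. exact: measurable_itv. Qed.

Lemma measurable_enorm_powR c (U : set 'rV[R]_n) : measurable_fun U (fun x => enorm x `^ c).
Proof.
by apply: measurable_funTS; apply: (measurableT_comp (measurable_powR _)); exact: measurable_enorm.
Qed.

(** Slicing [expR (- u)] as the integral of [expR (- t)] over [t > u] reduces the
integral to masses of ball sectors. *)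
Lemma wint_exp_power a c : 0 < a -> 0 < c ->
  wint W w (fun x => expR (- (a * enorm x `^ c))) = (V * a `^ (- (D / c)) * Gamma (D / c + 1))%:E.
Proof.
move=> a0 c0; have mW := cone_measurable cw.
have Dc : 0 < D / c by exact: divr_gt0.
pose f (z : 'rV[R]_n * measurableTypeR R) : R :=
  if a * enorm z.1 `^ c < z.2 then `|w z.1| * expR (- z.2) else 0.
have f0 z : 0 <= f z by rewrite /f; case: ifP => // _; rewrite mulr_ge0 ?expR_ge0.
have mf : measurable_fun setT f.
  apply: measurable_fun_if => //.
    apply: measurable_fun_ltr => //.
    apply: measurable_funM => //.
    by apply: (measurableT_comp (measurable_powR _)); exact: (measurableT_comp measurable_enorm).
  apply: measurable_funTS; apply: measurable_funM.
    apply: (measurableT_comp (@normr_measurable R _)).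
    exact: (measurableT_comp (cw_meas cw)).
  apply: (measurableT_comp (@measurable_expR R)).
  exact: measurable_funN.
have E1 x : W x -> (\int[mu]_(t in I) (f (x, t))%:E = (expR (- (a * enorm x `^ c)) * w x)%:E)%E.
  move=> Wx; rewrite mulrC EFinM -integral_expRN -ge0_integralZl_EFin ?(cw_ge0 cw)//.
  - rewrite [LHS]integral_mkcond [RHS]integral_mkcond; congr (integral _ _ _).
    apply/funext => t; rewrite !patchE /f /= !mem_setE /I !in_itv/= !andbT.
    have [xt|xt] := ltP (a * enorm x `^ c) t; last by case: ifP.
    rewrite (le_lt_trans _ xt) ?ger0_norm ?(cw_ge0 cw)//.
    by rewrite mulr_ge0 ?powR_ge0// ltW.
  - apply/measurable_EFinP; apply: measurable_funTS.
    exact: (measurableT_comp (@measurable_expR R)).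
have E2 t : 0 < t -> (\int[lebesgue_rV n]_(x in W) (f (x, t))%:E =
    (V * a `^ (- (D / c)))%:E * (t `^ (D / c + 1 - 1) * expR (- t))%:E)%E.
  move=> t0.
  have r0 : 0 < (t / a) `^ c^-1 by rewrite powR_gt0// divr_gt0.
  transitivity ((expR (- t))%:E * wint W w (fun x => if enorm x < (t / a) `^ c^-1 then 1 else 0)%R)%E.
    rewrite -(wintZ cw); last 3 first.
    - exact: measurable_funTS (measurable_ball_indicator _).
    - exact: expR_ge0.
    - by move=> x _; case: ifP.
    apply: eq_integral => x; rewrite inE => Wx; rewrite /f /=.
    have -> : (a * enorm x `^ c < t) = (enorm x < (t / a) `^ c^-1).
      rewrite mulrC -ltr_pdivlMr//.
      rewrite -[X in _ = (X < _)](powRr1 (enorm_ge0 x)) -(mulfV (lt0r_neq0 c0)) powRrM.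
      apply/idP/idP => h.
        by apply: gt0_ltr_powR; rewrite ?nnegrE ?powR_ge0 ?invr_gt0// divr_ge0 ?ltW.
      rewrite ltNge; apply/negP => h'; move: h; rewrite ltNge => /negP; apply.
      by apply: ge0_ler_powR; rewrite ?nnegrE ?powR_ge0 ?invr_ge0 ?(ltW c0)// divr_ge0 ?ltW.
    case: ifP => _; last by rewrite mulr0 mul0r.
    by rewrite mulr1 ger0_norm ?(cw_ge0 cw)// mulrC.
  rewrite sector_mass_dilate// -!EFinM; congr EFin.
  rewrite addrK -powRrM (mulrC c^-1) powRM ?(ltW t0) ?invr_ge0 ?(ltW a0)//.
  rewrite -(powR_inv1 (ltW a0)) -powRrM mulN1r; ring.
have := @tonelli_rectangle _ _ _ _ R (lebesgue_rV n) mu W I (EFin \o f) mW mI.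
move=> /(_ ((measurable_EFinP _ _).2 mf)).
move=> /(_ (fun z => f0 z : (0 <= (EFin \o f) z)%E)) T.
transitivity (\int[lebesgue_rV n]_(x in W) \int[mu]_(t in I) (f (x, t))%:E)%E.
  by apply: eq_integral => x; rewrite inE => Wx; rewrite E1.
rewrite T EFinM -gammaeE ?addr_gt0// /gammae -ge0_integralZl_EFin//.
- apply: eq_integral => t; rewrite inE /I/= in_itv/= andbT => t0.
  by rewrite -E2.
- by move=> x _; rewrite lee_fin mulr_ge0 ?powR_ge0 ?expR_ge0.
- by apply/measurable_EFinP; exact: measurable_gamma_integrand1.
- by rewrite mulr_ge0 ?powR_ge0// ltW.
Qed.

(** Writing [s ^ - b] as a Laplace transform turns the power weight into the
exponential one. *)
Lemma wint_inverse_power b c : 0 < c -> D / c < b ->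
  wint W w (fun x => (1 + enorm x `^ c) `^ (- b)) =
  (V * Gamma (D / c + 1) * Gamma (b - D / c) / Gamma b)%:E.
Proof.
move=> c0 bD; have mW := cone_measurable cw.
have Dc : 0 < D / c by exact: divr_gt0.
have b0 : 0 < b by exact: lt_trans bD.
have s0 x : 0 < 1 + enorm (x : 'rV[R]_n) `^ c by rewrite ltr_wpDr// powR_ge0.
pose f (z : 'rV[R]_n * measurableTypeR R) : R :=
  `|w z.1| * (z.2 `^ (b - 1) * expR (- ((1 + enorm z.1 `^ c) * z.2))).
have f0 z : 0 <= f z by rewrite /f !mulr_ge0 ?powR_ge0 ?expR_ge0.
have mf : measurable_fun setT f.
  apply: measurable_funM.
    apply: (measurableT_comp (@normr_measurable R _)).
    exact: (measurableT_comp (cw_meas cw)).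
  apply: measurable_funM; first by apply: (measurableT_comp (measurable_powR _)).
  apply: (measurableT_comp (@measurable_expR R)); apply: measurable_funN.
  apply: measurable_funM => //; apply: measurable_funD => //.
  by apply: (measurableT_comp (measurable_powR _)); exact: (measurableT_comp measurable_enorm).
have G0 := Gamma_gt0 b0.
have E1 x : W x -> (\int[mu]_(t in I) (f (x, t))%:E =
    (Gamma b)%:E * ((1 + enorm x `^ c) `^ (- b) * w x)%:E)%E.
  move=> Wx.
  transitivity ((w x)%:E * \int[mu]_(t in I) (t `^ (b - 1) * expR (- ((1 + enorm x `^ c) * t)))%:E)%E.
    rewrite -ge0_integralZl_EFin ?(cw_ge0 cw)//.
    - by apply: eq_integral => t _; rewrite /f /= ger0_norm ?(cw_ge0 cw)// EFinM.
    - by move=> t _; rewrite lee_fin mulr_ge0 ?powR_ge0 ?expR_ge0.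
    - by apply/measurable_EFinP; exact: measurable_gamma_integrand.
  by rewrite gammae_scale// gammaeE// -!EFinM; congr EFin; ring.
have E2 t : 0 < t -> (\int[lebesgue_rV n]_(x in W) (f (x, t))%:E =
    (V * Gamma (D / c + 1))%:E * (t `^ (b - D / c - 1) * expR (- t))%:E)%E.
  move=> t0.
  transitivity ((t `^ (b - 1) * expR (- t))%:E *
     wint W w (fun x => expR (- (t * enorm x `^ c)))%R)%E.
    rewrite -(wintZ cw).
    - apply: eq_integral => x; rewrite inE => Wx; rewrite /f /= ger0_norm ?(cw_ge0 cw)//.
      by rewrite mulrDl mul1r opprD expRD (mulrC t); congr EFin; ring.
    - apply: (measurableT_comp (@measurable_expR R)); apply: measurable_funN.
      by apply: measurable_funM => //; exact: measurable_enorm_powR.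
    - by rewrite mulr_ge0 ?powR_ge0 ?expR_ge0.
    - by move=> x _; exact: expR_ge0.
  rewrite wint_exp_power// -!EFinM; congr EFin.
  have -> : b - D / c - 1 = (b - 1) + (- (D / c)) by ring.
  have -> : t `^ ((b - 1) + (- (D / c))) = t `^ (b - 1) * t `^ (- (D / c)).
    by rewrite powRD// (gt_eqF t0) implybT.
  ring.
have := @tonelli_rectangle _ _ _ _ R (lebesgue_rV n) mu W I (EFin \o f) mW mI.
move=> /(_ ((measurable_EFinP _ _).2 mf)).
move=> /(_ (fun z => f0 z : (0 <= (EFin \o f) z)%E)) T.
have mm : measurable_fun W (fun x => (1 + enorm x `^ c) `^ (- b)).
  apply: (measurableT_comp (measurable_powR _)); apply: measurable_funD => //.
  exact: measurable_enorm_powR.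
have GV : ((Gamma b)%:E * wint W w (fun x => (1 + enorm x `^ c) `^ (- b))%R =
    (V * Gamma (D / c + 1) * Gamma (b - D / c))%:E)%E.
  transitivity (\int[lebesgue_rV n]_(x in W) \int[mu]_(t in I) (f (x, t))%:E)%E.
    rewrite -(wintZ cw) ?(ltW G0)//; last by move=> x _; exact: powR_ge0.
    by apply: eq_integral => x; rewrite inE => Wx; rewrite E1// -EFinM mulrA.
  have bDc : 0 < b - D / c by rewrite subr_gt0.
  rewrite T EFinM -(gammaeE bDc) /gammae -ge0_integralZl_EFin//.
  - apply: eq_integral => t; rewrite inE /I/= in_itv/= andbT => t0.
    by rewrite -E2.
  - by move=> x _; rewrite lee_fin mulr_ge0 ?powR_ge0 ?expR_ge0.
  - by apply/measurable_EFinP; exact: measurable_gamma_integrand1.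
  - by rewrite mulr_ge0 ?ltW// Gamma_gt0// addr_gt0.
rewrite mulrC EFinM -GV muleA -EFinM mulVf ?mul1e//.
by rewrite gt_eqF.
Qed.
End radial_integrals.

(** * The sharp constant of a weighted cone *)

Lemma lnM_gt0 (R : realType) (x y : R) : 0 < x -> 0 < y -> ln (x * y) = ln x + ln y.
Proof. by move=> x0 y0; rewrite lnM ?posrE. Qed.

Lemma lnV_gt0 (R : realType) (x : R) : 0 < x -> ln x^-1 = - ln x.
Proof. by move=> x0; rewrite lnV ?posrE. Qed.

(** Identities between products of real powers are proved on logarithms, where
they are linear. *)
Ltac positivity := repeat match goal with
  | H : is_true (0 < ?x) |- is_true (0 < ?x) => exact: H
  | |- is_true (0 < _ * _) => apply: mulr_gt0
  | |- is_true (0 < _^-1) => rewrite invr_gt0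
  | |- is_true (0 < _ `^ _) => apply: powR_gt0
  end.

Ltac expand_ln := repeat match goal with
  | |- context [ln (?x * ?y)] =>
    rewrite (@lnM_gt0 _ x y ltac:(positivity) ltac:(positivity))
  | |- context [ln (?x^-1)] => rewrite (@lnV_gt0 _ x ltac:(positivity))
  | |- context [ln (?x `^ ?y)] => rewrite (ln_powR x y)
  end.

Lemma ler_ln_gt0 (R : realType) (x y : R) : 0 < x -> 0 < y -> (ln x <= ln y) = (x <= y).
Proof. by move=> x0 y0; rewrite ler_ln ?posrE. Qed.

(** Solves the limit of [sobolev_truncated], with its parameters expressed by [D] and
[p], for the norm of the function. *)
Lemma sobolev_rearrange (R : realType) (D p p' J Q P : R) :
  0 < J -> 0 <= Q -> 0 <= P -> 1 < p -> p < D -> p' = p / (p - 1) ->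
  ((D - 1) * Q / ((D - p) / D)) `^ ((D - p) / D) *
    (J * ((D - 1) * p / (D - p)) / (p / D)) `^ (p / D) <=
    (D - 1) * ((p' - 1) * (p / (D - p) / p') `^ p) * P ->
  Q `^ (p * D / (D - p))^-1 <=
    D `^ (- p^-1) * ((p - 1) / (D - p)) `^ p'^-1 * J `^ (- D^-1) * P `^ p^-1.
Proof.
move=> J0 Q0 P0 p1 pD p'E main.
have p0 : 0 < p by exact: lt_trans p1.
have D0 : 0 < D by exact: lt_trans pD.
have p10 : 0 < p - 1 by rewrite subr_gt0.
have Dp0 : 0 < D - p by rewrite subr_gt0.
have D10 : 0 < D - 1 by rewrite subr_gt0 (lt_trans p1).
have p'0 : 0 < p' by rewrite p'E; positivity.
have p'1E : p' - 1 = (p - 1)^-1 by rewrite p'E; field; rewrite gt_eqF.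
have p'10 : 0 < p' - 1 by rewrite p'1E; positivity.
have [Qz|Qnz] := eqVneq Q 0.
  rewrite Qz powR0; last by rewrite gt_eqF//; positivity.
  by rewrite !mulr_ge0 ?powR_ge0.
have {Qnz}Qp : 0 < Q by rewrite lt0r Qnz Q0.
have K0 : 0 < (D - 1) * ((p' - 1) * (p / (D - p) / p') `^ p) by positivity.
have Pp : 0 < P.
  by rewrite -(pmulr_rgt0 _ K0); apply: lt_le_trans main; positivity.
rewrite -ler_ln_gt0; [|by positivity..].
move: main; rewrite -ler_ln_gt0; [|by positivity..].
rewrite p'1E; expand_ln.
have -> : ln p' = ln p - ln (p - 1) by rewrite p'E; expand_ln.
rewrite p'E => main.
rewrite -subr_ge0 -(pmulr_rge0 _ p0).
move: main; rewrite -subr_ge0; congr (0 <= _).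
by field; rewrite !gt_eqF.
Qed.

Section sharp_constant.
Context {R : realType} {n : nat} (W : set 'rV[R]_n.+1) (w : 'rV[R]_n.+1 -> R) (g : R).
Context (cw : cone_weight W w g) (W0 : W !=set0).
Context (D : R) (DE : D = n.+1%:R + g).
Context (p p' : R) (p1 : 1 < p) (pD : p < D) (pp' : p^-1 + p'^-1 = 1).
Let q := p * D / (D - p).
Local Notation Fpow f r := (fun x => (f x `^ r)%R).

Let p0 : 0 < p. Proof. exact: lt_trans p1. Qed.
Let Dp0 : 0 < D - p. Proof. by rewrite subr_gt0. Qed.
Let D1 : 1 < D. Proof. exact: lt_trans pD. Qed.
Let D0 : 0 < D. Proof. exact: lt_trans D1. Qed.
Let p1' : 0 < p - 1. Proof. by rewrite subr_gt0. Qed.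
Let D1' : 0 < D - 1. Proof. by rewrite subr_gt0. Qed.
Let degree0 : 0 < n.+1%:R + g. Proof. by rewrite -DE. Qed.

Lemma conjugate_exponentE : p' = p / (p - 1).
Proof.
have : p'^-1 = (p - 1) / p.
  by rewrite mulrBl mul1r mulfV ?gt_eqF// -pp'; ring.
by move=> /(congr1 GRing.inv); rewrite invrK invfM invrK mulrC.
Qed.

Let p'0 : 0 < p'. Proof. by rewrite conjugate_exponentE divr_gt0. Qed.

(** The mass of the [q]-th power of the extremal profile. *)
Definition extremal_mass : R :=
  fine (wint W w (fun x => (1 + enorm x `^ p') `^ (- D))).

Let Dp'E : D / p' = D - D / p.
Proof. by rewrite conjugate_exponentE; field; rewrite !gt_eqF. Qed.

Let Dp'lt : D / p' < D - 1.
Proof. by rewrite Dp'E ltrD2l ltrN2 ltr_pdivlMr// mul1r. Qed.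

Let Dp'ltD : D / p' < D.
Proof. by apply: lt_trans Dp'lt _; rewrite gtrDl ltrN10. Qed.

Lemma extremal_massE : extremal_mass =
  fine (sector_mass W w) * Gamma (D / p' + 1) * Gamma (D / p) / Gamma D.
Proof.
have := wint_inverse_power cw W0 degree0 (b := D) p'0.
rewrite -DE => /(_ Dp'ltD) E; rewrite /extremal_mass E /=.
by rewrite (_ : D - D / p' = D / p)// Dp'E opprB addrC subrK.
Qed.

Lemma wint_extremal : wint W w (fun x => (1 + enorm x `^ p') `^ (- D)) = extremal_mass%:E.
Proof.
have := wint_inverse_power cw W0 degree0 (b := D) p'0.
by rewrite -DE => /(_ Dp'ltD) E; rewrite /extremal_mass E.
Qed.

Let sector_gt0 : 0 < fine (sector_mass W w).
Proof. by rewrite fine_gt0// (sector_mass_gt0 cw W0) (sector_mass_lty cw). Qed.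

Lemma extremal_mass_gt0 : 0 < extremal_mass.
Proof.
have Dp : 0 < D / p by exact: divr_gt0.
have Dp' : 0 < D / p' + 1 by rewrite addr_gt0// divr_gt0.
have := (Gamma_gt0 Dp, Gamma_gt0 Dp', Gamma_gt0 D0) => -[[G1 G2] G3].
by rewrite extremal_massE; positivity.
Qed.

Lemma wint_model :
  wint W w (fun x => (1 + enorm x `^ p') `^ (- (D - 1))) =
  (extremal_mass * ((D - 1) * p / (D - p)))%:E.
Proof.
have := wint_inverse_power cw W0 degree0 (b := D - 1) p'0.
rewrite -DE => /(_ Dp'lt) ->; rewrite extremal_massE; congr EFin.
have Dp1 : 0 < D / p - 1 by rewrite subr_gt0 ltr_pdivlMr// mul1r.
have -> : D - 1 - D / p' = D / p - 1 by rewrite Dp'E; ring.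
have -> : Gamma (D / p) = (D / p - 1) * Gamma (D / p - 1) by rewrite -GammaS// subrK.
have -> : Gamma D = (D - 1) * Gamma (D - 1) by rewrite -GammaS// subrK.
have := Gamma_gt0 D1'; set GD := Gamma (D - 1) => GD0.
by field; rewrite !gt_eqF.
Qed.

(** Write $|x|^{p'}$ as $(1+|x|^{p'}) - 1$. *)
Lemma wint_extremal_slope :
  wint W w (fun x => enorm x `^ p' * (1 + enorm x `^ p') `^ (- D)) =
  (extremal_mass * (D * (p - 1) / (D - p)))%:E.
Proof.
have m1 r : measurable_fun W (fun x : 'rV[R]_n.+1 => (1 + enorm x `^ p') `^ r).
  apply: (measurableT_comp (measurable_powR _)); apply: measurable_funD => //.
  exact: measurable_enorm_powR.
have s0 (x : 'rV[R]_n.+1) : 0 < 1 + enorm x `^ p' by rewrite ltr_wpDr// powR_ge0.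
have : wint W w (fun x => (1 + enorm x `^ p') `^ (- (D - 1))) =
    (wint W w (fun x => (1 + enorm x `^ p') `^ (- D))%R +
     wint W w (fun x => enorm x `^ p' * (1 + enorm x `^ p') `^ (- D))%R)%E.
  rewrite -(wintD cw) => //.
  - apply: eq_wint => x _; set s := 1 + _.
    rewrite opprB addrC powRD; last by rewrite (gt_eqF (s0 x)) implybT.
    by rewrite powRr1 ?(ltW (s0 x))// mulrC {1}/s mulrDl mul1r.
  - by apply: measurable_funM => //; exact: measurable_enorm_powR.
  - by move=> x _; exact: powR_ge0.
  - by move=> x _; rewrite mulr_ge0 ?powR_ge0.
rewrite wint_model wint_extremal.
case: (wint W w (fun x => enorm x `^ p' * _)) => [r| |]//; rewrite -EFinD => -[h].
congr EFin; apply: (addrI extremal_mass); rewrite -h; field.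
by rewrite gt_eqF.
Qed.

Definition sharp_constant : R :=
  D `^ (- p^-1) * ((p - 1) / (D - p)) `^ p'^-1 * extremal_mass `^ (- D^-1).

Lemma sharp_constant_gt0 : 0 < sharp_constant.
Proof. by have J0 := extremal_mass_gt0; rewrite /sharp_constant; positivity. Qed.

Lemma ln_sharp_constant : ln sharp_constant =
  - p^-1 * ln D + p'^-1 * (ln (p - 1) - ln (D - p)) - D^-1 * ln extremal_mass.
Proof.
by have J0 := extremal_mass_gt0; rewrite /sharp_constant; expand_ln; ring.
Qed.

(** Equality for the extremal profile $u(x) = (1+|x|^{p'})^{-(D-p)/p}$: the last
factor on the right is the $L^p$ norm of $\nabla u$, and the left side is the $L^q$
norm of $u$. *)
Lemma sharp_constant_attained :
  extremal_mass `^ q^-1 = sharp_constant *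
    (((D - p) / (p - 1)) `^ p * (extremal_mass * (D * (p - 1) / (D - p)))) `^ p^-1.
Proof.
have J0 := extremal_mass_gt0; have C0 := sharp_constant_gt0.
apply: ln_inj; rewrite ?posrE; [by positivity..|].
expand_ln; rewrite ln_sharp_constant conjugate_exponentE /q.
by field; rewrite !gt_eqF.
Qed.

(** The limit of [sobolev_truncated] as the radius of the truncation tends to infinity. *)
Lemma cone_sobolev (F G : 'rV[R]_n.+1 -> R) (rho M L : R) : profile W F G rho M L ->
  fine (wint W w (Fpow F q)) `^ q^-1 <= sharp_constant * fine (wint W w (Fpow G p)) `^ p^-1.
Proof.
move=> pf.
pose k := p / (D - p); pose e := n%:R + g.
have eE : e = D - 1 by rewrite /e DE -natr1; ring.
have e0 : 0 < e by rewrite eE.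
have k0 : 0 < k by exact: divr_gt0.
have kE : (k + 1) * p = k * (e + 1) by rewrite eE /k; field; rewrite gt_eqF.
have qE : k * (e + 1) = q by rewrite eE /k /q; field; rewrite gt_eqF.
have tE : p / q = (D - p) / D by rewrite /q; field; rewrite !gt_eqF.
have t0 : 0 < (D - p) / D by exact: divr_gt0.
have t1E : 1 - (D - p) / D = p / D by field; rewrite gt_eqF.
have q0 : 0 < q by rewrite divr_gt0// mulr_gt0.
have J0 := extremal_mass_gt0.
set Q := fine (wint W w (Fpow F q)); set P := fine (wint W w (Fpow G p)).
have Q0 : 0 <= Q by apply/fine_ge0/(wint_ge0 cw) => x _; exact: powR_ge0.
have P0 : 0 <= P by apply/fine_ge0/(wint_ge0 cw) => x _; exact: powR_ge0.
pose K := e * ((p' - 1) * (k / p') `^ p).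
pose I_ (m : nat) := fine (wint W w (truncated_model (n := n) g p' m.+1%:R)).
pose I := extremal_mass * ((D - 1) * p / (D - p)).
have I0 : 0 < I by rewrite /I; positivity.
have Im m : (e * Q / ((D - p) / D)) `^ ((D - p) / D) * (I_ m / (p / D)) `^ (p / D) <= K * P.
  have := sobolev_truncated cw W0 k0 e0 p1 pp' kE pf (ltr0Sn R m).
  by rewrite -/e qE tE t1E.
have cvI : I_ m @[m --> \oo] --> I.
  suff : (wint W w (truncated_model (n := n) g p' m.+1%:R) @[m --> \oo] --> I%:E)%E.
    exact: fine_cvg.
  rewrite /I -wint_model.
  have mmodel : measurable_fun W (fun x : 'rV[R]_n.+1 => (1 + enorm x `^ p') `^ (- (D - 1))).
    apply: (measurableT_comp (measurable_powR _)); apply: measurable_funD => //.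
    exact: measurable_enorm_powR.
  apply: (wint_dominated cw (dom := fun x => (1 + enorm x `^ p') `^ (- (D - 1)))) => //.
  - by move=> m; exact: measurable_funTS (measurable_truncated_model _ _ _).
  - by rewrite wint_model ltry.
  - move=> m x _; rewrite truncated_model_ge0/= /truncated_model /model -/e -eE.
    by case: ifP => // _; exact: powR_ge0.
  - move=> x _; apply: cvg_near_cst.
    near=> m; rewrite /truncated_model /model -/e -eE ifT//.
    apply: lt_trans (truncnS_gt (enorm x)) _; rewrite ltr_nat ltnS.
    by near: m; exact: nbhs_infty_gt.
have main : (e * Q / ((D - p) / D)) `^ ((D - p) / D) * (I / (p / D)) `^ (p / D) <= K * P.
  set A := (e * Q / ((D - p) / D)) `^ ((D - p) / D) in Im *.
  have cv : A * (I_ m / (p / D)) `^ (p / D) @[m --> \oo] --> A * (I / (p / D)) `^ (p / D).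
    apply: cvgM; first exact: cvg_cst.
    have ct : {for I, continuous (fun u : R => (u / (p / D)) `^ (p / D))}.
      apply: (@continuous_comp _ _ _ (fun u : R => u / (p / D)) (fun v => v `^ (p / D))).
        by apply: continuousM; [exact: id|exact: cst_continuous].
      by apply: powR_continuous_at; positivity.
    exact: (cvg_comp _ _ cvI ct).
  by apply: (closed_cvg (fun y => y <= K * P)) cv => //; first [exact: closed_le|exact: nearW].
rewrite /sharp_constant; apply: sobolev_rearrange => //; first exact: conjugate_exponentE.
by move: main; rewrite /K /I /k eE.
Unshelve. all: by end_near.
Qed.
End sharp_constant.

(** * Chambers as weighted cones, test functions as profiles *)

Section root_weight.
Context {R : realType} {n : nat}.
Implicit Types (s : seq 'rV[R]_n) (eps k : 'rV[R]_n -> R) (x y : 'rV[R]_n).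

Definition cone_of s eps := [set x | forall a, a \in s -> 0 < eps a * dotp a x].

Definition weight_of s k x : R := \prod_(a <- s) `|dotp a x| `^ (2 * k a).

Definition degree_of s k : R := \sum_(a <- s) 2 * k a.

Lemma open_cone_of s eps : open (cone_of s eps).
Proof.
elim: s => [|a s IH].
  rewrite (_ : cone_of _ _ = setT); first exact: openT.
  by apply/seteqP; split.
rewrite (_ : cone_of _ _ = [set x | 0 < eps a * dotp a x] `&` cone_of s eps); last first.
  apply/seteqP; split => x.
    by move=> h; split => [|b bs]; apply: h; rewrite inE ?eqxx// bs orbT.
  by move=> [h1 h2] b; rewrite inE => /orP[/eqP->//|]; exact: h2.
apply: openI => //.
apply: (@open_comp _ _ (fun x : 'rV[R]_n => eps a * dotp a x) [set u | 0 < u]); last exact: open_gt.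
move=> x _; apply: continuousM; first exact: cst_continuous.
exact: dotp_continuous.
Qed.

(** On the cone each $|\langle a, x\rangle|$ is additive in [x], so that [bbl_weight]
takes care of one factor at a time. *)
Lemma bbl_weight_of s eps k e (a b h : \bar R) x y :
  (forall v, v \in s -> 0 <= k v) -> (forall v, v \in s -> `|eps v| = 1) ->
  degree_of s k <= e -> cone_of s eps x -> cone_of s eps y -> bbl e a b h ->
  bbl (e - degree_of s k) (a * (weight_of s k x)%:E) (b * (weight_of s k y)%:E)
    (h * (weight_of s k (x + y))%:E).
Proof.
rewrite /weight_of /degree_of.
elim: s e a b h => [|v s IH] e a b h k0 eps1 se Wx Wy abh.
  by rewrite !big_nil subr0 !mule1.
have vin : v \in v :: s by rewrite inE eqxx.
have sin u : u \in s -> u \in v :: s by rewrite inE => ->; rewrite orbT.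
have S0 : 0 <= \sum_(j <- s) 2 * k j.
  by rewrite big_seq; apply: sumr_ge0 => u us; rewrite mulr_ge0// k0// sin.
have absE z : cone_of (v :: s) eps z -> `|dotp v z| = eps v * dotp v z.
  by move=> /(_ v vin) h0; rewrite -[LHS]mul1r -(eps1 v vin) -normrM gtr0_norm.
rewrite !big_cons opprD addrA !EFinM !muleA.
rewrite big_cons in se.
apply: IH => //.
- by move=> u us; rewrite k0// sin.
- by move=> u us; rewrite eps1// sin.
- by rewrite lerBrDl.
- by move=> u us; apply: Wx; exact: sin.
- by move=> u us; apply: Wy; exact: sin.
have -> : `|dotp v (x + y)| = `|dotp v x| + `|dotp v y|.
  rewrite absE; last by move=> u us; rewrite dotpDr mulrDr addr_gt0 ?Wx ?Wy.
  by rewrite !absE// dotpDr mulrDr.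
apply: bbl_weight => //.
- by rewrite mulr_ge0 ?k0//=; apply: le_trans se; rewrite lerDl.
- by rewrite absE// Wx.
- by rewrite absE// Wy.
Qed.

Lemma cone_weight_of s eps k :
  (forall v, v \in s -> 0 <= k v) -> (forall v, v \in s -> `|eps v| = 1) ->
  cone_weight (cone_of s eps) (weight_of s k) (degree_of s k).
Proof.
move=> k0 eps1; split.
- by rewrite /degree_of big_seq; apply: sumr_ge0 => u us; rewrite mulr_ge0// k0.
- exact: open_cone_of.
- by move=> x y Wx Wy u us; rewrite dotpDr mulrDr addr_gt0 ?Wx ?Wy.
- by move=> c x c0 Wx u us; rewrite dotpZr mulrCA mulr_gt0// Wx.
- by move=> x; apply: prodr_ge0 => u _; exact: powR_ge0.
- move=> x Wx; rewrite /weight_of big_seq; apply: prodr_gt0 => u us.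
  rewrite powR_gt0// normr_gt0; apply/eqP => u0.
  by have := Wx u us; rewrite u0 mulr0 ltxx.
- move=> c x c0; rewrite /weight_of /degree_of; elim: (s) => [|u t IH].
    by rewrite !big_nil powRr0 mul1r.
  rewrite !big_cons IH powRD; last by rewrite (gt_eqF c0) implybT.
  rewrite dotpZr normrM gtr0_norm//.
  by rewrite powRM ?normr_ge0 ?(ltW c0)//; ring.
- rewrite /weight_of; elim: (s) => [|u t IH].
    under eq_fun do rewrite big_nil; exact: measurable_cst.
  under eq_fun do rewrite big_cons.
  apply: measurable_funM => //; apply: (measurableT_comp (measurable_powR _)).
  apply: (measurableT_comp (@normr_measurable R _)); exact: measurable_dotp.
- move=> r; exists (\prod_(u <- s) (enorm u * `|r|) `^ (2 * k u)) => x xr.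
  rewrite /weight_of big_seq [leRHS]big_seq; apply: ler_prod => u us.
  rewrite powR_ge0/=; apply: ge0_ler_powR; rewrite ?nnegrE ?mulr_ge0 ?enorm_ge0 ?k0//.
  apply: (le_trans (cauchy_schwarz _ _)); rewrite ler_wpM2l ?enorm_ge0//.
  by apply: (le_trans xr); exact: ler_norm.
- by move=> e a b h x y se Wx Wy; exact: (bbl_weight_of k0 eps1).
Qed.
End root_weight.

Section chamber.
Context {R : realType} {N : nat} (Phip : {fset 'rV[R]_N}) (k eps : 'rV[R]_N -> R).

Lemma signed_chamberE : (forall a, a \in Phip -> eps a = -1 \/ eps a = 1) ->
  signed_chamber Phip eps = cone_of Phip eps.
Proof.
move=> e1; apply/seteqP; split => x H a aP; have := H a aP; have := e1 a aP.
  move=> [] -> /eqP; rewrite sgr_cp0; first by rewrite mulN1r oppr_gt0.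
  by rewrite mul1r.
move=> [] ->; rewrite ?mulN1r ?mul1r ?oppr_gt0 => h; apply/eqP; by rewrite sgr_cp0.
Qed.

Lemma signed_chamber_cone_weight :
  (forall a, a \in Phip -> eps a = -1 \/ eps a = 1) ->
  (forall a, a \in Phip -> 0 <= k a) ->
  cone_weight (signed_chamber Phip eps) (w_k Phip k) (2 * gamma_k Phip k).
Proof.
move=> e1 k0; rewrite signed_chamberE// /gamma_k mulr_sumr.
apply: cone_weight_of => // a /e1[] ->; by rewrite ?normrN normr1.
Qed.
End chamber.

Lemma weyl_chamber_neq0 (R : realType) N (Phi : {fset 'rV[R]_N}) W :
  weyl_chamber Phi W -> W !=set0.
Proof.
by move=> [x hx ->]; exists x; exact: connected_component_refl.
Qed.

Section gradient.
Context {R : realType} {n : nat}.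
Implicit Types (f : 'rV[R]_n.+1 -> R) (x y v z : 'rV[R]_n.+1).

Lemma differential_grad f x v : differentiable f x -> 'd f x v = dotp (grad f x) v.
Proof.
move=> df; rewrite {1}(row_sum_delta v) linear_sum /dotp; apply: eq_bigr => i _.
by rewrite linearZ /= mxE deriveE// mulrC.
Qed.

Lemma derive_segment f y v (t : R) : differentiable f (y + t *: v) ->
  is_derive t 1 (fun u : R => f (y + u *: v)) (dotp (grad f (y + t *: v)) v).
Proof.
move=> df; have dv := @diff_derivable _ _ _ _ _ v df.
have E : (fun h : R => h^-1 *: ((((fun u : R => f (y + u *: v)) \o shift t) (h *: 1)) -
    f (y + t *: v))) =
    (fun h : R => h^-1 *: ((f \o shift (y + t *: v)) (h *: v) - f (y + t *: v))).
  apply/funext => h /=; congr (_ *: (f _ - _)).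
  have -> : h%:A = h :> R by rewrite /GRing.scale/= mulr1.
  by rewrite scalerDl addrCA.
apply: DeriveDef; first by rewrite /derivable E.
by rewrite /derive E -differential_grad// -deriveE.
Qed.

Lemma mean_value_segment f x y (B : R) :
  (forall t : R, 0 <= t <= 1 -> differentiable f (y + t *: (x - y))) ->
  (forall t : R, 0 <= t <= 1 -> enorm (grad f (y + t *: (x - y))) <= B) ->
  `|f x - f y| <= B * enorm (x - y).
Proof.
move=> df gB; pose phi (u : R) := f (y + u *: (x - y)).
have dphi (t : R) : t \in `]0, 1[ -> is_derive t 1 phi (dotp (grad f (y + t *: (x - y))) (x - y)).
  by rewrite in_itv/= => /andP[t0 t1]; apply: derive_segment; apply: df; rewrite !ltW.
have cphi : {within `[0, 1], continuous phi}.
  apply: derivable_within_continuous => t; rewrite in_itv/= => t01.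
  by have /derive_segment[] := df t t01.
have [c c01] := MVT ltr01 dphi cphi.
rewrite /phi scale1r scale0r addr0 subrKC subr0 mulr1 => ->.
apply: (le_trans (cauchy_schwarz _ _)); rewrite ler_wpM2r ?enorm_ge0//.
by apply: gB; move: c01; rewrite in_itv/= => /andP[h1 h2]; rewrite !ltW.
Qed.

End gradient.

Section test_functions.
Context {R : realType} {n : nat} (W : set 'rV[R]_n.+1) (w : 'rV[R]_n.+1 -> R) (g : R).
Context (cw : cone_weight W w g).

Lemma cone_segment x y (t : R) : W x -> W y -> 0 <= t <= 1 -> W (y + t *: (x - y)).
Proof.
move=> Wx Wy /andP[t0 t1].
have [->|tn0] := eqVneq t 0; first by rewrite scale0r addr0.
have [->|tn1] := eqVneq t 1; first by rewrite scale1r addrC subrK.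
have -> : y + t *: (x - y) = t *: x + (1 - t) *: y.
  by rewrite scalerBr scalerBl scale1r addrCA.
apply: (cw_add cw); apply: (cw_scale cw) => //.
  by rewrite lt0r tn0.
by rewrite subr_gt0 lt_neqAle tn1.
Qed.

Lemma compact_enorm_bounded (K : set 'rV[R]_n.+1) : compact K ->
  exists2 r, 0 < r & forall x, K x -> enorm x <= r.
Proof.
move=> /compact_bounded[M [Mreal H]].
exists (n.+2%:R * (`|M| + 1)).
  by rewrite mulr_gt0// ltr_wpDl.
move=> x Kx; apply: (le_trans (enorm_le_norm x)); rewrite ler_wpM2l//.
by apply: (H _ _ x Kx); rewrite (le_lt_trans (ler_norm _))// ltrDl.
Qed.

Lemma compact_closure_eball (r : R) : compact (closure W `&` [set x | enorm x <= r]).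
Proof.
apply: bounded_closed_compact.
  exists r; split; first exact: num_real.
  move=> M rM x [_ /= xr]; apply: le_trans (ltW rM).
  exact: le_trans (norm_le_enorm x) xr.
apply: closedI; first exact: closed_closure.
apply: (@closed_comp _ _ (enorm : 'rV[R]_n.+1 -> R) [set u | u <= r]); last exact: closed_le.
by move=> x _; exact: enorm_continuous.
Qed.

(** Along a segment in the convex cone the increments of [f] are controlled by
its gradient, which is bounded and continuous. *)
Lemma profile_of_C1c f : C1c_closure W f ->
  exists rho M L, profile W (fun x => `|f x|) (fun x => enorm (grad f x)) rho M L.
Proof.
move=> [cf df [h ch hE] Kc].
set K := closure _ in Kc.
have [rho rho0 Krho] := compact_enorm_bounded Kc.
have KW : K `<=` closure W.
  rewrite [X in _ `<=` X]((closure_id _).1 (@closed_closure _ W)).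
  by apply: closureS => x [].
have f0 x : closure W x -> rho < enorm x -> f x = 0.
  move=> Wx rx; apply/eqP; apply: contraTT rx => fx; rewrite -leNgt; apply: Krho.
  by apply: subset_closure.
have oW := cw_open cw.
have WcW : W `<=` closure W by exact: subset_closure.
have cfW x : W x -> {for x, continuous f} by move=> Wx; exact: differentiable_continuous (df _ Wx).
have [M0 M0P] : exists M0, forall x, K x -> `|f x| <= M0.
  have : compact (f @` K) by apply: continuous_compact => //; exact: continuous_subspaceW cf.
  move=> /compact_bounded[M [_ HM]]; exists (`|M| + 1) => x Kx.
  by apply: (HM (`|M| + 1)); [rewrite (le_lt_trans (ler_norm _))// ltrDl|exists x].
have fM x : closure W x -> `|f x| <= `|M0|.
  move=> Wx; have [->|fx] := eqVneq (f x) 0; first by rewrite normr0.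
  apply: le_trans (ler_norm _); apply: M0P.
  by apply: subset_closure.
have cG x : W x -> {for x, continuous (fun x => enorm (grad f x))}.
  move=> Wx.
  have chx : {for x, continuous h}.
    have : {within W, continuous h} by exact: continuous_subspaceW ch.
    by rewrite continuous_open_subspace// => /(_ x); rewrite inE; exact.
  have E : \forall y \near x, enorm (h y) = enorm (grad f y).
    have : nbhs x W by exact: open_nbhs_nbhs.
    by apply: filterS => y Wy; rewrite hE.
  rewrite /prop_for /continuous_at -(hE _ Wx).
  apply: cvg_trans (near_eq_cvg E) _.
  by apply: (@continuous_comp _ _ _ h enorm) => //; exact: enorm_continuous.
have Gout x : W x -> rho < enorm x -> enorm (grad f x) = 0.
  move=> Wx rx; suff -> : grad f x = 0 by rewrite enorm0.
  apply/rowP => i; rewrite !mxE.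
  have <- : 'D_(delta_mx ord0 i) (cst 0 : 'rV[R]_n.+1 -> R) x = 0 by rewrite derive_cst.
  apply: near_eq_derive.
  have n1 : nbhs x W by exact: open_nbhs_nbhs.
  have n2 : nbhs x [set y | rho < enorm y].
    apply: open_nbhs_nbhs; split => //.
    apply: (@open_comp _ _ (enorm : 'rV[R]_n.+1 -> R) [set u | rho < u]); last exact: open_gt.
    by move=> y _; exact: enorm_continuous.
  by apply: filterS (filterI n1 n2) => y [Wy ry]; rewrite f0//; exact: WcW.
have [L L0 LP] : exists2 L, 0 <= L & forall x, W x -> enorm (grad f x) <= L.
  have : compact (h @` (closure W `&` [set x | enorm x <= rho])).
    apply: continuous_compact; last exact: compact_closure_eball.
    by apply: continuous_subspaceW ch => x [].
  move=> /compact_enorm_bounded[L L0 LP]; exists L; first exact: ltW.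
  move=> x Wx; have [xr|xr] := leP (enorm x) rho; last by rewrite Gout// ltW.
  by rewrite -hE//; apply: LP; exists x => //; split => //; exact: WcW.
have mv x y B : (forall t : R, 0 <= t <= 1 -> W (y + t *: (x - y))) ->
    (forall t : R, 0 <= t <= 1 -> enorm (grad f (y + t *: (x - y))) <= B) ->
    `|f x| <= `|f y| + B * enorm (x - y).
  move=> Wt gB; have := mean_value_segment (fun t t01 => df _ (Wt t t01)) gB.
  by rewrite -lerBlDl; apply: le_trans; exact: lerB_dist.
exists rho, `|M0|, L; split.
- by move=> x; exact: normr_ge0.
- move=> x Wx; apply: (@continuous_comp _ _ _ f (fun u => `|u|)); first exact: cfW.
  exact: norm_continuous.
- by move=> x Wx rx; rewrite f0 ?normr0//; exact: WcW.
- by move=> x Wx; apply: fM; exact: WcW.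
- move=> x y Wx Wy; apply: mv => t t01; first exact: cone_segment.
  by apply: LP; exact: cone_segment.
- by move=> x; exact: enorm_ge0.
- by apply: continuous_rV_measurable oW _ => x; rewrite inE; exact: cG.
- by move=> x Wx rx; exact: Gout.
- exact: LP.
- move=> z eps Wz eps0.
  have n1 : nbhs z W by exact: open_nbhs_nbhs.
  have n2 : nbhs z [set x | enorm (grad f x) < enorm (grad f z) + eps].
    by apply: (cG z Wz [set u | u < enorm (grad f z) + eps]); apply: open_nbhs_nbhs; split;
      [exact: open_lt|rewrite /= ltrDl].
  have : nbhs z (W `&` [set x | enorm (grad f x) < enorm (grad f z) + eps]) by exact: filterI.
  move=> /(nbhs_ballP z _)[d /= d0 dP].
  exists d => // x Wx xz.
  have seg t : 0 <= t <= 1 -> ball z d (z + t *: (x - z)).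
    move=> /andP[t0 t1]; rewrite -ball_normE /= opprD addNKr normrN normrZ ger0_norm//.
    apply: le_lt_trans xz; apply: le_trans (norm_le_enorm _).
    by rewrite ler_piMl.
  apply: mv => t t01; first by have [] := dP _ (seg t t01).
  by have [_ /ltW] := dP _ (seg t t01).
Qed.
End test_functions.

(** * The Sobolev quotient from above, and radial functions *)

(** If [b = 0], then [a = 0] and the quotient is [0 * +oo = 0]. *)
Lemma lee_div_EFin (R : realType) (a b c : R) : 0 <= a -> 0 <= b -> 0 <= c ->
  a <= c * b -> (a%:E / b%:E <= c%:E)%E.
Proof.
move=> a0 b0 c0 abc; rewrite inver.
case: ifPn => [/eqP bz|bn0]; last by rewrite -EFinM lee_fin ler_pdivrMr// lt0r bn0.
have -> : a = 0 by apply/eqP; rewrite eq_le a0 andbT; rewrite bz mulr0 in abc.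
by rewrite mul0e lee_fin.
Qed.

Section sobolev_quotient.
Context {R : realType} {n : nat} (Phip : {fset 'rV[R]_n.+1}) (k : 'rV[R]_n.+1 -> R).
Context (W : set 'rV[R]_n.+1) (g : R) (cw : cone_weight W (w_k Phip k) g) (W0 : W !=set0).
Context (D : R) (DE : D = n.+1%:R + g).
Context (p p' : R) (p1 : 1 < p) (pD : p < D) (pp' : p^-1 + p'^-1 = 1).
Let q := p * D / (D - p).
Let C := sharp_constant W (w_k Phip k) D p p'.

Lemma Lnorm_mu_k_EFin r (f : 'rV[R]_n.+1 -> R) : (wint W (w_k Phip k) (fun x => `|f x| `^ r)%R < +oo)%E ->
  Lnorm_mu_k Phip k W r f = (fine (wint W (w_k Phip k) (fun x => `|f x| `^ r)) `^ r^-1)%:E.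
Proof.
move=> ffin; rewrite /Lnorm_mu_k /int_mu_k -/(wint W (w_k Phip k) _) -poweR_EFin fineK//.
have h0 : (0 <= wint W (w_k Phip k) (fun x => `|f x| `^ r)%R)%E.
  by apply: (wint_ge0 cw) => x _; exact: powR_ge0.
by rewrite (ge0_fin_numE h0).
Qed.

Lemma sobolev_quotient_le (f : 'rV[R]_n.+1 -> R) : C1c_closure W f ->
  (Lnorm_mu_k Phip k W q f / Lnorm_mu_k Phip k W p (fun x => enorm (grad f x)) <= C%:E)%E.
Proof.
move=> /(profile_of_C1c cw)[rho [M [L pf]]].
have p0 : 0 < p by exact: lt_trans p1.
have q0 : 0 < q by rewrite divr_gt0 ?subr_gt0// mulr_gt0// (lt_trans p0).
have GE : (fun x => `|enorm (grad f x)| `^ p) = (fun x => enorm (grad f x) `^ p).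
  by apply/funext => x; rewrite ger0_norm ?enorm_ge0.
have Qfin : (wint W (w_k Phip k) (fun x => `|f x| `^ q)%R < +oo)%E.
  apply: (wint_pow_lty cw (M := M) q0 (measurable_profile cw pf)); last exact: (pf_supp pf).
  by move=> x Wx; rewrite normr_ge0 (pf_bound pf Wx).
have Pfin : (wint W (w_k Phip k) (fun x => enorm (grad f x) `^ p)%R < +oo)%E.
  apply: (wint_pow_lty cw (M := L) p0 (pf_gmeas pf)); last exact: (pf_gsupp pf).
  by move=> x Wx; rewrite enorm_ge0 (pf_gbound pf Wx).
have main := cone_sobolev cw W0 DE p1 pD pp' pf.
rewrite Lnorm_mu_k_EFin// Lnorm_mu_k_EFin GE//.
apply: lee_div_EFin; [exact: powR_ge0|exact: powR_ge0| |exact: main].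
by apply: ltW; exact: (sharp_constant_gt0 cw W0 DE p1 pD pp').
Qed.
End sobolev_quotient.

Section positive_part.
Context {R : realType}.
Implicit Types (y h : R).

Definition pospart y : R := (y + `|y|) / 2.

Lemma pospart_ge0 y : 0 <= pospart y.
Proof. by rewrite divr_ge0// -lerBlDl sub0r; have := ler_norm (- y); rewrite normrN. Qed.

Lemma ge0_pospart y : 0 <= y -> pospart y = y.
Proof. by move=> y0; rewrite /pospart ger0_norm//; field. Qed.

Lemma le0_pospart y : y <= 0 -> pospart y = 0.
Proof. by move=> y0; rewrite /pospart ler0_norm// subrr mul0r. Qed.

Lemma pospart_le y s : y <= s -> 0 <= s -> pospart y <= s.
Proof.
by move=> ys s0; have [y0|y0] := leP 0 y; [rewrite ge0_pospart|rewrite le0_pospart// ltW].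
Qed.

Lemma cvg_pospart (u : nat -> R) l : u m @[m --> \oo] --> l ->
  pospart (u m) @[m --> \oo] --> pospart l.
Proof. by move=> ul; apply: cvgMl; apply: cvgD => //; exact: cvg_norm. Qed.

Lemma pospart_continuous : continuous pospart.
Proof.
by move=> y; apply: cvgMl; apply: cvgD; [exact: cvg_id|exact: norm_continuous].
Qed.

(** The derivative [2 pospart] is [2]-Lipschitz. *)
Lemma sqr_pospart_expand y h :
  `|pospart (y + h) ^+ 2 - pospart y ^+ 2 - h * (2 * pospart y)| <= h ^+ 2.
Proof.
have [y0|y0] := leP 0 y; have [yh|yh] := leP 0 (y + h).
- by rewrite !ge0_pospart// ler_norml; apply/andP; split; nra.
- by rewrite (ge0_pospart y0) (le0_pospart (ltW yh)) ler_norml; apply/andP; split; nra.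
- by rewrite (ge0_pospart yh) (le0_pospart (ltW y0)) ler_norml; apply/andP; split; nra.
- by rewrite (le0_pospart (ltW yh)) (le0_pospart (ltW y0)) ler_norml; apply/andP; split; nra.
Qed.

Lemma is_derive_sqr_pospart y : is_derive y 1 (fun y => pospart y ^+ 2) (2 * pospart y).
Proof.
have cv : (fun h : R => h^-1 *: (((fun y => pospart y ^+ 2) \o shift y) (h *: 1) - pospart y ^+ 2))
    @ 0^' --> 2 * pospart y.
  apply/cvgrPdist_le => e e0.
  near=> h; have h0 : h != 0 by near: h; exact: nbhs_dnbhs_neq.
  have -> : h *: 1 = h :> R by rewrite /GRing.scale/= mulr1.
  rewrite /= /GRing.scale/= distrC.
  have -> : h^-1 * (pospart (h + y) ^+ 2 - pospart y ^+ 2) - 2 * pospart y =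
     h^-1 * (pospart (y + h) ^+ 2 - pospart y ^+ 2 - h * (2 * pospart y)).
    by rewrite (addrC h); field.
  rewrite normrM normfV mulrC ler_pdivrMr ?normr_gt0//.
  apply: (le_trans (sqr_pospart_expand _ _)).
  rewrite -(real_normK (num_real h)) expr2 ler_wpM2r//.
  by near: h; apply: dnbhs0_le.
apply: DeriveDef; first by apply/cvg_ex; exists (2 * pospart y).
exact: cvg_lim cv.
Unshelve. all: by end_near.
Qed.
End positive_part.

Section radial_functions.
Context {R : realType} {n : nat}.
Implicit Types (x v : 'rV[R]_n.+1).

Lemma differentiable_sqr_norm x : differentiable (fun x : 'rV[R]_n.+1 => dotp x x) x.
Proof.
rewrite (_ : (fun x => dotp x x) =
  \sum_(i < n.+1) ((fun x : 'rV[R]_n.+1 => x ord0 i) * (fun x : 'rV[R]_n.+1 => x ord0 i))); last first.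
  by apply/funext => y; rewrite fct_sumE.
apply: differentiable_sum => i; apply: differentiableM; exact: differentiable_coord.
Qed.

Lemma differentiable_radial (Phi : R -> R) (dPhi : R) x : is_derive (dotp x x) 1 Phi dPhi ->
  differentiable (fun x : 'rV[R]_n.+1 => Phi (dotp x x)) x.
Proof.
move=> [dP _]; apply: (@differentiable_comp _ _ _ _ (fun x => dotp x x) Phi).
  exact: differentiable_sqr_norm.
exact/derivable1_diffP.
Qed.

(** Both sides are computed along the lines parallel to the axes, on which the
squared norm is a quadratic polynomial. *)
Lemma grad_radial (Phi : R -> R) (dPhi : R) x : is_derive (dotp x x) 1 Phi dPhi ->
  grad (fun x : 'rV[R]_n.+1 => Phi (dotp x x)) x = (2 * dPhi) *: x.
Proof.
move=> dP; have df := differentiable_radial dP; set f := fun x => _.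
apply/rowP => i; rewrite !mxE.
pose v : 'rV[R]_n.+1 := delta_mx ord0 i.
have vE y : dotp y v = y ord0 i.
  rewrite /dotp (bigD1 i)//= mxE !eqxx mulr1 big1 ?addr0// => j ji.
  by rewrite mxE eqxx /= (negPf ji) mulr0.
have x0 : x + (0 : R) *: v = x by rewrite scale0r addr0.
have d1 : is_derive (0 : R) 1 (fun u : R => f (x + u *: v)) (dotp (grad f x) v).
  by have := @derive_segment _ _ f x v 0; rewrite x0; exact.
have d2 : is_derive (0 : R) 1 (fun u : R => f (x + u *: v)) (dPhi * (2 * x ord0 i)).
  pose c := dotp x x; pose b := dotp x v.
  pose G (u : R) : R := c + (2 * b * u + dotp v v * (u * u)).
  have dG : is_derive (0 : R) 1 G (2 * x ord0 i).
    have := is_deriveD (is_derive_cst c (0:R) 1) (is_deriveD (is_deriveZ (2 * b) (is_derive_id (0:R) 1))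
      (is_deriveZ (dotp v v) (is_deriveM (is_derive_id (0:R) 1) (is_derive_id (0:R) 1)))).
    have -> : 0 + ((2 * b) *: 1 + dotp v v *: ((0 : R) *: 1 + (0 : R) *: 1)) = 2 * x ord0 i :> R.
      change (0 + (2 * b * 1 + dotp v v * (0 * 1 + 0 * 1)) = 2 * x ord0 i).
      by rewrite -vE -/b; ring.
    exact.
  have E : (fun u : R => f (x + u *: v)) = Phi \o G.
    apply/funext => u; rewrite /f /= dotpDr !dotpDl !dotpZr !dotpZl (dotpC v x); congr Phi.
    by rewrite /G -/c -/b; ring.
  have G0 : G 0 = dotp x x by rewrite /G /c; ring.
  clearbody G; rewrite E; apply: is_derive1_comp dG.
  by rewrite G0.
rewrite -/v -vE -[LHS]/('D_v f x).
have -> : 'D_v f x = dotp (grad f x) v by rewrite vE mxE.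
have -> : dotp (grad f x) v = dPhi * (2 * x ord0 i).
  by have [_ <-] := d1; have [_ ->] := d2.
by rewrite vE; ring.
Qed.
End radial_functions.

(** * Smooth truncations of the extremal profile *)

Lemma powR_cvg_gt0 (R : realType) (u : nat -> R) (l c : R) : 0 < l ->
  u m @[m --> \oo] --> l -> u m `^ c @[m --> \oo] --> l `^ c.
Proof.
move=> l0 ul; have ct : {for l, continuous (fun y : R => y `^ c)} by exact: powR_continuous_at.
exact: (cvg_comp _ _ ul ct).
Qed.

Lemma powR_cvg (R : realType) (u : nat -> R) (l b : R) : 0 < b -> 0 <= l ->
  (forall m, 0 <= u m) -> u m @[m --> \oo] --> l -> u m `^ b @[m --> \oo] --> l `^ b.
Proof.
move=> b0 l0 u0 ul.
have [lz|ln0] := eqVneq l 0; last first.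
  by apply: powR_cvg_gt0 => //; rewrite lt0r ln0.
rewrite lz powR0 ?gt_eqF//; rewrite lz in ul.
apply/cvgrPdist_le => e e0.
move/cvgrPdist_le : ul => /(_ _ (powR_gt0 b^-1 e0)).
apply: filterS => m; rewrite !sub0r !normrN ger0_norm// ger0_norm ?powR_ge0// => h.
rewrite [leRHS](_ : e = (e `^ b^-1) `^ b); last first.
  by rewrite -powRrM mulVf ?gt_eqF// powRr1// ltW.
by apply: ge0_ler_powR; rewrite ?nnegrE ?powR_ge0// ltW.
Qed.

Section truncated_extremal.
Context {R : realType} (a b : R) (a0 : 0 < a) (b0 : 0 < b).
Implicit Types (d r : R).

(** The extremal profile, as a function of the squared norm [r], is
[(1 + r ^ b) ^ - a].  Replacing [r] by [d + r] makes it smooth at the origin, and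
[s] by the square of the positive part of [s - d], divided by [s], gives it
compact support without increasing its slope. *)
Definition cutoff_base d r : R := 1 + (d + r) `^ b.

Definition cutoff_height d r : R := pospart (cutoff_base d r `^ (- a) - d).

Definition cutoff d r : R := cutoff_height d r ^+ 2 * cutoff_base d r `^ a.

Definition cutoff_slope d r : R :=
  - a * cutoff_base d r `^ (- a - 1) * (b * (d + r) `^ (b - 1)) *
  (cutoff_height d r * (2 * cutoff_base d r `^ (- a) - cutoff_height d r) * cutoff_base d r `^ (2 * a)).

Lemma cutoff_base_gt0 d r : 0 < cutoff_base d r.
Proof. by rewrite ltr_wpDr// powR_ge0. Qed.

Lemma cutoff_height_le d r : 0 <= d -> cutoff_height d r <= cutoff_base d r `^ (- a).
Proof. by move=> d0; apply: pospart_le; rewrite ?powR_ge0// gerBl. Qed.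

Lemma cutoff_ge0 d r : 0 <= cutoff d r.
Proof. by rewrite mulr_ge0 ?sqr_ge0 ?powR_ge0. Qed.

Let powB d r u v : cutoff_base d r `^ u * cutoff_base d r `^ v = cutoff_base d r `^ (u + v).
Proof. by rewrite powRD// (gt_eqF (cutoff_base_gt0 d r)) implybT. Qed.

Lemma cutoff_le d r : 0 <= d -> cutoff d r <= cutoff_base d r `^ (- a).
Proof.
move=> d0; have h1 := cutoff_height_le r d0.
have h0 : 0 <= cutoff_height d r by exact: pospart_ge0.
have -> : cutoff_base d r `^ (- a) = (cutoff_base d r `^ (- a)) ^+ 2 * cutoff_base d r `^ a.
  by rewrite expr2 !powB; congr (_ `^ _); ring.
by rewrite ler_wpM2r ?powR_ge0// lerXn2r ?nnegrE ?powR_ge0.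
Qed.

Lemma cutoff_slope_le d r : 0 <= d ->
  `|cutoff_slope d r| <= a * b * cutoff_base d r `^ (- a - 1) * (d + r) `^ (b - 1).
Proof.
move=> d0; have h1 := cutoff_height_le r d0.
have h0 : 0 <= cutoff_height d r by exact: pospart_ge0.
rewrite /cutoff_slope.
set t := cutoff_height d r * _ * _; set s := cutoff_base d r `^ (- a) in h1 t *.
have s0 : 0 <= s by exact: powR_ge0.
have t0 : 0 <= t.
  rewrite /t; apply: mulr_ge0; last exact: powR_ge0.
  apply: mulr_ge0 => //; clearbody s; clear -h0 h1 s0; lra.
have t1 : t <= 1.
  have -> : (1 : R) = s ^+ 2 * cutoff_base d r `^ (2 * a).
    rewrite expr2 /s !powB (_ : - a + - a + 2 * a = 0) ?powRr0//; ring.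
  by rewrite /t ler_wpM2r ?powR_ge0//; nra.
rewrite normrM (ger0_norm t0) !mulNr normrN ger0_norm; last first.
  by rewrite !mulr_ge0 ?powR_ge0// ltW.
rewrite -[leRHS]mulr1.
have -> : a * b * cutoff_base d r `^ (- a - 1) * (d + r) `^ (b - 1) =
  a * cutoff_base d r `^ (- a - 1) * (b * (d + r) `^ (b - 1)) by ring.
by apply: ler_wpM2l t1; rewrite !mulr_ge0 ?powR_ge0// ltW.
Qed.

Lemma is_derive_cutoff_base d r : 0 < d + r ->
  is_derive r 1 (cutoff_base d) (b * (d + r) `^ (b - 1)).
Proof.
move=> dr.
have d1 : is_derive r 1 (fun r => d + r) (1 : R).
  have := is_deriveD (is_derive_cst d r 1) (is_derive_id r 1).
  by rewrite add0r.
have d2 := @is_derive1_comp R (fun u => u `^ b) (fun r => d + r) r _ _ (is_derive1_powR b dr) d1.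
have := is_deriveD (is_derive_cst (1:R) r 1) d2.
by rewrite add0r mulr1.
Qed.

Lemma is_derive_cutoff d r : 0 < d + r -> is_derive r 1 (cutoff d) (cutoff_slope d r).
Proof.
move=> dr; have dB := is_derive_cutoff_base dr; have B0 := cutoff_base_gt0 d r.
have dpow c : is_derive r 1 (fun r => cutoff_base d r `^ c)
    (c * cutoff_base d r `^ (c - 1) * (b * (d + r) `^ (b - 1))).
  exact: (@is_derive1_comp R (fun u => u `^ c) (cutoff_base d) r _ _ (is_derive1_powR c B0) dB).
have ds : is_derive r 1 (fun r => cutoff_base d r `^ (- a) - d)
    (- a * cutoff_base d r `^ (- a - 1) * (b * (d + r) `^ (b - 1))).
  have := is_deriveD (dpow (- a)) (is_derive_cst (- d) r 1).
  by rewrite addr0.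
have dh : is_derive r 1 (fun r => cutoff_height d r ^+ 2)
    (2 * cutoff_height d r * (- a * cutoff_base d r `^ (- a - 1) * (b * (d + r) `^ (b - 1)))).
  exact: (@is_derive1_comp R (fun y => pospart y ^+ 2) (fun r => cutoff_base d r `^ (- a) - d)
    r _ _ (is_derive_sqr_pospart _) ds).
have := is_deriveM dh (dpow a).
congr (is_derive _ _ _ _); rewrite /cutoff_slope.
set h := cutoff_height d r; set B' := b * _.
change (h ^+ 2 * (a * cutoff_base d r `^ (a - 1) * B') +
  cutoff_base d r `^ a * (2 * h * (- a * cutoff_base d r `^ (- a - 1) * B')) =
  - a * cutoff_base d r `^ (- a - 1) * B' * (h * (2 * cutoff_base d r `^ (- a) - h) * cutoff_base d r `^ (2 * a))).
have -> : cutoff_base d r `^ (a - 1) = cutoff_base d r `^ (- a - 1) * cutoff_base d r `^ (2 * a).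
  by rewrite powB; congr (_ `^ _); ring.
have -> : cutoff_base d r `^ a = cutoff_base d r `^ (- a) * cutoff_base d r `^ (2 * a).
  by rewrite powB; congr (_ `^ _); ring.
ring.
Qed.

Lemma cutoff_slope_continuous d r : 0 < d + r -> {for r, continuous (cutoff_slope d)}.
Proof.
move=> dr; have B0 := cutoff_base_gt0 d r.
have cdr : {for r, continuous (fun r : R => d + r)}.
  by apply: continuousD; [exact: cst_continuous|exact: id].
have cdp c : {for r, continuous (fun r : R => (d + r) `^ c)}.
  apply: (@continuous_comp _ _ _ (fun r : R => d + r) (fun u => u `^ c)) => //.
  exact: powR_continuous_at.
have cB : {for r, continuous (cutoff_base d)}.
  by apply: continuousD; [exact: cst_continuous|exact: cdp].
have cBp c : {for r, continuous (fun r : R => cutoff_base d r `^ c)}.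
  apply: (@continuous_comp _ _ _ (cutoff_base d) (fun u => u `^ c)) => //.
  exact: powR_continuous_at.
have ch : {for r, continuous (cutoff_height d)}.
  apply: (@continuous_comp _ _ _ (fun r => cutoff_base d r `^ (- a) - d) (@pospart R)).
    by apply: continuousB; [exact: cBp|exact: cst_continuous].
  exact: pospart_continuous.
apply: continuousM; apply: continuousM.
- by apply: continuousM; [exact: cst_continuous|exact: cBp].
- by apply: continuousM; [exact: cst_continuous|exact: cdp].
- apply: continuousM => //; apply: continuousB => //.
  by apply: continuousM; [exact: cst_continuous|exact: cBp].
- exact: cBp.
Qed.

(** The profile tends to zero at infinity, so its excess over [d] vanishes outside
a ball. *)
Lemma cutoff_support d : 0 < d -> exists r0, forall r, 0 <= r -> r0 < r -> cutoff d r = 0.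
Proof.
move=> d0; exists ((d `^ (- a^-1)) `^ b^-1) => r r0 rr.
have q1 : d `^ (- a^-1) <= cutoff_base d r.
  rewrite -[leLHS](_ : ((d `^ (- a^-1)) `^ b^-1) `^ b = _); last first.
    by rewrite -powRrM mulVf ?gt_eqF// powRr1// powR_ge0.
  rewrite ler_wpDl//; apply: ge0_ler_powR; rewrite ?nnegrE ?powR_ge0 ?(ltW b0)//.
    by rewrite addr_ge0// ltW.
  by apply: (le_trans (ltW rr)); rewrite lerDr ltW.
have q2 : cutoff_base d r `^ (- a) <= d.
  rewrite [leRHS](_ : d = (d `^ (- a^-1)) `^ (- a)); last first.
    by rewrite -powRrM mulrNN mulVf ?gt_eqF// powRr1// ltW.
  by apply: ler_powRN; rewrite ?powR_gt0// ltW.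
by rewrite /cutoff /cutoff_height le0_pospart ?expr0n ?mul0r// subr_le0.
Qed.

Section limit.
Context (d : nat -> R) (d0 : forall m, 0 < d m) (dz : d m @[m --> \oo] --> 0).
Context (r : R) (r0 : 0 <= r).

Let cvdr : d m + r @[m --> \oo] --> r.
Proof. by rewrite -[X in _ --> X]add0r; apply: cvgD => //; exact: cvg_cst. Qed.

Let cvB : cutoff_base (d m) r @[m --> \oo] --> 1 + r `^ b.
Proof.
apply: cvgD; first exact: cvg_cst.
by apply: powR_cvg => // m; rewrite addr_ge0// ltW.
Qed.

Let cvBp c : cutoff_base (d m) r `^ c @[m --> \oo] --> (1 + r `^ b) `^ c.
Proof.
by apply: powR_cvg_gt0 cvB; rewrite ltr_wpDr// powR_ge0.
Qed.

Let cvh : cutoff_height (d m) r @[m --> \oo] --> (1 + r `^ b) `^ (- a).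
Proof.
rewrite -[X in _ --> X](ge0_pospart (powR_ge0 _ _)) -[X in _ --> pospart X]subr0.
by apply: cvg_pospart; apply: cvgB; first exact: cvBp.
Qed.

Let powB0 u v : (1 + r `^ b) `^ u * (1 + r `^ b) `^ v = (1 + r `^ b) `^ (u + v).
Proof.
have B0 : 0 < 1 + r `^ b by rewrite ltr_wpDr// powR_ge0.
by rewrite powRD// (gt_eqF B0) implybT.
Qed.

Lemma cvg_cutoff : cutoff (d m) r @[m --> \oo] --> (1 + r `^ b) `^ (- a).
Proof.
have -> : (1 + r `^ b) `^ (- a) =
    (1 + r `^ b) `^ (- a) * (1 + r `^ b) `^ (- a) * (1 + r `^ b) `^ a.
  by rewrite !powB0; congr (_ `^ _); ring.
by apply: cvgM; [apply: cvgM; exact: cvh|exact: cvBp].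
Qed.

Lemma cvg_cutoff_slope : 0 < r -> `|cutoff_slope (d m) r| @[m --> \oo] -->
  a * b * (1 + r `^ b) `^ (- a - 1) * r `^ (b - 1).
Proof.
move=> rp.
have cvp : (d m + r) `^ (b - 1) @[m --> \oo] --> r `^ (b - 1).
  exact: powR_cvg_gt0 cvdr.
have E : a * b * (1 + r `^ b) `^ (- a - 1) * r `^ (b - 1) =
    `|- a * (1 + r `^ b) `^ (- a - 1) * (b * r `^ (b - 1)) *
      ((1 + r `^ b) `^ (- a) * (2 * (1 + r `^ b) `^ (- a) - (1 + r `^ b) `^ (- a)) *
       (1 + r `^ b) `^ (2 * a))|.
  have -> : (1 + r `^ b) `^ (- a) * (2 * (1 + r `^ b) `^ (- a) - (1 + r `^ b) `^ (- a)) *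
      (1 + r `^ b) `^ (2 * a) = 1.
    rewrite (_ : 2 * _ - _ = (1 + r `^ b) `^ (- a)); last by ring.
    by rewrite !powB0 (_ : - a + - a + 2 * a = 0) ?powRr0//; ring.
  rewrite mulr1 !mulNr normrN ger0_norm; first by ring.
  by rewrite !mulr_ge0 ?powR_ge0// ltW.
rewrite E; apply: cvg_norm; apply: cvgM; apply: cvgM.
- by apply: cvgM; [exact: cvg_cst|exact: cvBp].
- by apply: cvgM; [exact: cvg_cst|exact: cvp].
- apply: cvgM; [exact: cvh|apply: cvgB; last exact: cvh].
  by apply: cvgM; [exact: cvg_cst|exact: cvBp].
- exact: cvBp.
Qed.
End limit.
End truncated_extremal.

(** * Sharpness of the constant *)

Section cutoff_estimates.
Context {R : realType} (a b D p q : R) (a0 : 0 < a) (b0 : 0 < b) (p0 : 0 < p) (q0 : 0 < q).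
Context (D1 : 0 < D - 1) (aq : a * q = D) (ap : (a + 1) * p = D) (bp : (b - 2^-1) * p = b).
Implicit Types (d r : R).

Let D0 : 0 < D. Proof. by rewrite -aq mulr_gt0. Qed.

Lemma cutoff_pow_le d r : 0 <= d -> 0 <= r -> cutoff a b d r `^ q <= (1 + r `^ b) `^ (- D).
Proof.
move=> d0 r0; have B0 := cutoff_base_gt0 b d r.
apply: (@le_trans _ _ ((cutoff_base b d r `^ (- a)) `^ q)).
  by apply: ge0_ler_powR; rewrite ?nnegrE ?powR_ge0 ?(ltW q0) ?cutoff_ge0//; exact: cutoff_le.
rewrite -powRrM mulNr aq; apply: ler_powRN; rewrite ?(ltW D0)//.
  by rewrite ltr_wpDr// powR_ge0.
rewrite lerD2l; apply: ge0_ler_powR; rewrite ?nnegrE ?(ltW b0)// ?addr_ge0//.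
by rewrite lerDr.
Qed.

Lemma cutoff_slope_pow_le d r : 0 < d -> 0 <= r ->
  (2 * `|cutoff_slope a b d r| * r `^ 2^-1) `^ p <=
  (2 * (a * b)) `^ p * (1 + r `^ b) `^ (- (D - 1)).
Proof.
move=> d0 r0; have B0 := cutoff_base_gt0 b d r.
have y0 : 0 < d + r by rewrite ltr_wpDr.
have ab0 : 0 < 2 * (a * b) by apply: mulr_gt0 => //; exact: mulr_gt0.
have rb0 : 0 < 1 + r `^ b by rewrite ltr_wpDr// powR_ge0.
apply: (@le_trans _ _ ((2 * (a * b) * cutoff_base b d r `^ (- a - 1) * (d + r) `^ (b - 2^-1)) `^ p)).
  apply: ge0_ler_powR; rewrite ?nnegrE ?(ltW p0) ?mulr_ge0 ?powR_ge0 ?(ltW a0) ?(ltW b0)//.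
  have -> : (d + r) `^ (b - 2^-1) = (d + r) `^ (b - 1) * (d + r) `^ 2^-1.
    by rewrite -powRD ?(gt_eqF y0) ?implybT//; congr (_ `^ _); field.
  rewrite mulrA; apply: ler_pM; rewrite ?powR_ge0 ?mulr_ge0//.
    rewrite -!mulrA ler_pM2l//; have := cutoff_slope_le a0 b0 r (ltW d0).
    by rewrite -!mulrA.
  by apply: ge0_ler_powR; rewrite ?nnegrE ?(ltW y0)// lerDr ltW.
rewrite powRM ?powR_ge0 ?mulr_ge0 ?powR_ge0 ?(ltW a0) ?(ltW b0)//.
rewrite powRM ?powR_ge0 ?(ltW ab0)// -!powRrM bp -[leLHS]mulrA ler_pM2l ?powR_gt0//.
rewrite -opprD mulNr ap.
apply: (@le_trans _ _ (cutoff_base b d r `^ (- (D - 1)))).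
  have -> : - (D - 1) = - D + 1 by ring.
  have -> : cutoff_base b d r `^ (- D + 1) = cutoff_base b d r `^ (- D) * cutoff_base b d r.
    by rewrite powRD ?(gt_eqF B0) ?implybT// powRr1// ltW.
  by rewrite ler_wpM2l ?powR_ge0// /cutoff_base lerDr.
apply: ler_powRN; rewrite ?(ltW D1)//.
rewrite lerD2l; apply: ge0_ler_powR; rewrite ?nnegrE ?(ltW b0)// ?(ltW y0)//.
by rewrite lerDr ltW.
Qed.

Lemma cutoff_slope_limitE r : 0 < r ->
  (2 * (a * b)) `^ p * (r `^ b * (1 + r `^ b) `^ (- D)) =
  (2 * (a * b * (1 + r `^ b) `^ (- a - 1) * r `^ (b - 1)) * r `^ 2^-1) `^ p.
Proof.
move=> r0.
have ab0 : 0 < 2 * (a * b) by apply: mulr_gt0 => //; exact: mulr_gt0.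
have -> : 2 * (a * b * (1 + r `^ b) `^ (- a - 1) * r `^ (b - 1)) * r `^ 2^-1 =
    2 * (a * b) * (1 + r `^ b) `^ (- a - 1) * (r `^ (b - 1) * r `^ 2^-1).
  by ring.
have -> : r `^ (b - 1) * r `^ 2^-1 = r `^ (b - 2^-1).
  by rewrite -powRD ?(gt_eqF r0) ?implybT//; congr (_ `^ _); field.
have h1 : 0 <= 2 * (a * b) * (1 + r `^ b) `^ (- a - 1).
  by rewrite mulr_ge0 ?powR_ge0// ltW.
rewrite (powRM _ h1 (powR_ge0 _ _)) (powRM _ (ltW ab0) (powR_ge0 _ _)) -!powRrM bp -opprD mulNr ap.
by rewrite -mulrA (mulrC (_ `^ b)).
Qed.
End cutoff_estimates.

Section extremal_sequence.
Context {R : realType} {n : nat} (Phip : {fset 'rV[R]_n.+1}) (k : 'rV[R]_n.+1 -> R).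
Context (W : set 'rV[R]_n.+1) (g : R) (cw : cone_weight W (w_k Phip k) g) (W0 : W !=set0).
Context (D : R) (DE : D = n.+1%:R + g).
Context (p p' : R) (p1 : 1 < p) (pD : p < D) (pp' : p^-1 + p'^-1 = 1).
Let q := p * D / (D - p).
Let w := w_k Phip k.
Let C := sharp_constant W w D p p'.
Let J := extremal_mass W w D p'.
Let a := (D - p) / p.
Let b := p' / 2.

Let p0 : 0 < p. Proof. exact: lt_trans p1. Qed.
Let Dp0 : 0 < D - p. Proof. by rewrite subr_gt0. Qed.
Let D0 : 0 < D. Proof. exact: lt_trans pD. Qed.
Let D1 : 0 < D - 1. Proof. by rewrite subr_gt0 (lt_trans p1). Qed.
Let p10 : 0 < p - 1. Proof. by rewrite subr_gt0. Qed.
Let p'E : p' = p / (p - 1). Proof. exact: conjugate_exponentE. Qed.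
Let p'0 : 0 < p'. Proof. by rewrite p'E; positivity. Qed.
Let a0 : 0 < a. Proof. by rewrite /a; positivity. Qed.
Let b0 : 0 < b. Proof. by rewrite /b divr_gt0. Qed.
Let q0 : 0 < q. Proof. by rewrite /q; positivity. Qed.
Let aq : a * q = D. Proof. by rewrite /a /q; field; rewrite !gt_eqF. Qed.
Let ap : (a + 1) * p = D. Proof. by rewrite /a; field; rewrite !gt_eqF. Qed.
Let bp : (b - 2^-1) * p = b. Proof. by rewrite /b p'E; field; rewrite !gt_eqF. Qed.
Let abE : 2 * (a * b) = (D - p) / (p - 1).
Proof. by rewrite /a /b p'E; field; rewrite !gt_eqF. Qed.

Lemma enorm_powR_half (x : 'rV[R]_n.+1) c : enorm x `^ c = dotp x x `^ (c / 2).
Proof.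
rewrite -sqr_enorm -powR_mulrn ?enorm_ge0// -powRrM; congr (_ `^ _).
by rewrite mulrCA mulfV ?mulr1.
Qed.

Let d (m : nat) : R := m.+1%:R^-1.
Let d0 m : 0 < d m. Proof. by rewrite /d invr_gt0. Qed.
Let dz : d m @[m --> \oo] --> 0. Proof. exact: cvg_harmonic. Qed.

Definition extremal_cutoff (m : nat) (x : 'rV[R]_n.+1) : R := cutoff a b (d m) (dotp x x).

Let r0 (x : 'rV[R]_n.+1) : 0 <= dotp x x. Proof. exact: dotp_ge0. Qed.

Let dr0 m (x : 'rV[R]_n.+1) : 0 < d m + dotp x x. Proof. by rewrite ltr_wpDr. Qed.

Lemma grad_extremal_cutoff m x :
  grad (extremal_cutoff m) x = (2 * cutoff_slope a b (d m) (dotp x x)) *: x.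
Proof. by apply: grad_radial; exact: is_derive_cutoff. Qed.

Lemma enorm_grad_extremal_cutoff m x : enorm (grad (extremal_cutoff m) x) =
  2 * `|cutoff_slope a b (d m) (dotp x x)| * dotp x x `^ 2^-1.
Proof.
rewrite grad_extremal_cutoff enormZ normrM (ger0_norm (_ : 0 <= 2 :> R))//.
by rewrite -[enorm x]powRr1 ?enorm_ge0// enorm_powR_half mul1r.
Qed.

Lemma differentiable_extremal_cutoff m x : differentiable (extremal_cutoff m) x.
Proof. by apply: differentiable_radial (is_derive_cutoff _ _ (dr0 m x)). Qed.

Lemma grad_extremal_cutoff_continuous m : continuous (grad (extremal_cutoff m)).
Proof.
rewrite (_ : grad _ = fun x => (2 * cutoff_slope a b (d m) (dotp x x)) *: x); last first.
  by apply/funext => x; exact: grad_extremal_cutoff.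
move=> x.
have cs : {for x, continuous (fun x : 'rV[R]_n.+1 => 2 * cutoff_slope a b (d m) (dotp x x))}.
  apply: continuousM; first exact: cst_continuous.
  apply: (@continuous_comp _ _ _ (fun x : 'rV[R]_n.+1 => dotp x x) (cutoff_slope a b (d m))).
    exact: sqr_enorm_continuous.
  exact: cutoff_slope_continuous.
have ci : {for x, continuous (fun y : 'rV[R]_n.+1 => y)} by exact: cvg_id.
exact: (@continuousZ R 'rV[R]_n.+1 'rV[R]_n.+1 _ _ x cs ci).
Qed.

Lemma C1c_extremal_cutoff m : C1c_closure W (extremal_cutoff m).
Proof.
have cf : continuous (extremal_cutoff m).
  by move=> x; exact: differentiable_continuous (differentiable_extremal_cutoff m x).
split.
- exact: continuous_subspaceT.
- by move=> x _; exact: differentiable_extremal_cutoff.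
- exists (grad (extremal_cutoff m)) => //.
  exact: continuous_subspaceT (@grad_extremal_cutoff_continuous m).
- have [r1 r1P] := cutoff_support a0 b0 (d0 m).
  pose B := [set x : 'rV[R]_n.+1 | dotp x x <= r1].
  have cB : closed B.
    apply: (@closed_comp _ _ (fun x : 'rV[R]_n.+1 => dotp x x) [set u | u <= r1]); last exact: closed_le.
    by move=> x _; exact: sqr_enorm_continuous.
  apply: bounded_closed_compact; last exact: closed_closure.
  have sub : closure (closure W `&` [set x | extremal_cutoff m x != 0]) `<=` B.
    rewrite [X in _ `<=` X]((closure_id _).1 cB); apply: closureS => x [_ /= fx].
    rewrite /B /= leNgt; apply: contra fx => rx; apply/eqP.
    exact: r1P.
  exists (Num.sqrt r1); split; first exact: num_real.
  move=> M rM x /sub Bx; apply: le_trans (ltW rM).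
  by apply: (le_trans (norm_le_enorm x)); rewrite /enorm ler_wsqrtr.
Qed.

Let mW := cone_measurable cw.

Let mf m c : measurable_fun W (fun x => extremal_cutoff m x `^ c).
Proof.
apply: (measurableT_comp (measurable_powR _)).
apply: (continuous_rV_measurable (cw_open cw)) => x _.
exact: differentiable_continuous (differentiable_extremal_cutoff m x).
Qed.

Let mG m c : measurable_fun W (fun x => enorm (grad (extremal_cutoff m) x) `^ c).
Proof.
apply: (measurableT_comp (measurable_powR _)).
apply: (continuous_rV_measurable (cw_open cw)) => x _.
apply: (@continuous_comp _ _ _ (grad (extremal_cutoff m)) enorm).
  exact: grad_extremal_cutoff_continuous.
exact: enorm_continuous.
Qed.

Let mE c : measurable_fun W (fun x => (1 + enorm x `^ p') `^ c).
Proof.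
apply: (measurableT_comp (measurable_powR _)); apply: measurable_funD => //.
exact: measurable_enorm_powR.
Qed.

Let Eb (x : 'rV[R]_n.+1) : 1 + enorm x `^ p' = 1 + dotp x x `^ b.
Proof. by rewrite enorm_powR_half. Qed.

Lemma extremal_cutoff_mass :
  fine (wint W w (fun x => extremal_cutoff m x `^ q)) @[m --> \oo] --> J.
Proof.
suff : (wint W w (fun x => (extremal_cutoff m x `^ q)%R) @[m --> \oo] --> J%:E)%E by exact: fine_cvg.
rewrite /J -(wint_extremal cw W0 DE p1 pD pp').
apply: (wint_dominated cw (dom := fun x => (1 + enorm x `^ p') `^ (- D))) => //.
- by rewrite (wint_extremal cw W0 DE p1 pD pp') ltry.
- by move=> m x _; rewrite powR_ge0/= Eb; apply: (@cutoff_pow_le R a b D q) => //; exact: ltW.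
- move=> x _; rewrite Eb.
  have -> : (1 + dotp x x `^ b) `^ (- D) = ((1 + dotp x x `^ b) `^ (- a)) `^ q.
    by rewrite -powRrM mulNr aq.
  by apply: powR_cvg_gt0; [apply: powR_gt0; rewrite ltr_wpDr// powR_ge0|exact: cvg_cutoff].
Qed.

Lemma extremal_cutoff_slope_mass :
  fine (wint W w (fun x => enorm (grad (extremal_cutoff m) x) `^ p)) @[m --> \oo] -->
  ((D - p) / (p - 1)) `^ p * (J * (D * (p - 1) / (D - p))).
Proof.
have ab0 : 0 < 2 * (a * b) by apply: mulr_gt0 => //; exact: mulr_gt0.
have mS : measurable_fun W (fun x => enorm x `^ p' * (1 + enorm x `^ p') `^ (- D)).
  by apply: measurable_funM => //; exact: measurable_enorm_powR.
have S0 x : 0 <= enorm (x : 'rV[R]_n.+1) `^ p' * (1 + enorm x `^ p') `^ (- D).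
  by rewrite mulr_ge0 ?powR_ge0.
suff : (wint W w (fun x => (enorm (grad (extremal_cutoff m) x) `^ p)%R) @[m --> \oo] -->
  (((D - p) / (p - 1)) `^ p * (J * (D * (p - 1) / (D - p))))%:E)%E by exact: fine_cvg.
rewrite EFinM /J -(wint_extremal_slope cw W0 DE p1 pD pp') -(wintZ cw mS (powR_ge0 _ _))//.
rewrite -abE.
apply: (wint_dominated cw (dom := fun x => (2 * (a * b)) `^ p * (1 + enorm x `^ p') `^ (- (D - 1)))).
- by [].
- by apply: measurable_funM => //; exact: measurable_cst.
- by apply: measurable_funM => //; exact: measurable_cst.
- rewrite (wintZ cw (mE _) (powR_ge0 _ _)); last by move=> x _; exact: powR_ge0.
  by rewrite (wint_model cw W0 DE p1 pD pp') -EFinM ltry.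
- move=> m x _; rewrite powR_ge0/= Eb enorm_grad_extremal_cutoff.
  exact: (cutoff_slope_pow_le a0 b0 p0 D1 ap bp (d0 m) (r0 x)).
- move=> x _; rewrite Eb enorm_powR_half -/b.
  have [xz|xn0] := eqVneq (dotp x x) 0.
    rewrite [X in _ --> X](_ : _ = 0); last by rewrite xz powR0 ?mul0r ?mulr0// gt_eqF.
    apply: cvg_near_cst; apply: nearW => m; rewrite enorm_grad_extremal_cutoff xz.
    by rewrite powR0 ?mulr0 ?powR0 ?gt_eqF// invr_gt0.
  have xp : 0 < dotp x x by rewrite lt0r xn0 r0.
  under eq_fun do rewrite enorm_grad_extremal_cutoff.
  rewrite (cutoff_slope_limitE a0 b0 ap bp xp).
  apply: powR_cvg_gt0; first by clear -a0 b0 xp; positivity; rewrite ?ltr0n// ltr_wpDr// powR_ge0.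
  apply: cvgM; last exact: cvg_cst.
  apply: cvgM; first exact: cvg_cst.
  exact: cvg_cutoff_slope.
Qed.

Lemma le_ereal_limit (u : nat -> R) (l : R) (S : \bar R) :
  u m @[m --> \oo] --> l -> (\forall m \near \oo, ((u m)%:E <= S)%E) -> (l%:E <= S)%E.
Proof.
case: S => [s||] ul uS; last 2 first.
- exact: leey.
- have [m _ /(_ m (leqnn m))] := uS.
  by rewrite leeNy_eq.
rewrite lee_fin; apply: (closed_cvg (fun y => y <= s)) ul => //; exact: closed_le.
Qed.

(** The quotients of the truncated extremal profiles converge to the constant that
[sobolev_quotient_le] allows. *)
Theorem sobolev_best_constantE : sobolev_best_constant Phip k W p q = C%:E.
Proof.
apply/eqP; rewrite eq_le; apply/andP; split.
  apply: ge_ereal_sup => _ [f [fC _] <-].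
  exact: (sobolev_quotient_le cw W0 DE p1 pD pp').
have J0 : 0 < J by exact: (extremal_mass_gt0 cw W0 DE p1 pD pp').
pose A := ((D - p) / (p - 1)) `^ p * (J * (D * (p - 1) / (D - p))).
have A0 : 0 < A by rewrite /A; positivity.
pose Q m := fine (wint W w (fun x => extremal_cutoff m x `^ q)).
pose P m := fine (wint W w (fun x => enorm (grad (extremal_cutoff m) x) `^ p)).
have QJ : Q m @[m --> \oo] --> J := extremal_cutoff_mass.
have PA : P m @[m --> \oo] --> A := extremal_cutoff_slope_mass.
have nQ : \forall m \near \oo, 0 < Q m by exact: (cvgr_gt J QJ).
have nP : \forall m \near \oo, 0 < P m by exact: (cvgr_gt A PA).
apply: (@le_ereal_limit (fun m => Q m `^ q^-1 / P m `^ p^-1)).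
  have -> : C = J `^ q^-1 / A `^ p^-1.
    rewrite /q (sharp_constant_attained cw W0 DE p1 pD pp') -/A mulfK//.
    by rewrite gt_eqF// powR_gt0.
  apply: cvgM; first exact: powR_cvg_gt0 QJ.
  by apply: cvgV; [rewrite gt_eqF// powR_gt0|exact: powR_cvg_gt0 PA].
apply: filterS (filterI nQ nP) => m [/= Qm Pm].
have fC := C1c_extremal_cutoff m.
have absf : (fun x => `|extremal_cutoff m x| `^ q) = (fun x => extremal_cutoff m x `^ q).
  by apply/funext => x; rewrite ger0_norm ?cutoff_ge0.
have absG : (fun x => `|enorm (grad (extremal_cutoff m) x)| `^ p) =
    (fun x => enorm (grad (extremal_cutoff m) x) `^ p).
  by apply/funext => x; rewrite ger0_norm ?enorm_ge0.
have [rho [M [L pf]]] := profile_of_C1c cw fC.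
have Qfin : (wint W w (fun x => `|extremal_cutoff m x| `^ q)%R < +oo)%E.
  apply: (wint_pow_lty cw (M := M) q0 (measurable_profile cw pf)); last exact: (pf_supp pf).
  by move=> x Wx; rewrite normr_ge0 (pf_bound pf Wx).
have Pfin : (wint W w (fun x => enorm (grad (extremal_cutoff m) x) `^ p)%R < +oo)%E.
  apply: (wint_pow_lty cw (M := L) p0 (pf_gmeas pf)); last exact: (pf_gsupp pf).
  by move=> x Wx; rewrite enorm_ge0 (pf_gbound pf Wx).
apply: ereal_sup_ubound; exists (extremal_cutoff m); last first.
  rewrite (Lnorm_mu_k_EFin cw Qfin) (Lnorm_mu_k_EFin cw) absG// absf inver.
  by rewrite ifN ?EFinM// gt_eqF// powR_gt0.
split => //; apply: contrapT => fz; move: Qm; rewrite /Q.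
have -> : wint W w (fun x => extremal_cutoff m x `^ q) = 0%E.
  rewrite /wint integral0_eq// => x Wx.
  have [->|fx] := eqVneq (extremal_cutoff m x) 0; first by rewrite powR0 ?gt_eqF// mul0r.
  by case: fz; exists x => //; exact: subset_closure.
by rewrite ltxx.
Qed.
End extremal_sequence.

(** * Simple roots and words in their reflections *)

Section reflections.
Context {R : realType} {N : nat}.
Implicit Types (a b x y z : 'rV[R]_N) (s t : seq 'rV[R]_N) (M : 'M[R]_N).

(** Reflections in the vectors of squared norm two. *)
Definition refl a x := x - dotp a x *: a.

Definition act s x := foldl (fun y a => refl a y) x s.

Lemma refl_linear a c x y : refl a (x - c *: y) = refl a x - c *: refl a y.
Proof.
rewrite /refl dotpBr dotpZr scalerBl scalerBr scalerA -!addrA; congr (_ + _).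
by rewrite !opprB addrCA [RHS]addrC addrA.
Qed.

Lemma act_linear s c x y : act s (x - c *: y) = act s x - c *: act s y.
Proof. by elim: s x y => [//|a s IH] x y /=; rewrite refl_linear IH. Qed.

Lemma refl_self a : dotp a a = 2 -> refl a a = - a.
Proof. by move=> aa; rewrite /refl aa scaler_nat mulr2n opprD addrA subrr add0r. Qed.

Lemma reflK a : dotp a a = 2 -> involutive (refl a).
Proof.
move=> aa x; rewrite [X in refl _ X]/refl refl_linear refl_self// scalerN opprK.
by rewrite /refl subrK.
Qed.

Lemma dotp_refl a x y : dotp a a = 2 -> dotp (refl a x) (refl a y) = dotp x y.
Proof.
move=> aa; rewrite /refl dotpBl !dotpBr !dotpZr !dotpZl aa (dotpC x a); ring.
Qed.

Lemma dotp_reflC a x y : dotp a a = 2 -> dotp x (refl a y) = dotp (refl a x) y.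
Proof. by move=> aa; rewrite -(dotp_refl _ y aa) reflK. Qed.

Lemma act_cat s t x : act (s ++ t) x = act t (act s x).
Proof. by rewrite /act foldl_cat. Qed.

Lemma act_rcons s a x : act (rcons s a) x = refl a (act s x).
Proof. by rewrite -cats1 act_cat. Qed.

Definition norm2 s := forall a, a \in s -> dotp a a = 2.

Lemma norm2_cons a s : norm2 (a :: s) -> dotp a a = 2 /\ norm2 s.
Proof. by move=> h; split=> [|b bs]; apply: h; rewrite inE ?eqxx// bs orbT. Qed.

Lemma norm2_rev s : norm2 s -> norm2 (rev s).
Proof. by move=> h a; rewrite mem_rev; exact: h. Qed.

Lemma dotp_act s x y : norm2 s -> dotp (act s x) (act s y) = dotp x y.
Proof.
elim: s x y => [//|a s IH] x y /norm2_cons[aa ns] /=.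
by rewrite IH// dotp_refl.
Qed.

Lemma act_revK s : norm2 s -> cancel (act s) (act (rev s)).
Proof.
elim: s => [//|a s IH] /norm2_cons[aa ns] x /=.
by rewrite rev_cons act_rcons IH// reflK.
Qed.

Lemma act_revKV s : norm2 s -> cancel (act (rev s)) (act s).
Proof. by move=> ns x; have := act_revK (norm2_rev ns) x; rewrite revK. Qed.

Lemma dotp_actC s x y : norm2 s -> dotp x (act s y) = dotp (act (rev s) x) y.
Proof. by move=> ns; rewrite -(dotp_act _ y ns) act_revKV. Qed.

(** Conjugating a reflection by an isometry reflects in the image vector. *)
Lemma act_conj s a y : norm2 s -> act (rev s) (refl (act s a) y) = refl a (act (rev s) y).
Proof.
move=> ns; rewrite {1}/refl act_linear act_revK// /refl; congr (_ - _ *: _).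
by rewrite dotp_actC ?revK//; exact: norm2_rev.
Qed.
End reflections.

Lemma seq_argmax (R : realType) (T : eqType) (f : T -> R) (s : seq T) x : x \in s ->
  exists2 a, a \in s & forall b, b \in s -> f b <= f a.
Proof.
elim: s x => [//|y s IH] x _.
case: s IH => [_|z s IH]; first by exists y; rewrite ?inE// => b; rewrite inE => /eqP->.
have [a az aP] := IH z (mem_head _ _).
have [ya|ay] := leP (f y) (f a).
  exists a; first by rewrite inE az orbT.
  by move=> b; rewrite inE => /orP[/eqP->//|]; exact: aP.
exists y; first by rewrite mem_head.
by move=> b; rewrite inE => /orP[/eqP->//|/aP ba]; exact: le_trans ba (ltW ay).
Qed.

Section chambers.
Context {R : realType} {N : nat} (Phi : {fset 'rV[R]_N}) (x0 : 'rV[R]_N).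
Implicit Types (a b x y z : 'rV[R]_N) (s t : seq 'rV[R]_N).
Context (norm_Phi : forall a, a \in Phi -> dotp a a = 2).
Context (refl_Phi : forall a b, a \in Phi -> b \in Phi -> refl a b \in Phi).

Definition regular z := forall a, a \in Phi -> dotp a z != 0.

Context (x0_regular : regular x0).

Definition positive a := (a \in Phi) && (0 < dotp a x0).

Definition simple a := positive a /\ forall b, positive b -> b != a -> positive (refl a b).

Definition chamber_of z := forall a, positive a -> 0 < dotp a z.

Let simples s := forall a, a \in s -> simple a.

Lemma simple_norm2 s : simples s -> norm2 s.
Proof. by move=> ss a /ss[/andP[aP _] _]; exact: norm_Phi. Qed.

Lemma opp_Phi a : a \in Phi -> - a \in Phi.
Proof. by move=> aP; rewrite -(refl_self (norm_Phi aP)); exact: refl_Phi. Qed.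

Lemma root_sign a : a \in Phi -> positive a \/ positive (- a).
Proof.
move=> aP; have := x0_regular aP; rewrite neq_lt => /orP[h|h]; [right|left].
  by rewrite /positive opp_Phi// dotpNl oppr_gt0.
by rewrite /positive aP.
Qed.

Lemma dotp_lt2 a b : a \in Phi -> b \in Phi -> b != a -> dotp a b < 2.
Proof.
move=> aP bP ba; have h : dotp (b - a) (b - a) = 4 - 2 * dotp a b.
  rewrite dotpBl !dotpBr !norm_Phi// (dotpC b a); ring.
have := dotp_ge0 (b - a); rewrite le0r => /orP[/eqP/dotp_eq0/eqP|].
  by rewrite subr_eq0 (negPf ba).
rewrite h; lra.
Qed.

(** A positive root of largest ratio [- <a, y> / <a, x0>], and among these of
smallest height [<a, x0>], is simple: if [s_a b] were negative, then
[<a, b> a = b - s_a b] would write [a] in terms of two positive roots, whose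
ratios, and then heights, are all equal to those of [a], and [<a, b>] would be
at least two. *)
Lemma simple_separates y b : positive b -> dotp b y < 0 ->
  exists2 a, simple a & dotp a y < 0.
Proof.
move=> pb by0; pose rho a := - dotp a y / dotp a x0.
pose P := [seq a <- enum_fset Phi | positive a].
have inP a : (a \in P) = positive a by rewrite mem_filter andb_idr// => /andP[].
have bP : b \in P by rewrite inP.
have [a1 a1P a1max] := seq_argmax rho bP.
have a1Q : a1 \in [seq a <- P | rho a == rho a1] by rewrite mem_filter eqxx a1P.
have [a aQ amin] := seq_argmax (fun a => - dotp a x0) a1Q.
move: aQ; rewrite mem_filter => /andP[/eqP rhoa]; rewrite inP => pa.
have amax c : positive c -> rho c <= rho a by rewrite -inP rhoa; exact: a1max.
have hmin c : positive c -> rho c = rho a -> dotp a x0 <= dotp c x0.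
  move=> pc rc; rewrite -lerN2; apply: amin.
  by rewrite mem_filter inP pc rc rhoa eqxx.
have /andP[aPhi ax0] := pa; have /andP[bPhi bx0] := pb.
have rhoy c : positive c -> - dotp c y = rho c * dotp c x0.
  by move=> /andP[_ cx]; rewrite /rho divfK// gt_eqF.
have rpos : 0 < rho a.
  by apply: lt_le_trans (amax _ pb); rewrite divr_gt0// oppr_gt0.
exists a; last by rewrite -oppr_gt0 rhoy// mulr_gt0.
split => // c pc ca; have /andP[cPhi cx0] := pc.
have sPhi : refl a c \in Phi by exact: refl_Phi.
have [//|pd] := root_sign sPhi.
set d := - refl a c in pd; have /andP[dPhi dx0] := pd.
have dE v : dotp d v = dotp a c * dotp a v - dotp c v.
  by rewrite /d /refl dotpNl dotpBl dotpZl; ring.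
have hx := dE x0; have hy := dE y.
have ry := rhoy _ pa; have rc := rhoy _ pc; have rd := rhoy _ pd.
have mc := amax _ pc; have md := amax _ pd.
have key : (rho a - rho c) * dotp c x0 + (rho a - rho d) * dotp d x0 = 0.
  transitivity (rho a * (dotp c x0 + dotp d x0) - (rho c * dotp c x0 + rho d * dotp d x0)).
    by ring.
  rewrite -rc -rd hx hy (_ : dotp c x0 + _ = dotp a c * dotp a x0); last by ring.
  by rewrite mulrCA -ry; ring.
have k1 : 0 <= (rho a - rho c) * dotp c x0 by rewrite mulr_ge0 ?subr_ge0// ltW.
have k2 : 0 <= (rho a - rho d) * dotp d x0 by rewrite mulr_ge0 ?subr_ge0// ltW.
have rca : rho c = rho a.
  have /eqP : (rho a - rho c) * dotp c x0 = 0 by lra.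
  by rewrite mulf_eq0 (gt_eqF cx0) orbF subr_eq0 => /eqP.
have rda : rho d = rho a.
  have /eqP : (rho a - rho d) * dotp d x0 = 0 by lra.
  by rewrite mulf_eq0 (gt_eqF dx0) orbF subr_eq0 => /eqP.
have h1 := hmin _ pc rca; have h2 := hmin _ pd rda.
have : dotp a c * dotp a x0 < 2 * dotp a x0 by rewrite ltr_pM2r// dotp_lt2.
by rewrite (_ : dotp a c * dotp a x0 = dotp c x0 + dotp d x0); [lra|rewrite hx; ring].
Qed.

Lemma regular_refl a z : a \in Phi -> regular z -> regular (refl a z).
Proof. by move=> aP rz b bP; rewrite dotp_reflC ?norm_Phi//; apply: rz; exact: refl_Phi. Qed.

Let negatives z := [seq b <- enum_fset Phi | positive b && (dotp b z < 0)].

Lemma negatives_refl a z : simple a -> dotp a z < 0 ->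
  (size (negatives (refl a z)) < size (negatives z))%N.
Proof.
move=> [pa sa] az; have /andP[aPhi _] := pa; have aa := norm_Phi aPhi.
have ain : a \in negatives z by rewrite mem_filter pa az/= aPhi.
apply: (@leq_ltn_trans (size (rem a (negatives z)))); last first.
  by rewrite size_rem// prednK// -has_predT; apply/hasP; exists a.
rewrite -(size_map (refl a)); apply: uniq_leq_size.
  rewrite map_inj_uniq; first by rewrite filter_uniq// fset_uniq.
  exact: inv_inj (reflK aa).
move=> _ /mapP[b bin ->]; move: bin; rewrite mem_filter => /andP[/andP[pb bz] bPhi].
have ba : b != a.
  apply/eqP => ba; move: bz; rewrite ba dotp_reflC// refl_self// dotpNl oppr_lt0.
  by rewrite ltNge (ltW az).
have srb := sa _ pb ba; have /andP[sPhi _] := srb.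
rewrite mem_rem_uniq ?filter_uniq ?fset_uniq// inE mem_filter srb sPhi/= andbT.
rewrite -dotp_reflC// bz andbT; apply/eqP => e.
have bE : b = - a by rewrite -(reflK aa b) e refl_self.
by move: pb; rewrite bE => /andP[_]; rewrite dotpNl oppr_gt0; move: pa => /andP[_ /ltW]; rewrite leNgt => /negP.
Qed.

(** Reflecting in a simple root that separates [z] from the chamber removes
exactly that root from those separating them. *)
Lemma chamber_transitive z : regular z -> exists2 s, simples s & chamber_of (act s z).
Proof.
have [m] := ubnP (size (negatives z)); elim: m z => // m IH z zm rz.
have [nz|] := eqVneq (negatives z) [::].
  exists [::] => // a pa /=; have /andP[aPhi _] := pa.
  rewrite lt_neqAle eq_sym rz//= leNgt; apply/negP => az.
  by have : a \in negatives z; [rewrite mem_filter pa az|rewrite nz].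
case E : (negatives z) => [//|b r] _.
have : b \in negatives z by rewrite E mem_head.
rewrite mem_filter => /andP[/andP[pb bz] _].
have [a sa az] := simple_separates pb bz.
have aPhi : a \in Phi by have [/andP[]] := sa.
have [] := IH (refl a z).
- by apply: leq_trans (negatives_refl sa az) _; rewrite -ltnS.
- exact: regular_refl.
move=> s ss cs; exists (a :: s) => // c; rewrite inE => /orP[/eqP->//|]; exact: ss.
Qed.

(** Among the positive roots, a simple reflection makes only its own simple root
negative; so [u] has become that root just before the step that makes it negative. *)
Lemma exchange s u : simples s -> positive u -> ~ positive (act s u) ->
  exists s1 b s2, s = s1 ++ b :: s2 /\ act s1 u = b.
Proof.
elim: s u => [//|c s IH] u ss pu nu.
have sc : simple c by apply: ss; exact: mem_head.
have [->|uc] := eqVneq u c; first by exists [::], c, s.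
have ss' : simples s by move=> d ds; apply: ss; rewrite inE ds orbT.
have [s1 [b [s2 [-> e]]]] := IH (refl c u) ss' (sc.2 _ pu uc) nu.
by exists (c :: s1), b, s2.
Qed.

(** The exchange condition shortens by two any word in the simple reflections
that maps some point of the chamber into it. *)
Lemma chamber_free s z : simples s -> chamber_of z -> chamber_of (act s z) ->
  forall x, act s x = x.
Proof.
have [m] := ubnP (size s); elim: m s => // m IH s sm ss cz csz x.
case/lastP: s sm ss csz => [//|t a] sm ss csz.
have sa : simple a by apply: ss; rewrite mem_rcons mem_head.
have st : simples t by move=> b bt; apply: ss; rewrite mem_rcons inE bt orbT.
have /andP[aPhi _] := sa.1; have aa := norm_Phi aPhi; have nt := simple_norm2 st.
have srt : simples (rev t) by move=> b; rewrite mem_rev; exact: st.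
have na : ~ positive (act (rev t) a).
  move=> pu; have := cz _ pu; rewrite -dotp_actC// => h.
  have := csz _ sa.1; rewrite act_rcons dotp_reflC// refl_self// dotpNl oppr_gt0.
  by rewrite ltNge (ltW h).
have [r1 [b [r2 [tE bE]]]] := exchange srt sa.1 na.
have {}tE : t = rev r2 ++ b :: rev r1 by rewrite -[t]revK tE rev_cat rev_cons cat_rcons.
have nr1 : norm2 r1.
  by move=> c cr; apply: nt; rewrite tE mem_cat inE !mem_rev cr !orbT.
have wE y : act (rcons t a) y = act (rev r2 ++ rev r1) y.
  by rewrite act_rcons tE !act_cat /= -bE act_conj// reflK.
rewrite wE; apply: IH => //.
- move: sm; rewrite size_rcons tE !size_cat /= addnS !ltnS => h.
  by apply: leq_trans h; rewrite leqnSn.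
- move=> c cr; apply: st; rewrite tE; move: cr; rewrite !mem_cat inE.
  by move=> /orP[->//|->]; rewrite !orbT.
- by rewrite -wE.
Qed.

(** A positive root that is not simple is lowered by some simple reflection, to
which its own reflection is conjugate. *)
Lemma refl_simple_word b : b \in Phi -> exists2 s, simples s & forall x, refl b x = act s x.
Proof.
have pos c : positive c -> exists2 s, simples s & forall x, refl c x = act s x.
  pose lower c := [seq d <- enum_fset Phi | dotp d x0 < dotp c x0].
  have [m] := ubnP (size (lower c)); elim: m c => // m IH c cm pc.
  have /andP[cPhi cx0] := pc; have cc := norm_Phi cPhi.
  have [] := @simple_separates (- c) c pc; first by rewrite dotpNr cc oppr_lt0.
  move=> a sa; rewrite dotpNr oppr_lt0 => ac.
  have /andP[aPhi ax0] := sa.1; have aa := norm_Phi aPhi.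
  have [->|ca] := eqVneq c a.
    by exists [:: a] => // d; rewrite inE => /eqP->.
  have pe := sa.2 _ pc ca; have /andP[ePhi _] := pe.
  have ex0 : dotp (refl a c) x0 < dotp c x0.
    by rewrite /refl dotpBl dotpZl ltrBlDr ltrDl mulr_gt0.
  have [] := IH (refl a c) _ pe.
    apply: leq_trans (_ : (size (lower (refl a c)) < size (lower c))%N) _; last by rewrite -ltnS.
    have ein : refl a c \in lower c by rewrite mem_filter ex0 ePhi.
    apply: (@leq_ltn_trans (size (rem (refl a c) (lower c)))); last first.
      by rewrite size_rem// prednK// -has_predT; apply/hasP; exists (refl a c).
    apply: uniq_leq_size; first by rewrite filter_uniq// fset_uniq.
    move=> d; rewrite mem_filter => /andP[dx dPhi].
    rewrite mem_rem_uniq ?filter_uniq ?fset_uniq// inE mem_filter dPhi (lt_trans dx ex0) !andbT.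
    by apply/eqP => de; move: dx; rewrite de ltxx.
  move=> s ss sE; exists (a :: rcons s a).
    move=> d; rewrite inE mem_rcons inE => /orP[/eqP->//|/orP[/eqP->//|]]; exact: ss.
  move=> x /=; rewrite act_rcons -sE.
  have := @act_conj _ _ [:: a] c (refl a x); rewrite /= reflK// => -> //.
  by move=> d; rewrite inE => /eqP->.
move=> bP; have [/pos//|/pos[s ss sE]] := root_sign bP.
by exists s => // x; rewrite -sE /refl dotpNl scalerN opprK scaleNr.
Qed.

Lemma act_simple_word t : {subset t <= Phi} ->
  exists2 s, simples s & forall x, act t x = act s x.
Proof.
elim: t => [|b t IH] tP; first by exists [::].
have [s ss sE] := IH (fun c ct => tP c (@mem_behead _ (b :: t) c ct)).
have [r rs rE] := refl_simple_word (tP b (mem_head _ _)).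
exists (r ++ s); first by move=> c; rewrite mem_cat => /orP[/rs|/ss].
by move=> x; rewrite act_cat /= rE sE.
Qed.
End chambers.

(** * The action of the reflection group on the chambers *)

Section reflection_groups.
Context {R : realType} {N : nat} (Phi : {fset 'rV[R]_N}).
Implicit Types (a b x y z : 'rV[R]_N) (s t : seq 'rV[R]_N) (M : 'M[R]_N).
Context (Phi_root : root_system Phi) (Phi_norm : forall a, a \in Phi -> enorm a ^+ 2 = 2).

Lemma root_dotp2 a : a \in Phi -> dotp a a = 2.
Proof. by move=> aP; rewrite -sqr_enorm Phi_norm. Qed.

Lemma reflectionE a x : dotp a a = 2 -> reflection a x = refl a x.
Proof. by move=> aa; rewrite /reflection /refl aa mulrCA mulfV ?mulr1. Qed.

Lemma root_refl_closed a b : a \in Phi -> b \in Phi -> refl a b \in Phi.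
Proof.
move=> aP bP; have [_ _ /(_ a aP) E] := Phi_root.
have : (reflection a @` [set` Phi]) (reflection a b) by exists b.
by rewrite E /= reflectionE ?root_dotp2.
Qed.

Lemma mulmx_reflection a x : dotp a a = 2 -> x *m lin1_mx (reflection a) = refl a x.
Proof.
move=> aa; apply/rowP => j; rewrite !mxE.
have E i : lin1_mx (reflection a) i j = (i == j)%:R - a ord0 i * a ord0 j.
  rewrite mxE reflectionE// !mxE eqxx /= eq_sym; congr (_ - _ * _).
  rewrite /dotp (bigD1 i)//= mxE !eqxx mulr1 big1 ?addr0// => l li.
  by rewrite mxE (negPf li) andbF mulr0.
under eq_bigr do rewrite E mulrBr.
rewrite sumrB; congr (_ - _).
  rewrite (bigD1 j)//= eqxx mulr1 big1 ?addr0// => l lj.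
  by rewrite (negPf lj) mulr0.
by rewrite /dotp mulr_suml; apply: eq_bigr => i _; ring.
Qed.

Definition wordmx s : 'M[R]_N := foldr (fun a M => lin1_mx (reflection a) *m M) 1%:M s.

Lemma mulmx_word s x : {subset s <= Phi} -> x *m wordmx s = act s x.
Proof.
elim: s x => [|a s IH] x sP /=; first by rewrite mulmx1.
rewrite mulmxA mulmx_reflection; last by rewrite root_dotp2// sP// mem_head.
by apply: IH => b bs; rewrite sP// inE bs orbT.
Qed.

Lemma eq_mulmx M M' : (forall x, x *m M = x *m M') -> M = M'.
Proof. by move=> h; apply/row_matrixP => i; rewrite !rowE. Qed.

Lemma word_norm2 s : {subset s <= Phi} -> norm2 s.
Proof. by move=> sP a /sP; exact: root_dotp2. Qed.

Lemma word_rev s : {subset s <= Phi} -> {subset rev s <= Phi}.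
Proof. by move=> sP a; rewrite mem_rev; exact: sP. Qed.

Lemma wordmx_rev s : {subset s <= Phi} -> wordmx s *m wordmx (rev s) = 1%:M.
Proof.
move=> sP; apply: eq_mulmx => x; rewrite mulmxA !mulmx_word//; last exact: word_rev.
by rewrite mulmx1 act_revK//; exact: word_norm2.
Qed.

Lemma wordmx_cat s t : {subset s <= Phi} -> {subset t <= Phi} ->
  wordmx (s ++ t) = wordmx s *m wordmx t.
Proof.
move=> sP tP; apply: eq_mulmx => x; rewrite mulmxA !mulmx_word//; first by rewrite act_cat.
by move=> a; rewrite mem_cat => /orP[/sP|/tP].
Qed.

Lemma reflection_groupP M :
  reflection_group Phi M <-> exists2 s, {subset s <= Phi} & M = wordmx s.
Proof.
split; last first.
  move=> [s sP ->] A [[uA A1 AM AV] GA].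
  elim: s sP => [//|a s IH] sP /=; apply: AM.
    by apply: GA; exists a => //; exact: sP (mem_head _ _).
  by apply: IH => b bs; rewrite sP// inE bs orbT.
suff : reflection_group Phi `<=` [set M | exists2 s : seq 'rV[R]_N, {subset s <= Phi} & M = wordmx s].
  by apply.
apply: smallest_sub.
  split.
  - by move=> M1 [s sP ->] /=; have /mulmx1_unit[] := wordmx_rev sP.
  - by exists [::].
  - move=> M1 M2 [s sP ->] [t tP ->]; exists (s ++ t); last by rewrite wordmx_cat.
    by move=> a; rewrite mem_cat => /orP[/sP|/tP].
  - move=> M1 [s sP ->]; exists (rev s); first exact: word_rev.
    have E := wordmx_rev sP; have /mulmx1_unit[u _] := E.
    by rewrite -[LHS]mulmx1 -E mulmxA mulVmx// mul1mx.
move=> _ [a aP <-]; exists [:: a]; last by rewrite /= mulmx1.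
by move=> b; rewrite inE => /eqP->.
Qed.

Context (x0 : 'rV[R]_N) (x0_regular : regular Phi x0).
Local Notation W := (chamber_of Phi x0).

Lemma x0_chamber : W x0. Proof. by move=> a /andP[]. Qed.

Lemma chamber_exists z : regular Phi z -> exists2 M, reflection_group Phi M & W (z *m M).
Proof.
move=> rz; have [s ss sW] := chamber_transitive root_dotp2 root_refl_closed x0_regular rz.
have sP : {subset s <= Phi} by move=> a /ss[/andP[]].
by exists (wordmx s); [apply/reflection_groupP; exists s|rewrite mulmx_word].
Qed.

Lemma chamber_stabilizer M z : reflection_group Phi M -> W z -> W (z *m M) -> M = 1%:M.
Proof.
move=> /reflection_groupP[t tP ->] Wz; rewrite mulmx_word// => Wtz.
have [s ss sE] := act_simple_word root_dotp2 root_refl_closed x0_regular tP.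
apply: eq_mulmx => x; rewrite mulmx_word// mulmx1 sE.
by apply: (chamber_free root_dotp2 ss Wz); rewrite -sE.
Qed.

Lemma chamber_unique M M' z : reflection_group Phi M -> reflection_group Phi M' ->
  W (z *m M) -> W (z *m M') -> M = M'.
Proof.
move=> /reflection_groupP[s sP ->] /reflection_groupP[t tP ->] Wz Wz'.
have rP := word_rev sP.
have : wordmx (rev s ++ t) = 1%:M.
  apply: (chamber_stabilizer (z := z *m wordmx s)) => //.
    apply/reflection_groupP; exists (rev s ++ t) => // a.
    by rewrite mem_cat => /orP[/rP|/tP].
  by rewrite wordmx_cat// mulmxA -(mulmxA z) wordmx_rev// mulmx1.
rewrite wordmx_cat// => E.
by rewrite -[LHS]mulmx1 -E mulmxA wordmx_rev// mul1mx.
Qed.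

(** An element is determined by the signs that the roots take at the image of
[x0]. *)
Lemma reflection_group_finite : finite_set (reflection_group Phi).
Proof.
pose sg M := [fset a in Phi | 0 < dotp a (x0 *m M)]%fset.
have inj : {in reflection_group Phi &, injective sg}.
  move=> M M'; rewrite !inE => gM gM'.
  move: gM gM' => /reflection_groupP[s sP ->] /reflection_groupP[t tP ->] e.
  have rP := word_rev tP.
  have srP : {subset s ++ rev t <= Phi} by move=> a; rewrite mem_cat => /orP[/sP|/rP].
  have E : wordmx (s ++ rev t) = 1%:M.
    apply: (chamber_stabilizer (z := x0)); [|exact: x0_chamber|].
      by apply/reflection_groupP; exists (s ++ rev t).
    move=> a /andP[aP ax0]; rewrite mulmx_word// act_cat.
    rewrite dotp_actC ?revK; last exact/word_norm2.
    have bP : act t a \in Phi.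
      elim: t a tP aP {e rP srP ax0} => [//|b t IH] a tP aP /=.
      apply: IH; first by move=> c ct; rewrite tP// inE ct orbT.
      by apply: root_refl_closed => //; exact: tP (mem_head _ _).
    have : act t a \in sg (wordmx t).
      by rewrite !inE bP mulmx_word//= dotp_act//; exact: word_norm2.
    by rewrite -e !inE mulmx_word// => /andP[].
  move: E; rewrite wordmx_cat// => E.
  by rewrite -[LHS]mulmx1 -(mulmx1C (wordmx_rev tP)) mulmxA E mul1mx.
suff : finite_set (sg @` reflection_group Phi).
  by rewrite (eq_finite_set (inj_card_eq inj)).
apply: (@sub_finite_set _ _ [set` fpowerset Phi]); last exact: finite_fset.
by move=> _ [M _ <-] /=; rewrite fpowersetE; apply/fsubsetP => a; rewrite !inE => /andP[].
Qed.

Lemma sum_chamber z (u : \bar R) : regular Phi z ->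
  (\sum_(M <- fset_set (reflection_group Phi)) (if `[< W (z *m M) >] then u else 0) = u)%E.
Proof.
move=> /chamber_exists[M gM WM].
rewrite (bigD1_seq M) ?fset_uniq//=; last by rewrite in_fset_set ?inE//; exact: reflection_group_finite.
rewrite asboolT// big_seq_cond big1 ?adde0// => M' /andP[M'G M'M].
rewrite asboolF// => WM'; move/eqP: M'M; apply.
apply: (chamber_unique _ gM WM' WM).
by move: M'G; rewrite in_fset_set ?inE//; exact: reflection_group_finite.
Qed.
End reflection_groups.

(** * Invariance of Lebesgue measure under reflections *)

Section isometry_invariance.
Context {R : realType} {n : nat}.
Implicit Types (a b x y : 'rV[R]_n) (s : seq 'rV[R]_n) (F : 'rV[R]_n -> \bar R).

Lemma measurable_rV_add d (T : measurableType d) (f h : T -> 'rV[R]_n) :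
  measurable_fun setT f -> measurable_fun setT h ->
  measurable_fun setT (fun z => f z + h z).
Proof.
move=> mf mh; apply: measurable_fun_rVP => i; under eq_fun do rewrite mxE.
by apply: measurable_funD; apply: (measurableT_comp (measurable_coor i)).
Qed.

Lemma measurable_refl a : measurable_fun setT (refl a).
Proof.
apply: measurable_fun_rVP => i.
rewrite (_ : (fun x => _) = (fun x => x ord0 i - dotp a x * a ord0 i)); last first.
  by apply/funext => x; rewrite !mxE.
apply: measurable_funB; first exact: measurable_coor.
by apply: measurable_funM => //; exact: measurable_dotp.
Qed.

Lemma measurable_opp_refl a : measurable_fun setT (fun y => - refl a y).
Proof.
rewrite (_ : (fun y => _) = (fun y => (-1) *: refl a y + 0)); last first.
  by apply/funext => y; rewrite scaleN1r addr0.
exact: (measurableT_comp (measurable_rV_affine (-1) 0) (measurable_refl a)).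
Qed.

Lemma measurable_act s : measurable_fun setT (act s).
Proof.
elim: s => [|a s IH]; first exact: measurable_id.
exact: (measurableT_comp IH (measurable_refl a)).
Qed.

Lemma enorm_refl a x : dotp a a = 2 -> enorm (refl a x) = enorm x.
Proof. by move=> aa; rewrite /enorm dotp_refl. Qed.

Lemma reflD a x y : refl a (x + y) = refl a x + refl a y.
Proof. by rewrite /refl dotpDr scalerDl opprD addrACA. Qed.

Lemma refl_shift a x y : dotp a a = 2 -> refl a (y + refl a (x - refl a y)) = x.
Proof. by move=> aa; rewrite reflD reflK// subrKC. Qed.

Lemma refl_shiftN a x y : dotp a a = 2 -> x - refl a (y + refl a x) = - refl a y.
Proof. by move=> aa; rewrite reflD reflK// opprD addrCA subrr addr0. Qed.

(** The measure is determined by its invariance under translations and its value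
on the Euclidean ball: for the reflection $S$ and an $S$-invariant function $h$,
Tonelli's theorem and translations give $\int G \int h = \int h \int G(-Sx)\,dx$,
and $h$ can be the indicator of the unit ball. *)
Lemma integral_refl a F : dotp a a = 2 -> measurable_fun setT F -> (forall x, 0 <= F x)%E ->
  (\int[lebesgue_rV n]_x F (refl a x) = \int[lebesgue_rV n]_x F x)%E.
Proof.
move=> aa mF F0.
pose h x : \bar R := ((if enorm x < 1 then 1 else 0) : R)%:E.
have mh : measurable_fun setT h by apply/measurable_EFinP; exact: measurable_ball_indicator.
have h0 x : (0 <= h x)%E by rewrite /h; case: ifP; rewrite lee_fin.
have hE x : h (refl a x) = h x by rewrite /h enorm_refl.
have hint : (\int[lebesgue_rV n]_x h x)%E = lebesgue_rV n [set x | enorm x < 1].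
  rewrite -[RHS]mul1e -integral_cst; last exact: measurable_eball.
  rewrite [RHS]integral_mkcond; apply: eq_integral => x _.
  by rewrite patchE /h; case: ifPn => x1; [rewrite mem_set|rewrite memNset//; exact/negP].
have hpos : (0 < \int[lebesgue_rV n]_x h x)%E.
  rewrite hint; apply: open_rV_gt0; last by exists 0; rewrite /= enorm0.
  apply: (@open_comp _ _ (enorm : 'rV[R]_n -> R) [set u | u < 1]); last exact: open_lt.
  by move=> x _; exact: enorm_continuous.
have hfin : (\int[lebesgue_rV n]_x h x < +oo)%E by rewrite hint; exact: eball_finite.
clear hint; clearbody h.
have mr := measurable_refl a.
have Zl (k : \bar R) (phi : 'rV[R]_n -> \bar R) : measurable_fun setT phi ->
    (forall x, 0 <= phi x)%E -> (0 <= k)%E ->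
    (\int[lebesgue_rV n]_x (k * phi x) = k * \int[lebesgue_rV n]_x phi x)%E.
  by move=> mphi phi0 k0; apply: ge0_integralZl => // x _; exact: phi0.
have key G : measurable_fun setT G -> (forall x, 0 <= G x)%E ->
    (\int[lebesgue_rV n]_x G x = \int[lebesgue_rV n]_x G (- refl a x)%R)%E.
  move=> mG G0.
  have mGn : measurable_fun setT (fun y => G (- refl a y)).
    exact: (measurableT_comp mG (measurable_opp_refl a)).
  set c := (\int[lebesgue_rV n]_x h x)%E in hpos hfin *.
  have cf : c \is a fin_num by rewrite (ge0_fin_numE (ltW hpos)).
  suff E : (c * \int[lebesgue_rV n]_x G x = c * \int[lebesgue_rV n]_x G (- refl a x)%R)%E.
    have c0 : fine c != 0 by rewrite gt_eqF// fine_gt0// hpos.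
    have : ((fine c)^-1%:E * (c * \int[lebesgue_rV n]_x G x) =
      (fine c)^-1%:E * (c * \int[lebesgue_rV n]_x G (- refl a x)%R))%E by rewrite E.
    by rewrite !muleA -(fineK cf) -EFinM mulVf// !mul1e.
  pose f1 (z : 'rV[R]_n * 'rV[R]_n) : \bar R := (G z.1 * h (z.2 + refl a z.1)%R)%E.
  pose f2 (z : 'rV[R]_n * 'rV[R]_n) : \bar R := (h z.1 * G (z.1 - refl a z.2)%R)%E.
  have mf1 : measurable_fun setT f1.
    apply: emeasurable_funM; first exact: (measurableT_comp mG).
    apply: (measurableT_comp mh); apply: measurable_rV_add => //.
    exact: (measurableT_comp mr).
  have mf2 : measurable_fun setT f2.
    apply: emeasurable_funM; first exact: (measurableT_comp mh).
    apply: (measurableT_comp mG); apply: measurable_rV_add => //.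
    exact: (measurableT_comp (measurable_opp_refl a)).
  have f10 z : (0 <= f1 z)%E by rewrite mule_ge0.
  have f20 z : (0 <= f2 z)%E by rewrite mule_ge0.
  have T1 := @fubini_tonelli _ _ _ _ R (lebesgue_rV n) (lebesgue_rV n) f1 mf1 f10.
  have T2 := @fubini_tonelli _ _ _ _ R (lebesgue_rV n) (lebesgue_rV n) f2 mf2 f20.
  transitivity (\int[lebesgue_rV n]_x \int[lebesgue_rV n]_y f1 (x, y))%E.
    rewrite -(Zl c G mG G0 (ltW hpos)).
    apply: eq_integral => x _.
    have mhx : measurable_fun setT (fun y => h (y + refl a x)).
      by apply: (measurableT_comp mh); exact: measurable_rV_add.
    transitivity (G x * \int[lebesgue_rV n]_y h (y + refl a x)%R)%E.
      by rewrite -(integral_rV_translate (refl a x) mh h0) muleC.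
    by rewrite -(Zl (G x) _ mhx (fun y => h0 _) (G0 x)).
  rewrite T1; transitivity (\int[lebesgue_rV n]_y \int[lebesgue_rV n]_x f2 (x, y))%E.
    apply: eq_integral => y _.
    have mf1y : measurable_fun setT (fun x => f1 (x, y)).
      exact: (measurableT_comp mf1 (pair2_measurable y)).
    rewrite (integral_rV_translate (- refl a y) mf1y (fun x => f10 _)).
    apply: eq_integral => x _.
    rewrite /f1 /f2 /= muleC; congr (_ * _)%E.
    by rewrite -[LHS]hE refl_shift.
  have K0 : (0 <= \int[lebesgue_rV n]_x G (- refl a x)%R)%E by apply: integral_ge0.
  rewrite -T2 muleC -(Zl _ h mh h0 K0); apply: eq_integral => x _.
  have mGx : measurable_fun setT (fun y => G (x - refl a y)).
    apply: (measurableT_comp mG); apply: measurable_rV_add.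
      exact: measurable_cst.
    exact: measurable_opp_refl.
  transitivity (h x * \int[lebesgue_rV n]_y G (x - refl a y)%R)%E.
    by rewrite -(Zl (h x) _ mGx (fun y => G0 _) (h0 x)).
  rewrite muleC; congr (_ * _)%E.
  rewrite (integral_rV_translate (refl a x) mGx (fun y => G0 _)).
  by apply: eq_integral => y _; rewrite refl_shiftN.
have neg : (\int[lebesgue_rV n]_x F x = \int[lebesgue_rV n]_x F (- x)%R)%E.
  have := @integral_rV_affine R n (-1) 0 F; rewrite oppr_eq0 oner_eq0 => /(_ isT mF F0) ->.
  rewrite normrN1 expr1n mul1e; apply: eq_integral => x _.
  by rewrite scaleN1r addr0.
have mFn : measurable_fun setT (fun x => F (- x)).
  apply: measurableT_comp => //.
  rewrite (_ : -%R = (fun x : 'rV[R]_n => (-1) *: x + 0)); first exact: measurable_rV_affine.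
  by apply/funext => x; rewrite scaleN1r addr0.
rewrite neg (key _ mFn)//; apply: eq_integral => x _.
by rewrite opprK.
Qed.

Lemma integral_act s F : norm2 s -> measurable_fun setT F -> (forall x, 0 <= F x)%E ->
  (\int[lebesgue_rV n]_x F (act s x) = \int[lebesgue_rV n]_x F x)%E.
Proof.
elim: s => [//|a s IH] /norm2_cons[aa ns] mF F0.
rewrite -[RHS]IH// -(integral_refl (F := fun x => F (act s x)) aa)//.
exact: (measurableT_comp mF (measurable_act s)).
Qed.

(** Each line in the direction [a] meets the hyperplane in one point; Tonelli's
theorem and translation invariance do the rest. *)
Lemma hyperplane_null a : a != 0 -> lebesgue_rV n [set x | dotp a x = 0] = 0%E.
Proof.
move=> a0; have aa : 0 < dotp a a by rewrite lt0r dotp_ge0 andbT; apply: contra_neq a0; exact: dotp_eq0.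
pose H := [set x | dotp a x = 0].
have mH : measurable H.
  rewrite -[H]setTI (_ : H = dotp a @^-1` [set 0])//.
  by apply: (@measurable_dotp R n a) => //; exact: measurable_set1.
pose I : set R := `[0, 1]%classic.
have mI : measurable I by exact: measurable_itv.
pose f (z : 'rV[R]_n * measurableTypeR R) : \bar R := (\1_H (z.1 + z.2 *: a))%:E.
have mz : measurable_fun setT (fun z : 'rV[R]_n * measurableTypeR R => z.1 + z.2 *: a).
  apply: measurable_rV_add => //; apply: measurable_fun_rVP => i.
  by under eq_fun do rewrite mxE; apply: measurable_funM.
have mf : measurable_fun setT f.
  apply/measurable_EFinP; apply: (measurableT_comp _ mz); exact: measurable_indic.
have f0 z : (0 <= f z)%E by rewrite lee_fin.
have T := @tonelli_rectangle _ _ _ _ R (lebesgue_rV n) (@lebesgue_measure R) setT I f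
  measurableT mI mf f0.
have R1 : (\int[@lebesgue_measure R]_(t in I) \int[lebesgue_rV n]_x f (x, t) = lebesgue_rV n H)%E.
  transitivity (\int[@lebesgue_measure R]_(t in I) lebesgue_rV n H)%E.
    apply: eq_integral => t _.
    have mind : measurable_fun setT (fun x => (\1_H x)%:E : \bar R).
      by apply/measurable_EFinP; exact: measurable_indic.
    transitivity (\int[lebesgue_rV n]_x (\1_H x)%:E)%E.
      by rewrite (integral_rV_translate (t *: a) mind).
    by rewrite integral_indic// setIT.
  have I1 : lebesgue_measure I = 1%E.
    by rewrite /I lebesgue_measure_itv/= lte_fin ltr01 -EFinB subr0.
  by rewrite integral_cst//= -[RHS]mule1; congr (_ * _)%E; exact: I1.
rewrite -[LHS]/(lebesgue_rV n H) -R1 -T integral0_eq// => x _.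
pose t0 := - dotp a x / dotp a a.
transitivity (\int[@lebesgue_measure R]_(t in I) (\1_[set t0] t)%:E)%E.
  apply: eq_integral => t _; rewrite /f /= !indicE; congr ((nat_of_bool _)%:R%:E).
  apply/idP/idP; rewrite !inE /H /= dotpDr dotpZr => h.
    rewrite /t0; apply: (mulIf (lt0r_neq0 aa)); rewrite divfK ?gt_eqF//.
    by apply/eqP; rewrite -addr_eq0 addrC h.
  by rewrite h /t0 divfK ?subrr ?gt_eqF// addrC addNr.
rewrite integral_indic//; apply/eqP; rewrite eq_le measure_ge0 andbT.
by rewrite -(lebesgue_measure_set1 t0); apply: le_measure; rewrite ?inE//; exact: measurableI.
Qed.
End isometry_invariance.

(** * Integrals over the whole space and over a chamber *)

Section weyl_integration.
Context {R : realType} {N : nat} (Phi Phip : {fset 'rV[R]_N}) (k : 'rV[R]_N -> R).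
Context (Phi_root : root_system Phi) (Phi_norm : forall a, a \in Phi -> enorm a ^+ 2 = 2).
Context (Phip_pos : positive_subsystem Phi Phip) (k_inv : invariant_multiplicity Phi k).
Implicit Types (a b x y z : 'rV[R]_N) (s : seq 'rV[R]_N).

Lemma positive_subset a : a \in Phip -> a \in Phi.
Proof. by have [E _ _] := Phip_pos => aP; have : [set` Phi] a by rewrite E; left. Qed.

Lemma positive_or_opp a : a \in Phi -> a \in Phip \/ - a \in Phip.
Proof.
have [E _ _] := Phip_pos => aP; have : [set` Phi] a by [].
by rewrite E => -[|[b bP <-]]; [left|right; rewrite opprK].
Qed.

Lemma multiplicity_refl a b : a \in Phi -> b \in Phi -> k (refl b a) = k a.
Proof.
move=> aP bP; have [_ kM] := k_inv.
rewrite -(kM a (wordmx [:: b]) aP); last first.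
  by apply/(reflection_groupP Phi_norm); exists [:: b] => // c; rewrite inE => /eqP->.
by rewrite (mulmx_word Phi_norm)// => c; rewrite inE => /eqP->.
Qed.

Lemma multiplicity_opp a : a \in Phi -> k (- a) = k a.
Proof.
by move=> aP; rewrite -(refl_self (root_dotp2 Phi_norm aP)) multiplicity_refl.
Qed.

(** The group permutes all the roots, but not the positive ones.  Opposite roots
give equal factors, which halves the exponents. *)
Lemma w_k_roots x : w_k Phip k x = \prod_(a <- Phi) `|dotp a x| `^ k a.
Proof.
have [_ dis _] := Phip_pos.
have PE : perm_eq Phi (enum_fset Phip ++ map -%R (enum_fset Phip)).
  apply: uniq_perm; first exact: fset_uniq.
    rewrite cat_uniq fset_uniq map_inj_uniq ?fset_uniq ?andbT; last exact: oppr_inj.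
    apply/hasPn => _ /mapP[b bP ->]; apply/negP => bP'.
    have : ([set` Phip] `&` -%R @` [set` Phip]) (- b) by split => //; exists b.
    by rewrite dis.
  move=> a; rewrite mem_cat; apply/idP/orP.
    move=> /positive_or_opp[->|bP]; [by left|right].
    by apply/mapP; exists (- a); rewrite ?opprK.
  move=> [/positive_subset//|/mapP[b bP ->]].
  by apply: (opp_Phi (root_dotp2 Phi_norm) (root_refl_closed Phi_root Phi_norm)); exact: positive_subset.
rewrite (perm_big _ PE) big_cat big_map /=.
transitivity (\prod_(a <- Phip) (`|dotp a x| `^ k a * `|dotp (- a) x| `^ k (- a))); last by rewrite big_split.
apply: eq_big_seq => a aP /=.
rewrite multiplicity_opp; last exact: positive_subset.
rewrite dotpNl normrN.
have [->|k0] := eqVneq (k a) 0; first by rewrite mulr0 !powRr0 mulr1.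
rewrite -powRD; last by rewrite -mulr2n mulrn_eq0/= (negPf k0).
by congr (_ `^ _); ring.
Qed.

Lemma w_k_act s x : {subset s <= Phi} -> w_k Phip k (act s x) = w_k Phip k x.
Proof.
elim: s x => [//|b s IH] x sP /=.
rewrite IH; last by move=> c cs; rewrite sP// inE cs orbT.
have bP : b \in Phi by exact: sP (mem_head _ _).
have bb := root_dotp2 Phi_norm bP.
have PE : perm_eq (map (refl b) (enum_fset Phi)) Phi.
  apply: uniq_perm; [|exact: fset_uniq|].
    by rewrite map_inj_uniq ?fset_uniq//; exact: inv_inj (reflK bb).
  move=> a; apply/mapP/idP => [[c cP ->]|aP]; first exact: root_refl_closed.
  by exists (refl b a); rewrite ?reflK//; exact: root_refl_closed.
rewrite !w_k_roots -[RHS](perm_big _ PE) big_map; apply: eq_big_seq => a aP /=.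
by rewrite dotp_reflC// multiplicity_refl.
Qed.

Context (eps : 'rV[R]_N -> R) (x0 : 'rV[R]_N).
Context (eps_sign : forall a, a \in Phip -> eps a = -1 \/ eps a = 1).
Context (x0W : signed_chamber Phip eps x0).

Lemma signed_chamber_regular : regular Phi x0.
Proof.
have reg b : b \in Phip -> dotp b x0 != 0.
  move=> bP; rewrite -sgr_eq0 x0W//.
  by have [->|->] := eps_sign bP; rewrite ?oppr_eq0 oner_eq0.
move=> a /positive_or_opp[|/reg]; first exact: reg.
by rewrite dotpNl oppr_eq0.
Qed.

Lemma signed_chamber_of : signed_chamber Phip eps = chamber_of Phi x0.
Proof.
apply/seteqP; split => x Wx a.
  move=> /andP[aP ax0]; have [bP|bP] := positive_or_opp aP.
    by have := Wx _ bP; rewrite -(x0W bP) (gtr0_sg ax0) => /eqP; rewrite sgr_cp0.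
  have := Wx _ bP; rewrite -(x0W bP) !dotpNl !sgrN (gtr0_sg ax0) => /oppr_inj/eqP.
  by rewrite sgr_cp0.
move=> aP; rewrite -(x0W aP); have aPhi := positive_subset aP.
have := signed_chamber_regular aPhi; rewrite neq_lt => /orP[h|h].
  have pa : positive Phi x0 (- a).
    rewrite /positive dotpNl oppr_gt0 h andbT.
    exact: (opp_Phi (root_dotp2 Phi_norm) (root_refl_closed Phi_root Phi_norm)).
  by have := Wx _ pa; rewrite dotpNl oppr_gt0 => h'; rewrite !ltr0_sg.
have pa : positive Phi x0 a by rewrite /positive aPhi h.
by have := Wx _ pa => h'; rewrite !gtr0_sg.
Qed.

Lemma negligible_nonregular : (lebesgue_rV N).-negligible (~` [set x | regular Phi x]).
Proof.
have sub : ~` [set x | regular Phi x] `<=` [set x | exists2 a, a \in enum_fset Phi & dotp a x = 0].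
  move=> x nr; apply: contrapT => h; apply: nr => a aP; apply/eqP => e.
  by apply: h; exists a.
apply: negligibleS sub _.
have : {subset enum_fset Phi <= Phi} by [].
elim: (enum_fset Phi) => [_|a s IH sP].
  rewrite (_ : [set x | _] = set0); first exact: negligible_set0.
  by apply/seteqP; split => // x [].
rewrite (_ : [set x | _] = [set x | dotp a x = 0] `|`
    [set x | exists2 b, b \in s & dotp b x = 0]); last first.
  apply/seteqP; split => x.
    move=> [b]; rewrite inE => /orP[/eqP->|bs] e; [by left|right; by exists b].
  move=> [e|[b bs e]]; [exists a => //|exists b => //]; first exact: mem_head.
  by rewrite inE bs orbT.
apply: negligibleU; last by apply: IH => b bs; rewrite sP// inE bs orbT.
have aP : a \in Phi by exact: sP (mem_head _ _).
have a0 : a != 0.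
  apply/eqP => a0; have := root_dotp2 Phi_norm aP.
  by rewrite a0 dotp0r => /eqP; rewrite eq_sym (pnatr_eq0 _ 2).
exists [set x | dotp a x = 0]; split => //; last exact: hyperplane_null.
rewrite -[X in measurable X]setTI (_ : [set x | _] = dotp a @^-1` [set 0])//.
by apply: (@measurable_dotp R N a) => //; exact: measurable_set1.
Qed.

(** The images of the chamber tile the space up to a null set. *)
Lemma integral_chamber (F : 'rV[R]_N -> \bar R) : open (signed_chamber Phip eps) ->
  measurable_fun setT F -> (forall x, 0 <= F x)%E ->
  (forall s x, {subset s <= Phi} -> F (act s x) = F x) ->
  (\int[lebesgue_rV N]_x F x =
   (group_order Phi)%:R%:E * \int[lebesgue_rV N]_(x in signed_chamber Phip eps) F x)%E.
Proof.
move=> oW mF F0 FG; set W := signed_chamber Phip eps.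
have mW : measurable W by exact: open_rV_measurable.
pose FW := F \_ W.
have mFW : measurable_fun setT FW.
  by apply: (measurable_restrictT _ mW).1; exact: measurable_funTS.
have FW0 x : (0 <= FW x)%E by apply: erestrict_ge0.
have gfin := reflection_group_finite Phi_root Phi_norm signed_chamber_regular.
pose G := fset_set (reflection_group Phi).
have Gword M : M \in G -> exists2 s, {subset s <= Phi} & forall x, x *m M = act s x.
  rewrite in_fset_set// inE => /(reflection_groupP Phi_norm)[s sP ->].
  by exists s => // x; rewrite (mulmx_word Phi_norm).
have mFM M : measurable_fun setT (fun x : 'rV[R]_N => FW (x *m M)).
  apply: measurableT_comp => //; apply: measurable_fun_rVP => i.
  have := measurable_dotp (\row_j M j i); congr (measurable_fun _ _).
  by apply/funext => x; rewrite mxE dotpC; apply: eq_bigr => j _; rewrite mxE.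
transitivity (\int[lebesgue_rV N]_x \sum_(M <- G) FW (x *m M))%E.
  apply: ge0_ae_eq_integral => //.
  - exact: emeasurable_sum.
  - by move=> x _; apply: sume_ge0.
  apply: negligibleS negligible_nonregular => x /= h rx; apply: h => _.
  rewrite -(sum_chamber Phi_root Phi_norm signed_chamber_regular (F x) rx).
  rewrite big_seq [RHS]big_seq; apply: eq_bigr => M /Gword[s sP sE].
  by rewrite -signed_chamber_of -/W /FW patchE sE FG.
rewrite ge0_integral_sum//.
transitivity (\sum_(M <- G) \int[lebesgue_rV N]_x FW x)%E.
  rewrite big_seq [RHS]big_seq; apply: eq_bigr => M /Gword[s sP sE].
  under eq_integral do rewrite sE.
  by apply: integral_act => //; exact: word_norm2 Phi_norm _ sP.
rewrite big_const_seq count_predT -/(group_order Phi) [X in (_ * X)%E]integral_mkcond -/FW.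
have I0 : (0 <= \int[lebesgue_rV N]_x FW x)%E by apply: integral_ge0.
rewrite /group_order -/G; elim: (size (enum_fset G)) => [|m IH] /=; first by rewrite mul0e.
by rewrite IH -[m.+1%:R]nat1r EFinD ge0_muleDl// ?mul1e.
Qed.

Lemma group_order_gt0 : (0 < group_order Phi)%N.
Proof.
have gfin := reflection_group_finite Phi_root Phi_norm signed_chamber_regular.
rewrite /group_order cardfs_gt0; apply/fset0Pn; exists 1%:M.
by rewrite in_fset_set// inE; apply/(reflection_groupP Phi_norm); exists [::].
Qed.
Lemma M_k_chamber : cone_weight (signed_chamber Phip eps) (w_k Phip k) (2 * gamma_k Phip k) ->
  M_k Phip k = (group_order Phi)%:R *
    fine (wint (signed_chamber Phip eps) (w_k Phip k) (fun x => expR (- (enorm x ^+ 2 / 2)))).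
Proof.
move=> cw; rewrite /M_k /int_mu_k.
have -> := @integral_chamber (fun x => (expR (- (enorm x ^+ 2 / 2)) * w_k Phip k x)%:E).
- have g0 : 0 < (group_order Phi)%:R :> R by rewrite ltr0n group_order_gt0.
  rewrite /wint; case: (\int[_]_(x in _) _)%E => [r| |]//=.
    by rewrite gt0_muley ?lte_fin//= mulr0.
  by rewrite gt0_muleNy ?lte_fin//= mulr0.
- exact: cw_open cw.
- apply/measurable_EFinP; apply: measurable_funM; last exact: (cw_meas cw).
  apply: (measurableT_comp (@measurable_expR R)); apply: measurable_funN.
  apply: measurable_funM => //; apply: measurable_funX; exact: measurable_enorm.
- by move=> x; rewrite lee_fin mulr_ge0 ?expR_ge0// (cw_ge0 cw).
- move=> s x sP; rewrite w_k_act// /enorm dotp_act//.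
  exact: (word_norm2 Phi_norm sP).
Qed.

End weyl_integration.

(** * The best constant in terms of the Gamma function *)

Section main_constant.
Context {R : realType} {n : nat} (Phi Phip : {fset 'rV[R]_n.+1}) (k : 'rV[R]_n.+1 -> R).
Context (Phi_root : root_system Phi) (Phi_norm : forall a, a \in Phi -> enorm a ^+ 2 = 2).
Context (Phip_pos : positive_subsystem Phi Phip) (k_inv : invariant_multiplicity Phi k).
Context (eps : 'rV[R]_n.+1 -> R) (eps_sign : forall a, a \in Phip -> eps a = -1 \/ eps a = 1).
Local Notation W := (signed_chamber Phip eps).
Local Notation D := (n.+1%:R + 2 * gamma_k Phip k).
Context (W0 : W !=set0).

Let cw : cone_weight W (w_k Phip k) (2 * gamma_k Phip k).
Proof.
apply: signed_chamber_cone_weight => // a /(positive_subset Phip_pos) aP.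
by have [k0 _] := k_inv; exact: k0.
Qed.

Let D0 : 0 < D.
Proof. by rewrite ltr_wpDr// (cw_degree cw). Qed.

Lemma M_kE : M_k Phip k = (group_order Phi)%:R *
  (fine (sector_mass W (w_k Phip k)) * 2 `^ (D / 2) * (D / 2 * Gamma (D / 2))).
Proof.
have [x0 x0W] := W0.
rewrite (M_k_chamber Phi_root Phi_norm Phip_pos k_inv eps_sign x0W cw); congr (_ * _).
have -> : (fun x : 'rV[R]_n.+1 => expR (- (enorm x ^+ 2 / 2))) =
    (fun x => expR (- (2^-1 * enorm x `^ 2%:R))).
  by apply/funext => x; rewrite powR_mulrn ?enorm_ge0// mulrC.
rewrite (wint_exp_power cw W0 D0)// ?invr_gt0//=.
have inv2 : (2^-1 : R) = 2 `^ (-1) by rewrite powR_inv1.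
have D2 : 0 < D / 2 by exact: divr_gt0.
by rewrite [X in _ * X `^ _]inv2 -powRrM mulN1r opprK GammaS.
Qed.

(** [M_kE] eliminates the mass of the unit ball sector, which is common to the
Gaussian integral and to the extremal mass. *)
Lemma extremal_mass_inv (p p' : R) : 1 < p -> p < D -> p^-1 + p'^-1 = 1 ->
  (extremal_mass W (w_k Phip k) D p')^-1 =
  2 `^ (D / 2 - 1) * p' * (group_order Phi)%:R / M_k Phip k
      * (Gamma D * Gamma (D / 2) / (Gamma (D / p) * Gamma (D / p'))).
Proof.
move=> p1 pD pp'; have p'E := conjugate_exponentE p1 pp'.
have p0 : 0 < p by exact: lt_trans p1.
have p'0 : 0 < p' by rewrite p'E divr_gt0// subr_gt0.
have [x0 x0W] := W0.
have g0 : 0 < (group_order Phi)%:R :> R.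
  by rewrite ltr0n (group_order_gt0 Phi_root Phi_norm Phip_pos eps_sign x0W).
rewrite (extremal_massE cw W0 (erefl D) p1 pD pp') M_kE GammaS ?divr_gt0//.
have V0 : 0 < fine (sector_mass W (w_k Phip k)).
  by rewrite fine_gt0// (sector_mass_gt0 cw W0) (sector_mass_lty cw).
have G1 : 0 < Gamma (D / p') by rewrite Gamma_gt0// divr_gt0.
have G2 : 0 < Gamma (D / p) by rewrite Gamma_gt0// divr_gt0.
have G3 : 0 < Gamma (D / 2) by rewrite Gamma_gt0// divr_gt0.
have G4 : 0 < Gamma D by rewrite Gamma_gt0.
have -> : 2 `^ (D / 2) = 2 `^ (D / 2 - 1) * 2 :> R.
  have : 2 `^ (D / 2 - 1 + 1) = 2 `^ (D / 2 - 1) * 2 `^ 1 :> R.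
    by rewrite powRD// (pnatr_eq0 _ 2) implybT.
  by rewrite subrK powRr1.
have P0 : 0 < 2 `^ (D / 2 - 1) :> R by exact: powR_gt0.
have alg (d V a b c e P G : R) : 0 < d -> 0 < V -> 0 < a -> 0 < b -> 0 < c -> 0 < e ->
    0 < P -> 0 < G ->
    (V * (d / p' * a) * b / e)^-1 =
    P * p' * G / (G * (V * (P * 2) * (d / 2 * c))) * (e * c / (b * a)).
  by move=> *; field; rewrite !gt_eqF.
exact: alg.
Qed.
End main_constant.

Theorem proposition6p5 (R : realType) (N : nat)
    (Phi Phip : {fset 'rV[R]_N}) (k eps : 'rV[R]_N -> R) (p q p' : R)
    (N_ge1 : (1 <= N)%N)
    (Phi_root : root_system Phi)
    (Phi_norm : forall a, a \in Phi -> enorm a ^+ 2 = 2)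
    (Phip_pos : positive_subsystem Phi Phip)
    (k_inv : invariant_multiplicity Phi k)
    (eps_sign : forall a, a \in Phip -> eps a = -1 \/ eps a = 1)
    (W_chamber : weyl_chamber Phi (signed_chamber Phip eps))
    (p_gt1 : 1 < p)
    (p_lt : p < N%:R + 2 * gamma_k Phip k)
    (q_def : q = p * (N%:R + 2 * gamma_k Phip k)
                 / (N%:R + 2 * gamma_k Phip k - p))
    (p'_def : 1 / p + 1 / p' = 1) :
  let d : R := N%:R + 2 * gamma_k Phip k in
  sobolev_best_constant Phip k (signed_chamber Phip eps) p q =
  (d `^ (- (1 / p)) * ((p - 1) / (d - p)) `^ (1 / p')
   * (2 `^ (d / 2 - 1) * p' * (group_order Phi)%:R / M_k Phip k
      * (Gamma d * Gamma (d / 2) / (Gamma (d / p) * Gamma (d / p'))))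
     `^ (1 / d))%:E.
Proof.
case: N N_ge1 Phi Phip k eps Phi_root Phi_norm Phip_pos k_inv eps_sign W_chamber p_lt q_def =>
  [//|n] _ Phi Phip k eps Phi_root Phi_norm Phip_pos k_inv eps_sign W_chamber p_lt q_def d.
have W0 := weyl_chamber_neq0 W_chamber.
have pp' : p^-1 + p'^-1 = 1 by rewrite -p'_def !div1r.
have cw : cone_weight (signed_chamber Phip eps) (w_k Phip k) (2 * gamma_k Phip k).
  apply: signed_chamber_cone_weight => // a /(positive_subset Phip_pos) aP.
  by have [k0 _] := k_inv; exact: k0.
rewrite q_def (sobolev_best_constantE cw W0 (erefl _) p_gt1 p_lt pp') /sharp_constant.
rewrite -(extremal_mass_inv Phi_root Phi_norm Phip_pos k_inv eps_sign W0 p_gt1 p_lt pp').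
have J0 := extremal_mass_gt0 cw W0 (erefl _) p_gt1 p_lt pp'.
by rewrite !div1r -[in RHS](powR_inv1 (ltW J0)) -powRrM mulN1r.
Qed.
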